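(* Let $(\mathcal X,\mathcal A,P)$ be a probability space, $X_1,X_2,\ldots$ independent random elements with distribution $P$, $\mathcal F$ a collection of measurable functions $\mathcal X\to\mathbb R$, and, for each $n$, $h_n:\mathcal X\to\mathbb R^{d_n}$ a feature map with leverage function $q_n$; let $L_f$, $\beta_{n,f}$, $\hat\beta_{n,f}$, $\varepsilon_{n,f}$, $M_n$, $\gamma_n^2$, $L_n^2$ be as defined in the context. Assume: (1) at least one of the following holds: (a) $P(q_n^2)=o(n)$ and $\log(\|q_n\|_\infty)=O(\log n)$ as $n\to\infty$; (b) $\|q_n\|_\infty\log(2d_n)=o(n)$ as $n\to\infty$; (2) $\mathcal F$ is at most countably infinite and admits an envelope $F:\mathcal X\to[0,\infty)$, i.e. $|f(x)|\le F(x)$ for all $f\in\mathcal F$, $x\in\mathcal X$, with $\|F\|_\infty<\infty$; (3) $\mathcal F$ is a VC-class of parameters $(v,A)\in(0,\infty)\times[1,\infty)$ with respect to the envelope $F$. Then there is a universal constant $K>0$ such that, with $$a_n=\frac{32A\,\|F\|_\infty\,\|q_n\|_\infty^{1/2}}{(D_n^* )^{1/(4v)}},\qquad D_n^*=\exp\left[\left\{\left(\frac{2n}{K\log n}\right)^{2/3}-w\right\}\log n\right],\qquad w=(4v)\vee 1,$$ one has $a_n=o(\exp\{-n^{2/3}\})$ as $n\to\infty$ and $$\sup_{f\in\mathcal F}\left\{L_f(\hat\beta_{n,f})-L_f(\beta_{n,f})\right\}=O_{\mathbb P}\left(\left\{\gamma_n^2\vee\left(\tau_n r_n^{1/2}\right)\right\}r_n\right),\qquad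 n\to\infty,$$ where $$\tau_n=L_n^2\left(1\vee(a_n/M_n)\right),\qquad r_n=1\wedge\left[\frac{\log n}{n}\left\{1+\left(\frac{(\log M_n^{-1})_+}{\log n}\right)^{3/2}\right\}\right].$$
   Context: Notation: $P(g)=\int g\,\mathrm dP$ and $P_n(g)=\frac1n\sum_{i=1}^n g(X_i)$ for real-, vector- or matrix-valued $g$; $\|g\|_\infty=\sup_{x\in\mathcal X}|g(x)|$; $a\vee b=\max(a,b)$, $a\wedge b=\min(a,b)$, $(a)_+=a\vee0$; ${}^\top$ is transposition. Feature maps: for each $n$, $d_n\ge1$ is an integer (it may tend to infinity) and $h_n=(h_{n,1},\dots,h_{n,d_n})^\top:\mathcal X\to\mathbb R^{d_n}$ is measurable with square-integrable components and invertible Gram matrix $P(h_nh_n^\top)$. The leverage function is $q_n(x)=h_n(x)^\top P(h_nh_n^\top)^{-1}h_n(x)$, and $\|q_n\|_\infty<\infty$. Regression quantities: $L_f(b)=P[(f-h_n^\top b)^2]$ for $b\in\mathbb R^{d_n}$; $\beta_{n,f}=P(h_nh_n^\top)^{-1}P(h_nf)$ is the minimizer of $L_f$; $\varepsilon_{n,f}=f-h_n^\top\beta_{n,f}$; $\hat\beta_{n,f}=P_n(h_nh_n^\top)^{-1}P_n(h_nf)$ is the ordinary least squares estimator (a pseudo-inverse is used if $P_n(h_nh_n^\top)$ is not invertible). Further, $M_n=\sup_{f\in\mathcal F}\|\varepsilon_{n,f}\|_\infty$, $\gamma_n^2=\sup_{f\in\mathcal F}P(q_n\varepsilon_{n,f}^2)$,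 $L_n^2=M_n^2\|q_n\|_\infty$. If $M_n=0$, $\tau_n$ is read as $M_n\|q_n\|_\infty(M_n\vee a_n)=0$ and $r_n$ as $1$. VC-class: for a subset $\mathcal F$ of a metric space $(\mathcal Y,\rho)$, $\mathcal N(\mathcal F,\rho,\eta)$ is the smallest number of open $\rho$-balls of radius $\eta$ with centers in $\mathcal Y$ needed to cover $\mathcal F$. A class $\mathcal F$ of real functions on $(\mathcal X,\mathcal A)$ is a VC-class of parameters $(v,A)\in(0,\infty)\times[1,\infty)$ with respect to the envelope $F$ if $\mathcal N(\mathcal F,L^2(Q),\eta\|F\|_{L^2(Q)})\le(A/\eta)^v$ for every $0<\eta<1$ and every probability measure $Q$ on $(\mathcal X,\mathcal A)$. $Y_n=O_{\mathbb P}(c_n)$ means: for every $\epsilon>0$ there is $C>0$ with $\limsup_{n\to\infty}\mathbb P(|Y_n|>c_nC)\le\epsilon$. *)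

(* Defs.v *)
From HB Require Import structures.
From mathcomp Require Import all_boot all_order all_algebra.
From mathcomp Require Import finmap.
From mathcomp Require Import all_classical all_reals all_analysis.

Set Implicit Arguments.
Unset Strict Implicit.
Unset Printing Implicit Defensive.

Import Order.TTheory GRing.Theory Num.Theory.
Import numFieldNormedType.Exports.

Local Open Scope classical_set_scope.
Local Open Scope ring_scope.

(* Supremum of a nonnegative function, taken in [0, +oo]: over the empty set it
   is 0, not -oo as for [ereal_sup]. *)
Definition nnsup (R : realType) (T : Type) (D : set T) (g : T -> \bar R) :
  \bar R := ereal_sup (0%E |` (g @` D)).

Definition supnorm (R : realType) (T : Type) (g : T -> R) : \bar R :=
  nnsup setT (fun x => `|g x|%:E).

Definition mutually_independent (R : realType)
    (dO : measure_display) (Omega : measurableType dO)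
    (Pr : probability Omega R) (d : measure_display) (X : measurableType d)
    (Xs : nat -> Omega -> X) : Prop :=
  forall (J : {fset nat}) (B : nat -> set X),
    (forall i, measurable (B i)) ->
    (Pr (\bigcap_(i in [set` J]) (Xs i @^-1` B i)) =
     \prod_(i <- J) Pr (Xs i @^-1` B i))%E.

(* Indexing starts at 0: [Xs i] is X_{i+1}. *)
Definition iid_sample (R : realType)
    (dO : measure_display) (Omega : measurableType dO)
    (Pr : probability Omega R) (d : measure_display) (X : measurableType d)
    (P : probability X R) (Xs : nat -> Omega -> X) : Prop :=
  [/\ forall i, measurable_fun setT (Xs i),
      forall i (B : set X), measurable B -> Pr (Xs i @^-1` B) = P B &
      mutually_independent Pr Xs].

(* The probability of the tail event is taken as the outer measure [Pr^*],
   which is [Pr] on measurable events ([measurable_mu_extE]); [Pr] itself is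
   unspecified on nonmeasurable sets. *)
Definition bigO_P (R : realType)
    (dO : measure_display) (Omega : measurableType dO)
    (Pr : probability Omega R) (Y : nat -> Omega -> \bar R) (c : nat -> R) :
    Prop :=
  forall eps : R, 0 < eps -> exists2 C : R, 0 < C &
    (limn_esup (fun n => (Pr^*)%mu [set w | (c n * C)%:E < `|Y n w|])
       <= eps%:E)%E.

Definition covering_number (R : realType) (T : Type) (Y : set T)
    (rho : T -> T -> \bar R) (S : set T) (eta : \bar R) : \bar R :=
  ereal_inf [set k%:R%:E | k in [set k : nat |
    exists2 c : 'I_k -> T, (forall i, Y (c i)) &
      S `<=` \bigcup_(i in setT) [set f | (rho (c i) f < eta)%E]]].

Definition L2norm (R : realType) (d : measure_display) (X : measurableType d)
    (Q : probability X R) (g : X -> R) : \bar R :=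
  ('N[Q]_2%:E[EFin \o g])%E.

(* The balls are open and Q is arbitrary: when the L2(Q) norm of the envelope
   is 0 the radius is 0, and the covering number of a nonempty class is +oo. *)
Definition VC_class (R : realType) (d : measure_display) (X : measurableType d)
    (Fam : set (X -> R)) (Fenv : X -> R) (v A : R) : Prop :=
  forall (Q : probability X R) (eta : R), 0 < eta < 1 ->
    (covering_number [set g | g \in Lfun Q 2%:E]
       (fun f g => L2norm Q (f \- g)%R) Fam (eta%:E * L2norm Q Fenv)
     <= ((A / eta) `^ v)%:E)%E.

Definition mean (R : realType) (d : measure_display) (X : measurableType d)
    (P : probability X R) (g : X -> R) : R := \int[P]_x g x.

Definition empirical_mean (R : realType) (X : Type) (n : nat) (xs : nat -> X)
    (g : X -> R) : R := n%:R^-1 * \sum_(i < n) g (xs i).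

(* [gram E h] and [cross E h f] are E(h h^T) and E(h f), entrywise, for E the
   functional g |-> P(g) or g |-> P_n(g). *)
Definition gram (R : realType) (X : Type) (m : nat) (E : (X -> R) -> R)
    (h : X -> 'cV[R]_m) : 'M[R]_m :=
  \matrix_(i, j) E (fun x => h x i 0 * h x j 0).

Definition cross (R : realType) (X : Type) (m : nat) (E : (X -> R) -> R)
    (h : X -> 'cV[R]_m) (f : X -> R) : 'cV[R]_m :=
  \col_i E (fun x => h x i 0 * f x).

Definition dotmul (R : realType) (m : nat) (u b : 'cV[R]_m) : R :=
  (u^T *m b) 0 0.

Section regression.
Context (R : realType) (d : measure_display) (X : measurableType d).
Context (P : probability X R) (m : nat) (h : X -> 'cV[R]_m).
Implicit Types (f : X -> R) (b : 'cV[R]_m) (Fam : set (X -> R)).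

Definition leverage (x : X) : R :=
  dotmul (h x) (invmx (gram (mean P) h) *m h x).

Definition feature_map : Prop :=
  [/\ (0 < m)%N,
      forall i, (fun x => h x i 0) \in Lfun P 2%:E,
      gram (mean P) h \in unitmx &
      (supnorm leverage < +oo)%E].

Definition leverage_sup : R := fine (supnorm leverage).

Definition risk f b : R := mean P (fun x => (f x - dotmul (h x) b) ^+ 2).

Definition beta f : 'cV[R]_m :=
  invmx (gram (mean P) h) *m cross (mean P) h f.

Definition resid f (x : X) : R := f x - dotmul (h x) (beta f).

Definition resid_sup Fam : R := fine (nnsup Fam (fun f => supnorm (resid f))).

Definition gamma2 Fam : R :=
  fine (nnsup Fam (fun f => \int[P]_x (leverage x * resid f x ^+ 2)%:E))%E.

Definition L2const Fam : R := resid_sup Fam ^+ 2 * leverage_sup.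

(* Any generalized inverse is an inverse on invertible matrices, so [pinv] only
   matters for singular empirical Gram matrices. *)
Definition ols (pinv : 'M[R]_m -> 'M[R]_m) (n : nat) (xs : nat -> X) f :
    'cV[R]_m :=
  pinv (gram (empirical_mean n xs) h) *m cross (empirical_mean n xs) h f.

Definition excess_risk_sup (pinv : 'M[R]_m -> 'M[R]_m) (n : nat)
    (xs : nat -> X) Fam : \bar R :=
  nnsup Fam (fun f => (risk f (ols pinv n xs f) - risk f (beta f))%:E).

End regression.

Definition pseudo_inverse (R : realType)
    (pinv : forall m, 'M[R]_m -> 'M[R]_m) : Prop :=
  forall m (B : 'M[R]_m), B *m pinv m B *m B = B.

Section rates.
Context (R : realType).
Implicit Types (K v A Fsup qsup M a : R) (n : nat).

Definition Dstar K v n : R :=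
  expR (((2 * n%:R / (K * ln n%:R)) `^ (2 / 3) - Num.max (4 * v) 1)
        * ln n%:R).

Definition a_rate K v A Fsup qsup n : R :=
  32 * A * Fsup * Num.sqrt qsup / Dstar K v n `^ (4 * v)^-1.

(* The case M = 0 is a convention, here and in [r_rate]. *)
Definition tau_rate M (L2 : R) a : R :=
  if M == 0 then 0 else L2 * Num.max 1 (a / M).

Definition r_rate M n : R :=
  if M == 0 then 1 else
  Num.min 1 (ln n%:R / n%:R *
             (1 + (Num.max (ln M^-1) 0 / ln n%:R) `^ (3 / 2))).

End rates.

(* Main.v *)
Require Import Defs.
From HB Require Import structures.
From mathcomp Require Import all_boot all_order all_algebra.
From mathcomp Require Import finmap.
From mathcomp Require Import all_classical all_reals all_analysis.
From mathcomp Require Import measurable_realfun lebesgue_integral.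
From mathcomp Require Import ring lra zify.
Set Implicit Arguments.
Unset Strict Implicit.
Unset Printing Implicit Defensive.
Import Order.TTheory GRing.Theory Num.Theory.
Import numFieldNormedType.Exports.
Local Open Scope classical_set_scope.
Local Open Scope ring_scope.

(* Whiten the features: if T G T^T = 1 for the Gram matrix G, then w = T h_n satisfies
   |w|^2 = q_n and P(w w^T) = 1, and as long as the empirical Gram matrix of w is at least 1/2
   the excess risk of f is at most |(2/n) sum_i eps_f(X_i) w(X_i)|^2. The empirical Gram matrix is
   controlled by Chebyshev's inequality in Frobenius norm under (1a), and under (1b) by
   symmetrization and a bound on the trace moments of sum_i s_i w(X_i) w(X_i)^T for random signs s.
   The process sum_i eps_f(X_i) w(X_i) is centred; it is symmetrized, and conditionally on the sample
   Hoeffding's inequality for Euclidean vectors is combined with a union bound over a net. A first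
   pass on q_n eps_f^2 bounds the conditional variances by a multiple of gamma_n^2 + L_n^2 r_n^(1/2),
   a second one gives the deviation of the process itself; n r_n dominates the entropy of the net
   when r_n < 1, because log(1/M_n) is then at most n r_n up to constants. *)

(** * I.i.d. sequences *)

Section sequence_space.
Context d (X : measurableType d) (R : realType).

(** All events live on the space of sequences under the law of the sample: the ghost sample is then
    a later block of the same sequence, exchanging it with the sample is a permutation of
    coordinates, and an expectation over signs is an average over the finite list [signs n]. The
    dimension is the main obstacle. It must not enter the bound for the process, so Hoeffding's
    inequality is proved through the exponential moment of the squared norm, which does not see it.
    Under (1b) it enters only as the trace of the identity, which a moment of order log d_n hides.
    Log-convexity of j |-> |W^j v| stands in for spectral theory. The net has accuracy M_n / n on
    the residuals, so its log-size is affine in log n, log of the leverage bound and log(1/M_n). The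
    leverage term is O(log n): (1a) contains this and (1b) implies it. The last term is handled by y
    <= 1 + y^(3/2), which is how the exponent 3/2 of r_n is used. When r_n = 1, the deterministic
    bound |eps_f| |w| <= L_n already gives the rate off the bad Gram event. *)

Definition cylinder (n : nat) (B : nat -> set X) : set (nat -> X) :=
  [set x | forall i, (i < n)%N -> B i (x i)].

Definition cylinders : set (set (nat -> X)) :=
  [set C | exists n, exists2 B : nat -> set X,
    (forall i, measurable (B i)) & C = cylinder n B].

Definition sequences := g_sigma_algebraType cylinders.

Lemma setI_closed_cylinders : setI_closed cylinders.
Proof.
move=> _ _ [n [B mB ->]] [n' [B' mB' ->]].
pose C i := (if (i < n)%N then B i else setT) `&` (if (i < n')%N then B' i else setT).
exists (maxn n n'); exists C.
  by move=> i; apply: measurableI; case: ifP.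
apply/seteqP; split => x /=.
  by move=> [xB xB'] i _; split; case: ifP => // ?; [apply: xB|apply: xB'].
move=> xC; split => i lti.
  by have := xC i; rewrite leq_max lti => /(_ isT) []; rewrite lti.
by have := xC i; rewrite leq_max lti orbT => /(_ isT) [_]; rewrite lti.
Qed.

Lemma measurable_cylinder n (B : nat -> set X) :
  (forall i, measurable (B i)) -> measurable (cylinder n B : set sequences).
Proof. by move=> mB; apply: sub_sigma_algebra; exists n; exists B. Qed.

Lemma measurable_coord i : measurable_fun setT (fun x : sequences => x i).
Proof.
move=> _ B mB; rewrite setTI.
pose C j := if j == i then B else setT.
rewrite (_ : _ @^-1` _ = cylinder i.+1 C); last first.
  apply/seteqP; split => x /=.
    by move=> Bx j _; rewrite /C; case: eqP => // ->.
  by move/(_ i (ltnSn i)); rewrite /C eqxx.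
by apply: measurable_cylinder => j; rewrite /C; case: ifP.
Qed.

Lemma measurable_to_sequences d' (Y : measurableType d') (f : Y -> sequences) :
  (forall i, measurable_fun setT (fun y => f y i)) -> measurable_fun setT f.
Proof.
move=> mf; apply: (@measurability _ _ _ sequences _ _ cylinders) => //.
move=> _ [_ [n [B mB ->]] <-]; rewrite setTI.
have -> : f @^-1` cylinder n B = \bigcap_(i in `I_n) ((fun y => f y i) @^-1` B i).
  by apply/seteqP; split.
apply: bigcap_measurableType => i _.
by rewrite -[X in measurable X]setTI; exact: mf.
Qed.

(** This determines the product of countably many copies of [P]. No infinite product measure is
    constructed: the law of the given sample is an instance, see [iid_sample_law]. *)
Definition iid_law (P : probability X R) (nu : set sequences -> \bar R) :=
  forall n (B : nat -> set X), (forall i, measurable (B i)) ->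
    nu (cylinder n B) = (\prod_(i < n) P (B i))%E.

Lemma iid_law_unique (P : probability X R)
    (m1 m2 : {measure set sequences -> \bar R}) :
  iid_law P m1 -> iid_law P m2 ->
  forall A, measurable A -> m1 A = m2 A.
Proof.
move=> m1P m2P A mA.
have cT : setT = cylinder 0 (fun=> setT) by apply/seteqP; split.
apply: (@measure_unique _ R sequences cylinders (fun=> setT)) => //.
- exact: setI_closed_cylinders.
- by move=> _; rewrite cT; exists 0%N; exists (fun=> setT).
- by rewrite bigcup_const//; exists 0%N.
- by move=> _ [n [B mB ->]]; rewrite m1P// m2P.
- by move=> _; rewrite cT m1P// big_ord0 ltry.
Qed.

(* Splicing two independent i.i.d. sequences yields an i.i.d. sequence: this separates the
   sample from its ghost copy. *)
Definition splice (A : pred nat) (xy : sequences * sequences) : sequences :=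
  fun i => if A i then xy.1 i else xy.2 i.

Lemma measurable_splice A : measurable_fun setT (splice A).
Proof.
apply: measurable_to_sequences => i; rewrite /splice; case: (A i).
  by apply: (measurableT_comp (measurable_coord i)).
by apply: (measurableT_comp (measurable_coord i)).
Qed.

HB.instance Definition _ A := isMeasurableFun.Build _ _ _ _ (splice A) (measurable_splice A).

Lemma measurable_reindex (p : nat -> nat) :
  measurable_fun setT (fun x : sequences => (x \o p : sequences)).
Proof. by apply: measurable_to_sequences => i; exact: measurable_coord. Qed.

Section iid_law_theory.
Variables (P : probability X R) (nu : probability sequences R).
Hypothesis nuP : iid_law P nu.

(** The preimage of a cylinder is a rectangle: its constraints are distributed over the two factors
    according to [A], and the product of the probabilities is recovered. Cylinders form a pi-system
    that determines the measure. *)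
Lemma iid_law_splice A (C : set sequences) : measurable C ->
  (nu \x nu)%E (splice A @^-1` C) = nu C.
Proof.
move=> mC.
apply: (@iid_law_unique P (distribution (nu \x nu)%E (splice A)) nu) => //.
move=> n B mB.
pose B1 i := if A i then B i else setT.
pose B2 i := if A i then setT else B i.
have mB1 i : measurable (B1 i) by rewrite /B1; case: ifP.
have mB2 i : measurable (B2 i) by rewrite /B2; case: ifP.
rewrite /distribution /pushforward/=.
rewrite (_ : _ @^-1` _ = cylinder n B1 `*` cylinder n B2); last first.
  apply/seteqP; split => [[x y]|[x y] [/= xB yB] i lti] /=.
    rewrite /splice /cylinder/= => xyB; split => i lti; have := xyB i lti;
      by rewrite /B1 /B2; case: (A i).
  have := xB i lti; have := yB i lti.
  by rewrite /splice /B1 /B2/=; case: (A i).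
rewrite product_measure1E; [|exact: measurable_cylinder..].
transitivity ((\prod_(i < n) P (B1 i)) * (\prod_(i < n) P (B2 i)))%E.
  by congr (_ * _)%E; exact: nuP.
rewrite -big_split/=; apply: eq_bigr => i _.
rewrite /B1 /B2; case: (A i); rewrite probability_setT; [exact: mule1|exact: mul1e].
Qed.

Lemma iid_law_involution (p : nat -> nat) N (C : set sequences) :
  involutive p -> (forall i, (N <= i)%N -> p i = i) -> measurable C ->
  nu ((fun x : sequences => (x \o p : sequences)) @^-1` C) = nu C.
Proof.
move=> pK pN mC.
pose r : {mfun sequences >-> sequences} := HB.pack
  (fun x : sequences => (x \o p : sequences))
  (isMeasurableFun.Build _ _ _ _ (fun x : sequences => (x \o p : sequences))
     (measurable_reindex p)).
apply: (@iid_law_unique P (distribution nu r) nu) => //.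
move=> n B mB.
(* Beyond [N] the involution is the identity, so it permutes the indices below [m]; padding [B] with
   [setT] up to [m] leaves the cylinder unchanged. *)
pose m := maxn n N.
have pm i : (i < m)%N -> (p i < m)%N.
  move=> im; rewrite ltnNge; apply/negP => mpi.
  have /pN : (N <= p i)%N by rewrite (leq_trans _ mpi)// leq_maxr.
  by rewrite pK => ipi; move: im; rewrite ipi ltnNge mpi.
pose B' i := if (i < n)%N then B i else setT.
have mB' i : measurable (B' i) by rewrite /B'; case: ifP.
have cB : cylinder n B = cylinder m B'.
  apply/seteqP; split => x /= xB i lti.
    by rewrite /B'; case: ifPn => // /xB.
  by have := xB i; rewrite /B' lti; apply; rewrite (leq_trans lti)// leq_maxl.
rewrite -[LHS]/(nu ((fun x : sequences => (x \o p : sequences)) @^-1` cylinder n B)) cB.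
rewrite (_ : _ @^-1` _ = cylinder m (B' \o p)); last first.
  apply/seteqP; split => x /= xB i lti.
    by have := xB (p i) (pm _ lti); rewrite /= pK.
  by have /= := xB (p i) (pm _ lti); rewrite pK.
rewrite nuP; last by move=> i; exact: mB'.
transitivity (\prod_(i < m) P (B' i))%E.
  pose q (i : 'I_m) := Ordinal (pm i (ltn_ord i)).
  rewrite (reindex_inj (h := q))/=; last first.
    by apply: (can_inj (g := q)) => i; apply/val_inj => /=; rewrite pK.
  by apply: eq_bigr => i _; rewrite pK.
by rewrite -nuP// -cB nuP.
Qed.

Lemma iid_law_coord i (B : set X) : measurable B ->
  nu ((fun x : sequences => x i) @^-1` B) = P B.
Proof.
move=> mB; pose C j := if j == i then B else setT.
rewrite (_ : _ @^-1` _ = cylinder i.+1 C); last first.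
  apply/seteqP; split => x /=.
    by move=> Bx j _; rewrite /C; case: eqP => // ->.
  by move/(_ i (ltnSn i)); rewrite /C eqxx.
rewrite nuP; last by move=> j; rewrite /C; case: ifP.
rewrite big_ord_recr/= /C eqxx big1 ?mul1e// => j _.
by rewrite ltn_eqF// probability_setT.
Qed.

Lemma ge0_integral_coord i (f : X -> \bar R) : measurable_fun setT f ->
  (forall x, 0 <= f x)%E ->
  (\int[nu]_x f (x i) = \int[P]_x f x)%E.
Proof.
move=> mf f0.
pose r : {mfun sequences >-> X} := HB.pack
  (fun x : sequences => x i)
  (isMeasurableFun.Build _ _ _ _ (fun x : sequences => x i)
     (measurable_coord i)).
have -> : (\int[P]_x f x = \int[distribution nu r]_x f x)%E.
  by apply: eq_measure_integral => B mB _; rewrite -[LHS](iid_law_coord i mB).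
by rewrite ge0_integral_pushforward.
Qed.

Lemma ge0_integral_splice A (f : sequences -> \bar R) :
  measurable_fun setT f -> (forall x, 0 <= f x)%E ->
  (\int[nu]_x f x = \int[nu]_x \int[nu]_y f (splice A (x, y)))%E.
Proof.
move=> mf f0.
have -> : (\int[nu]_x f x = \int[distribution (nu \x nu) (splice A)]_x f x)%E.
  by apply: eq_measure_integral => C mC _; rewrite -[LHS](iid_law_splice A mC).
rewrite ge0_integral_pushforward//=.
rewrite fubini_tonelli1//.
by apply: measurableT_comp => //; exact: measurable_splice.
Qed.

(** Induction on [n]: after splicing, the first [n] coordinates are frozen and the last one is an
    independent draw, so the cross term integrates to zero by centring. *)
Lemma integral_sqr_sum (f : X -> R) n :
  P.-integrable setT (EFin \o f) -> (\int[P]_x (f x)%:E = 0)%E ->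
  P.-integrable setT (EFin \o (fun x => f x ^+ 2)) ->
  (\int[nu]_x ((\sum_(i < n) f (x i)) ^+ 2)%:E =
   n%:R%:E * \int[P]_x (f x ^+ 2)%:E)%E.
Proof.
move=> if1 f0 if2.
have mf : measurable_fun setT f by apply/measurable_EFinP; case/integrableP : if1.
have mS k : measurable_fun setT (fun x : sequences => \sum_(i < k) f (x i)).
  apply: measurable_sum => i.
  exact: (measurableT_comp mf (measurable_coord i)).
elim: n => [|n IH].
  rewrite mul0e integral0_eq// => x _.
  by rewrite big_ord0 expr0n.
rewrite (@ge0_integral_splice (fun i => (i < n)%N)); last 2 first.
- by apply/measurable_EFinP; apply: measurable_funX; exact: mS.
- by move=> x; rewrite lee_fin sqr_ge0.
have inner (x : sequences) : (\int[nu]_y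
    ((\sum_(i < n.+1) f (splice (fun i => (i < n)%N) (x, y) i)) ^+ 2)%:E =
    ((\sum_(i < n) f (x i)) ^+ 2)%:E + \int[P]_y (f y ^+ 2)%:E)%E.
  pose c := \sum_(i < n) f (x i).
  under eq_integral => y _.
    rewrite big_ord_recr/= (eq_bigr (fun i : 'I_n => f (x i))); last first.
      by move=> i _; rewrite /splice/= ltn_ord.
    rewrite -/c {1}/splice/= ltnn.
    over.
  rewrite (ge0_integral_coord n (f := fun z => ((c + f z) ^+ 2)%:E)); last 2 first.
  - by apply/measurable_EFinP; apply: measurable_funX; exact: measurable_funD.
  - by move=> z; rewrite lee_fin sqr_ge0.
  have -> : (\int[P]_z ((c + f z) ^+ 2)%:E =
    \int[P]_z ((c ^+ 2)%:E + ((2 * c)%:E * (f z)%:E + (f z ^+ 2)%:E)))%E.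
    by apply: eq_integral => z _; rewrite -EFinM -!EFinD; congr EFin; ring.
  have i1 : P.-integrable setT (fun z => (2 * c)%:E * (f z)%:E)%E by exact: integrableZl.
  rewrite integralD//; last 2 first.
  - exact: finite_measure_integrable_cst.
  - exact: integrableD.
  rewrite integralD// integralZl// f0 mule0 add0e integral_cst//.
  by rewrite [X in (_ * X)%E]probability_setT mule1.
under eq_integral do rewrite inner.
have [v vE] : exists v, (\int[P]_y (f y ^+ 2)%:E)%E = v%:E.
  have : (\int[P]_y (f y ^+ 2)%:E)%E \is a fin_num by exact: integrable_fin_num.
  by move: (\int[P]_y (f y ^+ 2)%:E)%E => -[v| |]// _; exists v.
have v0 : (0 <= v%:E)%E by rewrite -vE; apply: integral_ge0 => y _; rewrite lee_fin sqr_ge0.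
rewrite vE ge0_integralD//; last 2 first.
- by move=> x _; rewrite lee_fin sqr_ge0.
- by apply/measurable_EFinP; apply: measurable_funX; exact: mS.
rewrite IH vE integral_cst// [X in (_ + _ * X)%E]probability_setT mule1.
by rewrite -!EFinM -EFinD -natr1; congr EFin; ring.
Qed.
End iid_law_theory.
End sequence_space.

(** * Euclidean norms and random signs *)

Section euclidean.
Context (R : realType) (m : nat).
Implicit Types (u v w : 'cV[R]_m).

Lemma dotmulE u v : dotmul u v = \sum_i u i 0 * v i 0.
Proof. by rewrite /dotmul mxE; apply: eq_bigr => i _; rewrite mxE. Qed.

Lemma dotmulC u v : dotmul u v = dotmul v u.
Proof. by rewrite !dotmulE; apply: eq_bigr => i _; rewrite mulrC. Qed.

Lemma dotmulDl u v w : dotmul (u + v) w = dotmul u w + dotmul v w.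
Proof.
by rewrite !dotmulE -big_split/=; apply: eq_bigr => i _; rewrite mxE mulrDl.
Qed.

Lemma dotmulZl a u v : dotmul (a *: u) v = a * dotmul u v.
Proof.
by rewrite !dotmulE mulr_sumr; apply: eq_bigr => i _; rewrite mxE mulrA.
Qed.

Lemma dotmulNl u v : dotmul (- u) v = - dotmul u v.
Proof. by rewrite -scaleN1r dotmulZl mulN1r. Qed.

Lemma dotmulDr u v w : dotmul u (v + w) = dotmul u v + dotmul u w.
Proof. by rewrite dotmulC dotmulDl !(dotmulC u). Qed.

Lemma dotmulZr a u v : dotmul u (a *: v) = a * dotmul u v.
Proof. by rewrite dotmulC dotmulZl dotmulC. Qed.

Lemma dotmulNr u v : dotmul u (- v) = - dotmul u v.
Proof. by rewrite dotmulC dotmulNl dotmulC. Qed.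

Lemma dotmulBr u v w : dotmul u (v - w) = dotmul u v - dotmul u w.
Proof. by rewrite dotmulDr dotmulNr. Qed.

Lemma dotmulBl u v w : dotmul (u - v) w = dotmul u w - dotmul v w.
Proof. by rewrite dotmulDl dotmulNl. Qed.

Lemma dotmul0r u : dotmul u 0 = 0.
Proof. by rewrite -(scale0r 0) dotmulZr mul0r. Qed.

Lemma dotmul0l u : dotmul 0 u = 0.
Proof. by rewrite dotmulC dotmul0r. Qed.

Lemma dotmul_sumr I (r : seq I) (p : pred I) u (f : I -> 'cV[R]_m) :
  dotmul u (\sum_(i <- r | p i) f i) = \sum_(i <- r | p i) dotmul u (f i).
Proof.
by elim/big_rec2 : _ => [|i y x _ <-]; rewrite ?dotmul0r// dotmulDr.
Qed.

Lemma dotmul_ge0 u : 0 <= dotmul u u.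
Proof. by rewrite dotmulE sumr_ge0// => i _; rewrite -expr2 sqr_ge0. Qed.

Lemma dotmul_eq0 u : (dotmul u u == 0) = (u == 0).
Proof.
apply/eqP/eqP => [|->]; last by rewrite dotmul0r.
rewrite dotmulE => /eqP; rewrite psumr_eq0; last first.
  by move=> i _; rewrite -expr2 sqr_ge0.
move=> /allP u0; apply/matrixP => i j; rewrite ord1 mxE; apply/eqP.
by have := u0 i (mem_index_enum i); rewrite /= mulf_eq0 orbb.
Qed.

Lemma cauchy_schwarz u v : dotmul u v ^+ 2 <= dotmul u u * dotmul v v.
Proof.
have [->|v0] := eqVneq v 0; first by rewrite !dotmul0r mulr0 expr0n.
have vv : 0 < dotmul v v by rewrite lt_neqAle eq_sym dotmul_eq0 v0 dotmul_ge0.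
rewrite -(ler_pM2r vv) -subr_ge0.
have := dotmul_ge0 (dotmul v v *: u - dotmul u v *: v).
rewrite dotmulBl !dotmulBr !dotmulZl !dotmulZr (dotmulC v u); congr (0 <= _).
by ring.
Qed.

Definition enorm u : R := Num.sqrt (dotmul u u).

Lemma enorm_ge0 u : 0 <= enorm u. Proof. exact: sqrtr_ge0. Qed.

Lemma enorm_sqr u : enorm u ^+ 2 = dotmul u u.
Proof. by rewrite sqr_sqrtr// dotmul_ge0. Qed.

Lemma enorm0 : enorm 0 = 0.
Proof. by rewrite /enorm dotmul0r sqrtr0. Qed.

Lemma dotmul_le_enorm u v : `|dotmul u v| <= enorm u * enorm v.
Proof.
rewrite -(ler_pXn2r (n := 2))// ?nnegrE ?mulr_ge0 ?enorm_ge0//.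
by rewrite exprMn !enorm_sqr -normrX ger0_norm ?sqr_ge0// cauchy_schwarz.
Qed.

Lemma enormZ a u : enorm (a *: u) = `|a| * enorm u.
Proof.
by rewrite /enorm dotmulZl dotmulZr mulrA -expr2 sqrtrM ?sqr_ge0// sqrtr_sqr.
Qed.

Lemma enormN u : enorm (- u) = enorm u.
Proof. by rewrite -scaleN1r enormZ normrN1 mul1r. Qed.

Lemma enormD u v : enorm (u + v) <= enorm u + enorm v.
Proof.
rewrite -(ler_pXn2r (n := 2))// ?nnegrE ?addr_ge0 ?enorm_ge0//.
rewrite sqrrD !enorm_sqr dotmulDl !dotmulDr (dotmulC v u).
have := le_trans (ler_norm _) (dotmul_le_enorm u v); lra.
Qed.

Lemma enormB u v : enorm (u - v) <= enorm u + enorm v.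
Proof. by rewrite -(enormN v) enormD. Qed.

Lemma enorm_sum I (r : seq I) (p : pred I) (f : I -> 'cV[R]_m) :
  enorm (\sum_(i <- r | p i) f i) <= \sum_(i <- r | p i) enorm (f i).
Proof.
elim/big_rec2 : _ => [|i y x _ xy]; first by rewrite enorm0.
by rewrite (le_trans (enormD _ _))// lerD2l.
Qed.

End euclidean.


(** Rademacher signs are encoded as all bit sequences of length [n], so a probability over signs is
    a count divided by 2^n. The new bit goes to the end, to match sums that are split at their last
    term. *)
Fixpoint signs (n : nat) : seq bitseq :=
  if n is k.+1 then [seq rcons s b | b <- [:: false; true], s <- signs k]
  else [:: [::]].

Lemma mem_signs n (s : bitseq) : (s \in signs n) = (size s == n).
Proof.
elim: n s => [|n IH] s; first by rewrite inE size_eq0.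
apply/allpairsP/idP => [[[b t] [_]]|].
  by rewrite IH /= => /eqP st ->; rewrite size_rcons st.
case/lastP: s => // t b; rewrite size_rcons eqSS => st.
by exists (b, t); split => //=; [case: b; rewrite !inE|rewrite IH].
Qed.

Lemma size_signs n : size (signs n) = (2 ^ n)%N.
Proof. by elim: n => // n IH; rewrite /signs -/signs size_allpairs IH expnS. Qed.

Lemma uniq_signs n : uniq (signs n).
Proof.
elim: n => // n IH; apply: allpairs_uniq => //.
by move=> [b s] [c t] _ _ /= /rcons_inj [-> ->].
Qed.

Lemma big_signsS (T : Type) (idx : T) (op : Monoid.com_law idx) n (F : bitseq -> T) :
  \big[op/idx]_(s <- signs n.+1) F s =
  \big[op/idx]_(s <- signs n) op (F (rcons s false)) (F (rcons s true)).
Proof.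
rewrite [signs n.+1]/= cats0 big_cat/= !big_map big_split/=.
by rewrite Monoid.mulmC.
Qed.

Definition flip (i : nat) (s : bitseq) : bitseq :=
  set_nth false s i (~~ nth false s i).

Lemma flipK n i s : (i < n)%N -> s \in signs n -> flip i (flip i s) = s.
Proof.
rewrite mem_signs => lti /eqP ss; rewrite /flip set_set_nth eqxx nth_set_nth/= eqxx negbK.
apply: (@eq_from_nth _ false); rewrite size_set_nth; first by rewrite (maxn_idPr _)// ss.
by move=> j _; rewrite nth_set_nth/=; case: eqP => // ->.
Qed.

Lemma flip_signs n i s : (i < n)%N -> s \in signs n -> flip i s \in signs n.
Proof.
rewrite !mem_signs => lti /eqP ss; rewrite size_set_nth (maxn_idPr _) ?ss//.
Qed.

Lemma big_signs_flip (T : Type) (idx : T) (op : Monoid.com_law idx) n i (F : bitseq -> T) :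
  (i < n)%N ->
  \big[op/idx]_(s <- signs n) F s = \big[op/idx]_(s <- signs n) F (flip i s).
Proof.
move=> lti; rewrite -[RHS](big_map (flip i) predT F).
apply: perm_big; apply: uniq_perm; first exact: uniq_signs.
  rewrite map_inj_in_uniq ?uniq_signs// => s t sn tn st.
  by rewrite -(flipK lti sn) st (flipK lti tn).
move=> s; apply/idP/mapP => [sn|[t tn ->]]; last exact: flip_signs.
by exists (flip i s); rewrite ?flip_signs ?(flipK lti sn).
Qed.

Section rademacher.
Context (R : realType) (V : lmodType R).
Implicit Type f : nat -> V.

(** A missing bit reads as [false], that is sign +1, so the empty sequence gives the unsigned sum;
    [signed_difference [::]] relies on this. *)
Definition signed_sum n (s : bitseq) f : V :=
  \sum_(i < n) (-1) ^+ (nth false s i) *: f i.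

Lemma signed_sumS n s b f : s \in signs n ->
  signed_sum n.+1 (rcons s b) f = signed_sum n s f + (-1) ^+ b *: f n.
Proof.
rewrite mem_signs => /eqP ss; rewrite /signed_sum big_ord_recr/=.
rewrite nth_rcons ss ltnn eqxx; congr (_ + _).
by apply: eq_bigr => i _; rewrite nth_rcons ss ltn_ord.
Qed.

End rademacher.

Section hoeffding.
Context (R : realType) (m : nat).
Implicit Types (f : nat -> 'cV[R]_m).

(** The sharp exponent x^2/2 is given up for an elementary proof: for x >= 1 both exponentials are
    below e^(2x^2); for 0 <= x < 1, with y = x/2, the left side is 2 + (e^y - e^-y)^2 and e^y - e^-y
    <= 3y. *)
Lemma cosh_le_exp (x : R) : expR x + expR (- x) <= 2 * expR (2 * x ^+ 2).
Proof.
wlog x0 : x / 0 <= x.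
  move=> H; have [/H//|x0] := leP 0 x.
  have := H (- x); rewrite opprK sqrrN addrC; apply; lra.
have [x1|x1] := leP 1 x.
  have h1 : expR x <= expR (2 * x ^+ 2) by rewrite ler_expR; nra.
  have h2 : expR (- x) <= expR (2 * x ^+ 2) by rewrite ler_expR; nra.
  lra.
pose y := x / 2.
have a1 : 1 - y <= expR (- y) by have := expR_ge1Dx (- y).
have y1 : y <= 2^-1 by rewrite /y; lra.
have y0 : 0 <= y by rewrite /y; lra.
have ee : expR y * expR (- y) = 1 by rewrite -expRD subrr expR0.
have e0 := expR_gt0 y.
have b1 : expR y * (1 - y) <= 1 by nra.
have b2 : expR y <= 1 + 2 * y by nra.
have b3 : expR y - expR (- y) <= 3 * y by nra.
have b4 : 0 <= expR y - expR (- y) by rewrite subr_ge0 ler_expR; lra.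
have -> : expR x + expR (- x) = 2 + (expR y - expR (- y)) ^+ 2.
  have -> : expR x = expR y ^+ 2 by rewrite expr2 -expRD; congr expR; rewrite /y; field.
  have -> : expR (- x) = expR (- y) ^+ 2 by rewrite expr2 -expRD; congr expR; rewrite /y; field.
  rewrite sqrrB ee; ring.
have := expR_ge1Dx (2 * x ^+ 2).
have : (expR y - expR (- y)) ^+ 2 <= (3 * y) ^+ 2 by rewrite ler_pXn2r// nnegrE; lra.
have -> : (3 * y) ^+ 2 = 9 / 4 * x ^+ 2 by rewrite /y; field.
have := sqr_ge0 x; lra.
Qed.

(** Expanding the squares leaves the cross term 2<a,v>/w, which [cosh_le_exp] and Cauchy-Schwarz
    turn into 8 |a|^2 |v|^2 / w^2. Shrinking the scale from w to w - 8 |v|^2 absorbs it, so the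
    right side has again a form to which the next sign applies. *)
Lemma exp_sign_step (a v : 'cV[R]_m) (w : R) : 8 * dotmul v v < w ->
  expR (dotmul (a + v) (a + v) / w) + expR (dotmul (a - v) (a - v) / w) <=
  2 * expR ((dotmul a a + dotmul v v) / (w - 8 * dotmul v v)).
Proof.
move=> vw; have v0 := dotmul_ge0 v; have a0 := dotmul_ge0 a.
have w0 : 0 < w by lra.
pose c := 2 * dotmul a v / w.
have -> : dotmul (a + v) (a + v) / w = (dotmul a a + dotmul v v) / w + c.
  by rewrite !dotmulDl !dotmulDr (dotmulC v a) /c; field; lra.
have -> : dotmul (a - v) (a - v) / w = (dotmul a a + dotmul v v) / w - c.
  by rewrite !dotmulBl !dotmulBr (dotmulC v a) /c; field; lra.
rewrite !expRD -mulrDr.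
apply: (@le_trans _ _ (expR ((dotmul a a + dotmul v v) / w) * (2 * expR (2 * c ^+ 2)))).
  by rewrite ler_pM2l ?expR_gt0// cosh_le_exp.
rewrite mulrCA ler_pM2l// -expRD ler_expR.
have c2 : 2 * c ^+ 2 <= 8 * dotmul a a * dotmul v v / w ^+ 2.
  have -> : 2 * c ^+ 2 = 8 * dotmul a v ^+ 2 / w ^+ 2 by rewrite /c; field; lra.
  rewrite ler_pM2r ?invr_gt0 ?exprn_gt0// -mulrA ler_pM2l//.
  exact: cauchy_schwarz.
apply: le_trans (lerD (lexx _) c2) _.
set A := dotmul a a in a0 *; set B := dotmul v v in vw v0 *.
have -> : (A + B) / w + 8 * A * B / w ^+ 2 = ((A + B) * w + 8 * A * B) / w ^+ 2.
  by field; lra.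
rewrite ler_pdivrMr ?exprn_gt0// [leRHS]mulrAC ler_pdivlMr; last lra.
have AB : 0 <= A * B by rewrite mulr_ge0.
have BB : 0 <= B * B by rewrite mulr_ge0.
have ABB : 0 <= A * B * B by rewrite mulr_ge0.
have wBB : 0 <= B * B * w by rewrite mulr_ge0// ltW.
rewrite -subr_ge0.
have -> : (A + B) * w ^+ 2 - ((A + B) * w + 8 * A * B) * (w - 8 * B) =
  8 * (B * B * w) + 64 * (A * B * B) by ring.
by lra.
Qed.

Lemma exp_sign_moment n f (a : 'cV[R]_m) (w : R) :
  8 * \sum_(i < n) dotmul (f i) (f i) < w ->
  \sum_(s <- signs n)
    expR (dotmul (a + signed_sum n s f) (a + signed_sum n s f) / w) <=
  2 ^+ n * expR ((dotmul a a + \sum_(i < n) dotmul (f i) (f i)) /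
              (w - 8 * \sum_(i < n) dotmul (f i) (f i))).
Proof.
elim: n a w => [|n IH] a w.
  by rewrite /signs big_seq1 /signed_sum !big_ord0 !addr0 mulr0 subr0 expr0 mul1r.
rewrite big_ord_recr/= => nw.
set v := f n in nw *; set S := \sum_(i < n) _ in IH nw *.
have v0 := dotmul_ge0 v.
have S0 : 0 <= S by apply: sumr_ge0 => i _; exact: dotmul_ge0.
rewrite big_signsS/= big_seq.
apply: (@le_trans _ _ (\sum_(s <- signs n | s \in signs n)
  2 * (expR (dotmul v v / (w - 8 * dotmul v v)) * expR (dotmul (a + signed_sum n s f) (a + signed_sum n s f) / (w - 8 * dotmul v v))))).
  apply: ler_sum => s sn; rewrite !signed_sumS// expr0 expr1 scale1r scaleN1r !addrA.
  rewrite -expRD -mulrDl (addrC (dotmul v v)).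
  by apply: exp_sign_step; lra.
rewrite -big_seq -mulr_sumr -mulr_sumr.
apply: (@le_trans _ _ (2 * (expR (dotmul v v / (w - 8 * dotmul v v)) *
  (2 ^+ n * expR ((dotmul a a + S) / (w - 8 * dotmul v v - 8 * S)))))).
  by rewrite ler_pM2l// ler_pM2l ?expR_gt0//; apply: IH; lra.
rewrite exprS -mulrA ler_pM2l// mulrCA ler_pM2l ?exprn_gt0// -expRD ler_expR.
have -> : w - 8 * (S + dotmul v v) = w - 8 * dotmul v v - 8 * S by ring.
rewrite [leRHS](_ : _ = dotmul v v / (w - 8 * dotmul v v - 8 * S) + (dotmul a a + S) / (w - 8 * dotmul v v - 8 * S)); last first.
  by rewrite -mulrDl; congr (_ / _); ring.
rewrite lerD2r ler_wpM2l// lef_pV2 ?posrE; lra.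
Qed.

(** Markov's inequality for exp(|S|^2 / (16 W)). Of the scale 16 W, [exp_sign_moment] consumes at
    most 8 W, so the moment is at most e^(1/8) <= 2 per sign pattern, whatever the dimension. *)
Lemma hoeffding_signs n f (W t : R) : 0 < W ->
  \sum_(i < n) dotmul (f i) (f i) <= W -> 0 <= t ->
  (count (fun s => t < enorm (signed_sum n s f)) (signs n))%:R <=
  2 ^+ n * (2 * expR (- (t ^+ 2 / (16 * W)))).
Proof.
move=> W0 SW t0; set S := \sum_(i < n) _ in SW.
have S0 : 0 <= S by apply: sumr_ge0 => i _; exact: dotmul_ge0.
rewrite expRN mulrA ler_pdivlMr ?expR_gt0//.
have e8 : expR (8^-1 : R) <= 2.
  have h : 1 - 8^-1 <= expR (- 8^-1 : R) by have := expR_ge1Dx (- 8^-1 : R).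
  have ee : expR (8^-1 : R) * expR (- 8^-1) = 1 by rewrite -expRD subrr expR0.
  have := expR_gt0 (8^-1 : R); nra.
apply: le_trans (le_trans (@exp_sign_moment n f 0 (16 * W) _) _).
- rewrite -sum1_count natr_sum mulr_suml big_mkcond/=; apply: ler_sum => s _.
  case: ifPn => [ts|_]; last exact: expR_ge0.
  rewrite mul1r add0r ler_expR ler_pM2r ?invr_gt0; last lra.
  by rewrite -enorm_sqr ler_pXn2r ?nnegrE ?enorm_ge0// ltW.
- rewrite -/S; lra.
- rewrite -/S ler_pM2l ?exprn_gt0// dotmul0r add0r.
  apply: le_trans e8; rewrite ler_expR ler_pdivrMr; lra.
Qed.

End hoeffding.

(** * Symmetrization *)

Section probability_value.
Context d (T : measurableType d) (R : realType) (mu : probability T R).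
Implicit Types A B : set T.

Definition pr A : R := fine (mu A).

Lemma EFin_pr A : measurable A -> (pr A)%:E = mu A.
Proof. by move=> mA; rewrite fineK// fin_num_measure. Qed.

Lemma le_pr A B : measurable A -> measurable B -> A `<=` B -> pr A <= pr B.
Proof. by move=> mA mB AB; rewrite -lee_fin !EFin_pr// le_measure// inE. Qed.

Lemma pr_setU A B : measurable A -> measurable B -> pr (A `|` B) <= pr A + pr B.
Proof.
move=> mA mB; rewrite -lee_fin EFinD !EFin_pr//; last exact: measurableU.
exact: measureU2.
Qed.

End probability_value.

Section symmetrization.
Context d (X : measurableType d) (R : realType) (P : probability X R).
Variable nu : probability (sequences X) R.
Hypothesis nuP : iid_law P nu.

Lemma measurable_enorm d' (Y : measurableType d') m (F : Y -> 'cV[R]_m) :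
  (forall a, measurable_fun setT (fun y => F y a 0)) ->
  measurable_fun setT (fun y => enorm (F y)).
Proof.
move=> mF; rewrite /enorm.
apply: (measurableT_comp (continuous_measurable_fun (@sqrt_continuous R))) => //=.
rewrite (_ : (fun _ => _) = (fun y => \sum_a F y a 0 * F y a 0)).
  by apply: measurable_sum => a; exact: measurable_funM.
by apply/funext => y; rewrite dotmulE.
Qed.

Lemma measurable_gt d' (Y : measurableType d') (f : Y -> R) (a : R) :
  measurable_fun setT f -> measurable [set y | a < f y].
Proof.
move=> mf; rewrite (_ : [set _ | _] = f @^-1` `]a, +oo[); last first.
  by apply/seteqP; split => y /=; rewrite in_itv/= andbT.
by rewrite -[X in measurable X]setTI; apply: mf.
Qed.

Lemma measurable_exists_gt d' (Y : measurableType d') (f : nat -> Y -> R) (a : R) :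
  (forall k, measurable_fun setT (f k)) ->
  measurable [set y | exists k, a < f k y].
Proof.
move=> mf; rewrite (_ : [set _ | _] = \bigcup_k [set y | a < f k y]); last first.
  by apply/seteqP; split => y /= [k]; exists k.
by apply: bigcupT_measurable => k; exact: measurable_gt.
Qed.

Lemma markov_gt d' (Y : measurableType d') (mu : {measure set Y -> \bar R})
   (f : Y -> R) (a : R) :
  measurable_fun setT f -> (forall y, 0 <= f y) -> 0 <= a ->
  (a%:E * mu [set y | (a < f y)%R] <= \int[mu]_y (f y)%:E)%E.
Proof.
move=> mf f0 a0; have mA := measurable_gt a mf.
rewrite -[X in (_ * mu X <= _)%E]setIT -integral_indic//.
rewrite -ge0_integralZl//; last by apply/measurable_EFinP; exact: measurable_indic.
apply: ge0_le_integral => //.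
- by move=> y _; rewrite mule_ge0// lee_fin.
- by apply: emeasurable_funM => //; apply/measurable_EFinP; exact: measurable_indic.
- by apply/measurable_EFinP.
- move=> y _; rewrite -EFinM lee_fin indicE.
  by case: (boolP (y \in _)); rewrite ?mulr0// mulr1 inE => /ltW.
Qed.

Lemma pr_markov d' (Y : measurableType d') (mu : probability Y R)
   (f : Y -> R) (a b : R) :
  measurable_fun setT f -> (forall y, 0 <= f y) -> 0 <= a ->
  (\int[mu]_y (f y)%:E <= b%:E)%E -> a * pr mu [set y | a < f y] <= b.
Proof.
move=> mf f0 a0 fb; rewrite -lee_fin EFinM EFin_pr; last exact: measurable_gt.
exact: le_trans (markov_gt mu mf f0 a0) fb.
Qed.

(* The ghost sample of x 0, ..., x (n - 1) is x n, ..., x (2n - 1). *)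
Definition swap_halves (n : nat) (s : bitseq) (i : nat) : nat :=
  if (i < n)%N then if nth false s i then (n + i)%N else i
  else if (i < n + n)%N then if nth false s (i - n) then (i - n)%N else i
  else i.

Lemma swap_halvesK n s : involutive (swap_halves n s).
Proof.
move=> i; rewrite /swap_halves.
have [lin|nli] := ltnP i n.
  case sE: (nth false s i); last by rewrite lin sE.
  by rewrite ltnNge leq_addr/= ltn_add2l lin addKn sE.
have [lin2|n2li] := ltnP i (n + n).
  case sE: (nth false s (i - n)); last by rewrite ltnNge nli/= lin2 sE.
  by rewrite ltn_subLR// lin2 sE subnKC.
by rewrite ltnNge nli/= ltnNge n2li.
Qed.

Lemma swap_halves_id n s i : (n + n <= i)%N -> swap_halves n s i = i.
Proof.
move=> ni; rewrite /swap_halves !ltnNge ni (leq_trans (leq_addr _ _) ni)//.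
Qed.

Lemma swap_halves_lo n s i : (i < n)%N ->
  swap_halves n s i = if nth false s i then (n + i)%N else i.
Proof. by rewrite /swap_halves => ->. Qed.

Lemma swap_halves_hi n s i : (i < n)%N ->
  swap_halves n s (n + i) = if nth false s i then i else (n + i)%N.
Proof.
move=> lin; rewrite /swap_halves ltn_add2l lin addKn.
by rewrite ltnNge leq_addr.
Qed.


Lemma measurable_signed_sum d' (Y : measurableType d') m n s
    (u : Y -> nat -> 'cV[R]_m) :
  (forall i a, measurable_fun setT (fun y : Y => u y i a 0)) ->
  forall a, measurable_fun setT (fun y : Y => signed_sum n s (u y) a 0).
Proof.
move=> mu a; rewrite (_ : (fun _ => _) =
  (fun y => \sum_(i < n) (-1) ^+ nth false s i * u y i a 0)).
  by apply: measurable_sum => i; apply: measurable_funM.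
by apply/funext => y; rewrite summxE; apply: eq_bigr => i _; rewrite mxE.
Qed.

Variables (m n : nat) (g : nat -> X -> 'cV[R]_m).
Hypothesis mg : forall k a, measurable_fun setT (fun x => g k x a 0).

Definition signed_deviation s (tau : R) : set (sequences X) :=
  [set x : sequences X | exists k, tau < enorm (signed_sum n s (fun i => g k (x i)))].

Definition signed_difference s (tau : R) : set (sequences X) :=
  [set x : sequences X | exists k,
     tau < enorm (signed_sum n s (fun i => g k (x i) - g k (x (n + i)%N)))].

Lemma measurable_coord_comp k a i :
  measurable_fun setT (fun x : sequences X => g k (x i) a 0).
Proof. exact: (measurableT_comp (mg k a) (measurable_coord i)). Qed.

Lemma measurable_signed_deviation s tau : measurable (signed_deviation s tau).
Proof.
apply: (measurable_exists_gt
  (f := fun k (x : sequences X) => enorm (signed_sum n s (fun i => g k (x i))))) => k.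
apply: measurable_enorm; apply: measurable_signed_sum => i a.
exact: measurable_coord_comp.
Qed.

Lemma measurable_signed_difference s tau : measurable (signed_difference s tau).
Proof.
apply: (measurable_exists_gt
  (f := fun k (x : sequences X) => enorm (signed_sum n s (fun i => g k (x i) - g k (x (n + i)%N))))) => k.
apply: measurable_enorm; apply: measurable_signed_sum => i a.
rewrite (_ : (fun _ => _) = (fun x : sequences X => g k (x i) a 0 - g k (x (n + i)%N) a 0)).
  by apply: measurable_funB; exact: measurable_coord_comp.
by apply/funext => x; rewrite !mxE.
Qed.

(** Exchanging coordinates i and n + i exactly where [s] has bit [true] preserves [nu] and
    multiplies the i-th difference by the corresponding sign. *)
Lemma signed_difference_swap s tau :
  nu (signed_difference [::] tau) = nu (signed_difference s tau).
Proof.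
rewrite -(iid_law_involution nuP (p := swap_halves n s) (N := n + n)); first last.
- exact: measurable_signed_difference.
- by move=> i; exact: swap_halves_id.
- exact: swap_halvesK.
congr (nu _).
have e k (x : sequences X) :
  signed_sum n [::] (fun i => g k ((x \o swap_halves n s) i) - g k ((x \o swap_halves n s) (n + i)%N))
  = signed_sum n s (fun i => g k (x i) - g k (x (n + i)%N)).
  apply: eq_bigr => i _ /=; rewrite swap_halves_lo// swap_halves_hi//.
  by rewrite nth_nil; case: nth; rewrite expr0 scale1r ?scale1r// expr1 scaleN1r opprB.
by apply/seteqP; split => x [k]; exists k; move: p; rewrite e.
Qed.

Lemma signed_difference_le s tau :
  pr nu (signed_difference s (2 * tau)) <= 2 * pr nu (signed_deviation s tau).
Proof.
(* With all bits [true] the permutation brings the whole ghost block to the front, so [S'] is the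
   same event for the ghost sample. *)
pose sw : nat -> nat := swap_halves n (nseq n true).
pose S' := (fun x : sequences X => (x \o sw : sequences X)) @^-1` signed_deviation s tau.
have mD := measurable_signed_deviation s tau.
have mS' : measurable S'.
  by rewrite -[X in measurable X]setTI; apply: measurable_reindex.
have nS' : nu S' = nu (signed_deviation s tau).
  apply: (iid_law_involution nuP (N := n + n)) => //; first exact: swap_halvesK.
  by move=> i; exact: swap_halves_id.
apply: (@le_trans _ _ (pr nu (signed_deviation s tau `|` S'))).
  apply: le_pr.
  - exact: measurable_signed_difference.
  - exact: measurableU.
  move=> x [k]; rewrite /signed_sum.
  under eq_bigr do rewrite scalerBr.
  rewrite sumrB => /lt_le_trans /(_ (enormB _ _)) H.
  apply: contrapT => /not_orP [n1 n2].
  have {}n1 : enorm (signed_sum n s (fun i => g k (x i))) <= tau.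
    by rewrite leNgt; apply/negP => h; apply: n1; exists k.
  have {}n2 : enorm (signed_sum n s (fun i => g k (x (n + i)%N))) <= tau.
    rewrite leNgt; apply/negP => h; apply: n2; exists k.
    move: h; congr (_ < enorm _); apply: eq_bigr => i _.
    by rewrite /= /sw swap_halves_lo// nth_nseq ltn_ord.
  move: H; rewrite /signed_sum in n1 n2; lra.
by rewrite (le_trans (pr_setU _ _ _))// {2}/pr nS' -/(pr _ _); lra.
Qed.


Variables (c : nat -> 'cV[R]_m) (t s2 : R).
Hypotheses (ig : forall k a, P.-integrable setT (fun x => (g k x a 0 - c k a 0)%:E))
  (zg : forall k a, (\int[P]_x (g k x a 0 - c k a 0)%:E = 0)%E)
  (ig2 : forall k a, P.-integrable setT (fun x => ((g k x a 0 - c k a 0) ^+ 2)%:E))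
  (vg : forall k, (\sum_a \int[P]_x ((g k x a 0 - c k a 0) ^+ 2)%:E <= s2%:E)%E)
  (t0 : 0 < t) (ts2 : 8 * n%:R * s2 <= t ^+ 2).

Definition deviation (x : sequences X) k : R :=
  enorm (\sum_(i < n) (g k (x i) - c k)).

Lemma measurable_deviation k :
  measurable_fun setT (fun x : sequences X => deviation x k).
Proof.
apply: measurable_enorm => a.
rewrite (_ : (fun _ => _) = (fun x : sequences X => \sum_(i < n) (g k (x i) a 0 - c k a 0))).
  apply: measurable_sum => i; apply: measurable_funB => //.
  exact: measurable_coord_comp.
by apply/funext => x; rewrite summxE; apply: eq_bigr => i _; rewrite !mxE.
Qed.

(** Chebyshev: the second moment of the deviation is at most n s2, and [ts2] makes this at most half
    of (t/2)^2. *)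
Lemma deviation_chebyshev k :
  pr nu [set x : sequences X | t / 2 < deviation x k] <= 2^-1.
Proof.
have mdev := measurable_deviation k.
have e2 : (\int[nu]_x (deviation x k ^+ 2)%:E <= (n%:R * s2)%:E)%E.
  rewrite (_ : (\int[nu]_x _)%E = (\sum_a \int[nu]_x ((\sum_(i < n) (g k (x i) a 0 - c k a 0)) ^+ 2)%:E)%E).
    rewrite (eq_bigr (fun a => n%:R%:E * \int[P]_x ((g k x a 0 - c k a 0) ^+ 2)%:E)%E); last first.
      move=> a _; exact: (integral_sqr_sum nuP n (ig k a) (zg k a) (ig2 k a)).
    rewrite -ge0_sume_distrr//; last first.
      by move=> a _; apply: integral_ge0 => x _; rewrite lee_fin sqr_ge0.
    by rewrite EFinM lee_wpmul2l.
  rewrite -ge0_integral_sum//; last 2 first.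
  - move=> a; apply/measurable_EFinP/measurable_funX/measurable_sum => i.
    by apply: measurable_funB => //; exact: measurable_coord_comp.
  - by move=> a x _; rewrite lee_fin sqr_ge0.
  apply: eq_integral => x _; rewrite sumEFin; congr EFin.
  rewrite /deviation enorm_sqr dotmulE; apply: eq_bigr => a _.
  by rewrite -expr2 summxE; congr (_ ^+ 2); apply: eq_bigr => i _; rewrite !mxE.
have H := pr_markov (measurable_funX 2 mdev) (fun=> sqr_ge0 _) (sqr_ge0 (t / 2)) e2.
have mA : measurable [set x : sequences X | t / 2 < deviation x k] by exact: measurable_gt.
move: H; rewrite (_ : [set y | _] = [set x : sequences X | t / 2 < deviation x k]); last first.
  have d0 x : 0 <= deviation x k by exact: enorm_ge0.
  have t20 : 0 <= t / 2 by rewrite divr_ge0// ltW.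
  by apply/seteqP; split => x /=; rewrite ltr_pXn2r ?nnegrE.
move=> H.
have t2 : 0 < t ^+ 2 by rewrite exprn_gt0.
rewrite -(ler_pM2l t2); move: H; set p := pr _ _ => H.
have -> : t ^+ 2 * p = 4 * ((t / 2) ^+ 2 * p) by field.
by move: H ts2; set a := _ * p; set b := n%:R * s2; rewrite -mulrA -/b; lra.
Qed.

(** Fix the sample and an index k that deviates by more than t. With probability at least 1/2 the
    ghost sample deviates by at most t/2 at this same k, and then the difference, in which the
    centres [c k] cancel, exceeds t/2. *)
Lemma deviation_le_difference :
  pr nu [set x : sequences X | exists k, t < deviation x k] <=
  2 * pr nu (signed_difference [::] (t / 2)).
Proof.
set B := [set x | _].
have mB : measurable B by apply: measurable_exists_gt => k; exact: measurable_deviation.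
have mD := measurable_signed_difference [::] (t / 2).
pose A i := (i < n)%N.
pose sw : nat -> nat := swap_halves n (nseq n true).
have key x : B x -> (2^-1%:E <= nu (xsection (splice A @^-1` signed_difference [::] (t / 2)) x))%E.
  move=> [k txk].
  pose G := [set y : sequences X | t / 2 < deviation y k].
  pose G' := (fun y : sequences X => (y \o sw : sequences X)) @^-1` G.
  have mG : measurable G by apply: measurable_gt; exact: measurable_deviation.
  have mG' : measurable G'.
    by rewrite -[X in measurable X]setTI; apply: measurable_reindex.
  have nG' : nu G' = nu G.
    apply: (iid_law_involution nuP (N := n + n)) => //; first exact: swap_halvesK.
    by move=> i; exact: swap_halves_id.
  apply: (@le_trans _ _ (nu (~` G'))).
    rewrite probability_setC// nG' -(EFin_pr nu mG) -EFinB lee_fin.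
    have := deviation_chebyshev k; rewrite -/G; lra.
  apply: le_measure; rewrite ?inE.
  - exact: measurableC.
  - apply: measurable_xsection; rewrite -[X in measurable X]setTI.
    by apply: measurable_splice.
  move=> y /= Gy; rewrite /xsection/= inE/=; exists k.
  have {}Gy : deviation (y \o sw) k <= t / 2 by rewrite leNgt; apply/negP.
  have -> : signed_sum n [::] (fun i => g k (splice A (x, y) i) - g k (splice A (x, y) (n + i)%N))
    = \sum_(i < n) (g k (x i) - c k) - \sum_(i < n) (g k ((y \o sw) i) - c k).
    rewrite -sumrB; apply: eq_bigr => i _.
    rewrite nth_nil expr0 scale1r /splice/= /A ltn_ord ltnNge leq_addr/=.
    by rewrite /sw swap_halves_lo// nth_nseq ltn_ord opprB addrA subrK.
  have := enormD (\sum_(i < n) (g k (x i) - c k) - \sum_(i < n) (g k ((y \o sw) i) - c k)) (\sum_(i < n) (g k ((y \o sw) i) - c k)).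
  rewrite subrK -/(deviation x k) -/(deviation (y \o sw) k); lra.
rewrite -lee_fin EFinM !EFin_pr//.
rewrite -(iid_law_splice nuP A mD).
apply: (@le_trans _ _ (2%:E * \int[nu]_x (2^-1 * \1_B x)%:E)%E).
  under eq_integral do rewrite EFinM.
  rewrite ge0_integralZl//; last first.
    by apply/measurable_EFinP; exact: measurable_indic.
  rewrite integral_indic// setIT muleA -EFinM divff// mul1e//.
rewrite lee_wpmul2l//; apply: ge0_le_integral => //.
- by apply/measurable_EFinP/measurable_funM => //; exact: measurable_indic.
- apply: measurable_fun_xsection; rewrite -[X in measurable X]setTI.
  by apply: measurable_splice.
move=> x _; rewrite indicE; case: (boolP (x \in B)) => [|_]; last by rewrite mulr0.
by rewrite inE mulr1 => /key.
Qed.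

(** Twice the threshold is halved and the probability doubled: once to pass to the ghost difference,
    once to split that difference. The resulting bound holds for every sign pattern, so it may be
    averaged over all of them; exchanging average and integral leaves, for each x in [Gd], the
    proportion of bad sign patterns. *)
Lemma symmetrization (Gd : set (sequences X)) (rho : R) : measurable Gd -> 0 <= rho ->
  (forall x, Gd x ->
    (count (fun s => `[< signed_deviation s (t / 4) x >]) (signs n))%:R <= 2 ^+ n * rho) ->
  pr nu [set x : sequences X | exists k, t < deviation x k] <=
  4 * (pr nu (~` Gd) + rho).
Proof.
move=> mGd rho0 Gdrho; set B := [set x | _].
have mD s := measurable_signed_deviation s (t / 4).
have B4 s : pr nu B <= 4 * pr nu (signed_deviation s (t / 4)).
  rewrite (le_trans deviation_le_difference)//.
  have -> : pr nu (signed_difference [::] (t / 2)) = pr nu (signed_difference s (t / 2)).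
    by congr fine; exact: signed_difference_swap.
  have := signed_difference_le s (t / 4).
  rewrite (_ : 2 * (t / 4) = t / 2); last by field.
  lra.
have cGd s : pr nu (signed_deviation s (t / 4)) <=
    pr nu (~` Gd) + pr nu (signed_deviation s (t / 4) `&` Gd).
  apply: le_trans (pr_setU _ _ _); [|exact: measurableC|exact: measurableI].
  apply: le_pr => //; first by apply: measurableU; [exact: measurableC|exact: measurableI].
  by move=> x Dx; have [Gx|nGx] := pselect (Gd x); [right|left].
have S : \sum_(s <- signs n) pr nu (signed_deviation s (t / 4) `&` Gd) <= 2 ^+ n * rho.
  rewrite -lee_fin -sumEFin.
  rewrite (eq_bigr (fun s => \int[nu]_x (\1_(signed_deviation s (t / 4) `&` Gd) x)%:E)%E); last first.
    by move=> s _; rewrite integral_indic ?setIT ?EFin_pr//; exact: measurableI.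
  rewrite -ge0_integral_sum//; last first.
    by move=> s; apply/measurable_EFinP/measurable_indic/measurableI.
  have r0 : 0 <= 2 ^+ n * rho by rewrite mulr_ge0 ?exprn_ge0.
  apply: (@le_trans _ _ (\int[nu]_x (2 ^+ n * rho)%:E)%E).
    apply: ge0_le_integral => //.
    - by move=> x _; rewrite sume_ge0.
    - apply: emeasurable_sum => s; apply/measurable_EFinP/measurable_indic/measurableI => //.
    move=> x _; rewrite sumEFin lee_fin.
    have [Gx|nGx] := pselect (Gd x); last first.
      by rewrite big1// => s _; rewrite indicE memNset// => -[].
    apply: le_trans (Gdrho x Gx); rewrite -sum1_count natr_sum [leRHS]big_mkcond/=.
    apply: ler_sum => s _; rewrite indicE; case: asboolP => [Dx|nDx].
      by rewrite mem_set.
    by rewrite memNset// => -[].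
  by rewrite integral_cst// [X in (_ * X)%E]probability_setT mule1.
have : \sum_(s <- signs n) pr nu B <= \sum_(s <- signs n)
    4 * (pr nu (~` Gd) + pr nu (signed_deviation s (t / 4) `&` Gd)).
  by apply: ler_sum => s _; rewrite (le_trans (B4 s))// ler_pM2l.
rewrite -mulr_sumr big_split/= !big_const_seq !count_predT size_signs !iter_addr_0.
rewrite -(mulr_natl (pr nu B)) -(mulr_natl (pr nu (~` Gd))) natrX => H.
have p2 : 0 < (2 : R) ^+ n by rewrite exprn_gt0.
rewrite -(ler_pM2l p2); nra.
Qed.

End symmetrization.

(** * Trace moments of signed sums of outer products *)

Section logconvex.
Context (R : realType).

(** A log-convex sequence lies below its chord, and c rho^j is the exponential of a chord. After
    division by it, a first value above 1 would make the sequence nondecreasing from there on, so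
    that it would still exceed 1 at r. *)
Lemma logconvex_le (x : nat -> R) (c rho : R) (r : nat) :
  (forall j, 0 <= x j) -> (forall j, x j.+1 ^+ 2 <= x j * x j.+2) ->
  0 < c -> 0 < rho -> x 0%N <= c -> x r <= c * rho ^+ r ->
  forall j, (j <= r)%N -> x j <= c * rho ^+ j.
Proof.
move=> x0 xlc c0 r0 xc xr.
pose y j := x j / (c * rho ^+ j).
have cr j : 0 < c * rho ^+ j by rewrite mulr_gt0// exprn_gt0.
have xE j : x j = y j * (c * rho ^+ j) by rewrite /y divfK// gt_eqF.
have y0 j : 0 <= y j by rewrite divr_ge0// ltW.
have ylc j : y j.+1 ^+ 2 <= y j * y j.+2.
  have := xlc j; rewrite !xE.
  have -> : (y j.+1 * (c * rho ^+ j.+1)) ^+ 2 = y j.+1 ^+ 2 * (c * rho ^+ j.+1) ^+ 2 by ring.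
  have -> : y j * (c * rho ^+ j) * (y j.+2 * (c * rho ^+ j.+2)) = y j * y j.+2 * (c * rho ^+ j.+1) ^+ 2.
    by rewrite !exprS; ring.
  by rewrite ler_pM2r// exprn_gt0.
suff yle j : (j <= r)%N -> y j <= 1.
  by move=> j jr; rewrite xE -[leRHS]mul1r ler_pM2r// yle.
elim: j => [_|j IH jr]; first by rewrite /y expr0 mulr1 ler_pdivrMr// mul1r.
have yj := IH (ltnW jr); rewrite leNgt; apply/negP => y1.
have inc k : y (j + k)%N <= y (j + k).+1 /\ 1 < y (j + k).+1.
  elim: k => [|k [k1 k2]]; first by rewrite addn0; split=> //; rewrite (le_trans yj)// ltW.
  rewrite addnS; have := ylc (j + k)%N; have := y0 (j + k)%N; have := y0 (j + k).+2.
  move: k1 k2; move: (y (j + k)%N) (y (j + k).+1) (y (j + k).+2) => u v w uv v1 w0 u0 vuw.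
  have vw : v <= w.
    rewrite leNgt; apply/negP => wv.
    suff : u * w < v ^+ 2 by rewrite ltNge vuw.
    have h : u * w <= v * w by rewrite ler_wpM2r.
    have h2 : v * w < v * v by rewrite ltr_pM2l//; lra.
    by rewrite expr2; exact: le_lt_trans h h2.
  by split => //; lra.
have [_] := inc (r - j.+1)%N; rewrite -addnS -subSn// subSS subnKC; last exact: ltnW.
rewrite ltNge => /negP; apply.
by rewrite /y ler_pdivrMr// mul1r.
Qed.

(** The ratios of consecutive terms are nondecreasing, so all of them are at least [t]. *)
Lemma logconvex_ge (x : nat -> R) (t : R) :
  (forall j, 0 <= x j) -> (forall j, x j.+1 ^+ 2 <= x j * x j.+2) ->
  0 < t -> 0 < x 0%N -> t * x 0%N <= x 1%N -> forall p, t ^+ p * x 0%N <= x p.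
Proof.
move=> x0 xlc t0 x00 x01.
have inc j : 0 < x j /\ t * x j <= x j.+1.
  elim: j => // j [xj xjS]; have xS : 0 < x j.+1 by rewrite (lt_le_trans _ xjS)// mulr_gt0.
  split => //; rewrite -(ler_pM2l xj); apply: le_trans (xlc j).
  by rewrite mulrA expr2 ler_pM2r// mulrC.
elim=> [|p IH]; first by rewrite expr0 mul1r.
rewrite exprS -mulrA (le_trans _ (inc p).2)// ler_pM2l//.
Qed.

End logconvex.

Section symmetric_matrices.
Context (R : realType) (m : nat).
Implicit Types (W Y A : 'M[R]_m) (v u : 'cV[R]_m).

Definition quad A v : R := dotmul v (A *m v).

Lemma dotmul_sym W u v : W^T = W -> dotmul (W *m u) v = dotmul u (W *m v).
Proof. by move=> sW; rewrite /dotmul trmx_mul sW mulmxA. Qed.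

Lemma trmx_expr W p : W^T = W -> (W ^+ p)^T = W ^+ p.
Proof.
move=> sW; elim: p => [|p IH]; first by rewrite expr0 trmx1.
by rewrite exprS -mulmxE trmx_mul IH sW !mulmxE -exprS -exprSr.
Qed.

Lemma quadM W v j l : W^T = W ->
  quad (W ^+ (j + l)) v = dotmul (W ^+ j *m v) (W ^+ l *m v).
Proof. by move=> sW; rewrite /quad exprD -mulmxE -mulmxA -dotmul_sym// trmx_expr. Qed.

(** By symmetry |W^(j+1) v|^2 = <W^j v, W^(j+2) v>. This Cauchy-Schwarz step replaces
    diagonalization: growth and interpolation of the powers of [W] are read off the norms alone. *)
Lemma enorm_power_logconvex W v j : W^T = W ->
  enorm (W ^+ j.+1 *m v) ^+ 2 <= enorm (W ^+ j *m v) * enorm (W ^+ j.+2 *m v).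
Proof.
move=> sW; rewrite enorm_sqr -quadM//.
rewrite (_ : (j.+1 + j.+1)%N = (j + j.+2)%N); last by rewrite !addnS addSn.
by rewrite quadM// (le_trans (ler_norm _))// dotmul_le_enorm.
Qed.

Lemma enorm_frobenius A v : dotmul (A *m v) (A *m v) <= \tr (A *m A^T) * dotmul v v.
Proof.
rewrite dotmulE /mxtrace mulr_suml; apply: ler_sum => i _.
have -> : (A *m v) i 0 = dotmul (row i A)^T v.
  by rewrite /dotmul trmxK !mxE; apply: eq_bigr => j _; rewrite !mxE.
rewrite -expr2 (le_trans (cauchy_schwarz _ _))// ler_wpM2r ?dotmul_ge0//.
rewrite dotmulE !mxE le_eqVlt; apply/orP; left; apply/eqP.
by apply: eq_bigr => j _; rewrite !mxE.
Qed.

(** Interpolation between the powers 0 and r: if c = |v| and c rho^r is the square root of the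
    bracket, then for both matrices the form of the j-th power is at most c^2 rho^j in absolute
    value for j <= 2r, and the exponents q and 2r - q add up to 2r. The matrices need not
    commute. *)
Lemma quad_power_product W Y v r q : W^T = W -> Y^T = Y -> (q <= r.*2)%N ->
  quad (W ^+ q) v * quad (Y ^+ (r.*2 - q)) v <=
  dotmul v v * (dotmul (W ^+ r *m v) (W ^+ r *m v) + dotmul (Y ^+ r *m v) (Y ^+ r *m v)).
Proof.
move=> sW sY qr.
have [->|v0] := eqVneq v 0.
  by rewrite /quad dotmul0l !mul0r dotmul0l mul0r.
pose c := enorm v.
have vv : 0 < dotmul v v by rewrite lt_neqAle eq_sym dotmul_eq0 v0 dotmul_ge0.
have c0 : 0 < c by rewrite sqrtr_gt0.
have c2 : dotmul v v = c ^+ 2 by rewrite enorm_sqr.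
set Z := _ + _; have Z0 : 0 <= Z by rewrite addr_ge0// dotmul_ge0.
have [r0|r0] := posnP r.
  move: qr; rewrite r0 leqn0 => /eqP ->; rewrite subn0 /quad expr0 mul1mx ler_pM2l//.
  by rewrite /Z r0 expr0 mul1mx lerDl ltW.
(* The slack [e] keeps [mu], hence [rho], positive when [Z] vanishes. *)
apply/ler_addgt0Pr => e e0.
pose mu := Num.sqrt (Z + e / dotmul v v).
have mu0 : 0 < mu by rewrite sqrtr_gt0 ltr_wpDl// divr_gt0.
have mu2 : mu ^+ 2 = Z + e / dotmul v v by rewrite sqr_sqrtr// addr_ge0// ltW// divr_gt0.
pose rho := (mu / c) `^ (r%:R^-1).
have rho0 : 0 < rho by rewrite powR_gt0// divr_gt0.
have rhor : rho ^+ r = mu / c.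
  rewrite -powR_mulrn ?ltW// -powRrM mulVf ?powRr1 ?ltW ?divr_gt0//.
  by rewrite pnatr_eq0 -lt0n.
have bnd (A : 'M[R]_m) : A^T = A -> dotmul (A ^+ r *m v) (A ^+ r *m v) <= Z ->
    forall j, (j <= r)%N -> enorm (A ^+ j *m v) <= c * rho ^+ j.
  move=> sA AZ; apply: logconvex_le => //.
  - by move=> j; exact: enorm_ge0.
  - by move=> j; exact: enorm_power_logconvex.
  - by rewrite expr0 mul1mx.
  - rewrite rhor mulrC divfK ?gt_eqF//.
    rewrite -(ler_pXn2r (n := 2))// ?nnegrE ?enorm_ge0 ?(ltW mu0)// enorm_sqr mu2.
    by apply: (le_trans AZ); rewrite lerDl ltW// divr_gt0.
have bq (A : 'M[R]_m) : A^T = A -> dotmul (A ^+ r *m v) (A ^+ r *m v) <= Z ->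
    forall j, (j <= r.*2)%N -> `|quad (A ^+ j) v| <= c ^+ 2 * rho ^+ j.
  (* Splitting [j] into its upper half [o] and its lower half keeps both exponents at most r, where
     [bnd] applies. *)
  move=> sA AZ j jr; pose o := (odd j + j./2)%N.
  have jE : j = (o + j./2)%N by rewrite /o -addnA addnn odd_double_half.
  have h1 : (j./2 <= r)%N by rewrite leq_half_double (leq_trans jr).
  have h2 : (o <= r)%N by rewrite /o -uphalf_half leq_uphalf_double.
  rewrite {1}jE quadM// (le_trans (dotmul_le_enorm _ _))//.
  have -> : c ^+ 2 * rho ^+ j = (c * rho ^+ o) * (c * rho ^+ j./2).
    by rewrite {1}jE exprD; ring.
  by rewrite ler_pM ?enorm_ge0//; exact: bnd.
have W1 : dotmul (W ^+ r *m v) (W ^+ r *m v) <= Z by rewrite /Z lerDl dotmul_ge0.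
have Y1 : dotmul (Y ^+ r *m v) (Y ^+ r *m v) <= Z by rewrite /Z lerDr dotmul_ge0.
rewrite (le_trans (ler_norm _))// normrM.
apply: (@le_trans _ _ ((c ^+ 2 * rho ^+ q) * (c ^+ 2 * rho ^+ (r.*2 - q)))).
  by rewrite ler_pM// bq// leq_subr.
rewrite mulrACA -[X in _ * X <= _]exprD subnKC// -addnn exprD rhor.
have -> : c ^+ 2 * c ^+ 2 * (mu / c * (mu / c)) = c ^+ 2 * mu ^+ 2 by field; rewrite gt_eqF.
by rewrite mu2 -c2 mulrDr mulrCA divff ?gt_eqF// mulr1.
Qed.

Lemma subr_expr A W k : A ^+ k - W ^+ k =
  \sum_(q < k) A ^+ q *m (A - W) *m W ^+ (k.-1 - q).
Proof.
elim: k => [|k IH]; first by rewrite !expr0 subrr big_ord0.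
rewrite big_ord_recl/= expr0 mul1mx subn0.
have -> : A ^+ k.+1 - W ^+ k.+1 = (A - W) *m W ^+ k + A *m (A ^+ k - W ^+ k).
  by rewrite !exprS -!mulmxE mulmxBl mulmxBr [RHS]addrC addrA subrK.
rewrite IH mulmx_sumr; congr (_ + _); apply: eq_bigr => i _.
by rewrite /bump/= add1n exprS -!mulmxE !mulmxA -predn_sub subnS.
Qed.

End symmetric_matrices.

Section khintchine.
Context (R : realType) (m n : nat) (v : nat -> 'cV[R]_m) (Q L : R).
Hypotheses (Q0 : 0 <= Q) (L0 : 0 <= L) (vQ : forall i, (i < n)%N -> dotmul (v i) (v i) <= Q)
  (vL : forall u, \sum_(i < n) dotmul (v i) u ^+ 2 <= L * dotmul u u).

Definition sign_matrix (s : bitseq) : 'M[R]_m :=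
  signed_sum n s (fun i => v i *m (v i)^T).

Lemma sign_matrix_sym s : (sign_matrix s)^T = sign_matrix s.
Proof.
rewrite /sign_matrix /signed_sum linear_sum/=; apply: eq_bigr => i _.
by rewrite linearZ/= trmx_mul trmxK.
Qed.

Lemma mxtrace_outer (A : 'M[R]_m) (w : 'cV[R]_m) : \tr (w *m w^T *m A) = quad A w.
Proof.
rewrite -mulmxA mxtrace_mulC /quad /dotmul !trace_mx11 mulmxA.
by rewrite -mulmxA.
Qed.

Lemma quad_outer (A W : 'M[R]_m) (w : 'cV[R]_m) :
  quad (A *m (w *m w^T) *m W) w = quad A w * quad W w.
Proof.
rewrite /quad /dotmul; set l := w^T *m A *m w.
have -> : w^T *m (A *m (w *m w^T) *m W *m w) = l *m (w^T *m (W *m w)) by rewrite /l !mulmxA.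
by rewrite mxE big_ord1 /l !mulmxA.
Qed.

(* Summing over the i-th sign first turns the trace into a difference of powers of two symmetric
   matrices that differ by 2 v_i v_i^T; the products of quadratic forms it telescopes into are
   bounded by log-convexity of j |-> |W^j v_i|. *)
Lemma sum_sign_trace_step p : 
  \sum_(s <- signs n) \tr (sign_matrix s ^+ p.+1.*2) <=
  (2 * (p.*2.+1)%:R * Q * L) * \sum_(s <- signs n) \tr (sign_matrix s ^+ p.*2).
Proof.
pose q i s k := quad (sign_matrix s ^+ k) (v i).
pose sg i s : R := (-1) ^+ nth false s i.
have trE s : \tr (sign_matrix s ^+ p.+1.*2) = \sum_(i < n) sg i s * q i s p.*2.+1.
  rewrite doubleS exprS -mulmxE {1}/sign_matrix /signed_sum mulmx_suml linear_sum/=.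
  by apply: eq_bigr => i _; rewrite -scalemxAl linearZ/= mxtrace_outer.
under eq_bigr do rewrite trE.
rewrite exchange_big/=.
have pair (i : 'I_n) : \sum_(s <- signs n) sg i s * q i s p.*2.+1 <=
    (p.*2.+1)%:R * Q * \sum_(s <- signs n)
      (dotmul (sign_matrix s ^+ p *m v i) (sign_matrix s ^+ p *m v i) *+ 2).
  have flipd s : s \in signs n -> sg i (flip i s) = - sg i s /\
      sign_matrix s - sign_matrix (flip i s) = (2 * sg i s) *: (v i *m (v i)^T).
    move=> sn; have sgf : sg i (flip i s) = - sg i s.
      by rewrite /sg /flip nth_set_nth/= eqxx; case: nth; rewrite ?expr0 ?expr1 ?opprK.
    split=> //; rewrite /sign_matrix /signed_sum (bigD1 i)//= [X in _ - X](bigD1 i)//=.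
    rewrite -!/(sg _ _) sgf scaleNr opprD opprK addrACA -sumrB big1 ?addr0.
      by rewrite -scalerDl mulr_natl mulr2n.
    move=> j ji; rewrite /sg /flip nth_set_nth/= ifN ?subrr//.
  rewrite -(ler_pM2l (ltr0n R 2)) mulr_natl mulr2n {2}(big_signs_flip _ _ (ltn_ord i)).
  rewrite -big_split/= big_seq.
  apply: (@le_trans _ _ (\sum_(s <- signs n | s \in signs n) 2 * (p.*2.+1)%:R * Q *
     (dotmul (sign_matrix s ^+ p *m v i) (sign_matrix s ^+ p *m v i) +
      dotmul (sign_matrix (flip i s) ^+ p *m v i) (sign_matrix (flip i s) ^+ p *m v i)))).
    apply: ler_sum => s sn; have [sgf dif] := flipd s sn.
    rewrite sgf mulNr -mulrBr.
    have -> : q i s p.*2.+1 - q i (flip i s) p.*2.+1 =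
       2 * sg i s * \sum_(k < p.*2.+1) q i s k * q i (flip i s) (p.*2 - k)%N.
      rewrite /q {1 2}/quad -dotmulBr -mulmxBl subr_expr dif mulmx_suml dotmul_sumr mulr_sumr.
      apply: eq_bigr => k _; rewrite -scalemxAr -!scalemxAl dotmulZr; congr (_ * _).
      exact: quad_outer.
    have -> : forall z, sg i s * (2 * sg i s * z) = 2 * z.
      by move=> z; rewrite /sg; case: nth; rewrite ?expr0 ?expr1; ring.
    rewrite -!mulrA ler_pM2l// mulrA.
    apply: (@le_trans _ _ (\sum_(k < p.*2.+1) Q * (dotmul (sign_matrix s ^+ p *m v i) (sign_matrix s ^+ p *m v i) +
      dotmul (sign_matrix (flip i s) ^+ p *m v i) (sign_matrix (flip i s) ^+ p *m v i)))); last first.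
      by rewrite [leLHS]sumr_const card_ord -[leLHS]mulr_natl mulrA.
    apply: ler_sum => k _.
    apply: le_trans (quad_power_product _ (sign_matrix_sym _) (sign_matrix_sym _) _) _.
      by rewrite -ltnS ltn_ord.
    by rewrite ler_wpM2r ?vQ// addr_ge0// dotmul_ge0.
  rewrite -big_seq -mulr_sumr big_split/= -(big_signs_flip _ (fun s => dotmul (sign_matrix s ^+ p *m v i) (sign_matrix s ^+ p *m v i)) (ltn_ord i)).
  by rewrite -big_split/= !mulrA.
apply: le_trans (ler_sum _ (fun i _ => pair i)) _.
rewrite -mulr_sumr exchange_big/=.
rewrite [leRHS](_ : _ = (p.*2.+1)%:R * Q * (\sum_(s <- signs n) 2 * L * \tr (sign_matrix s ^+ p.*2))); last first.
  by rewrite -mulr_sumr; ring.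
rewrite ler_wpM2l ?mulr_ge0//; apply: ler_sum => s _.
under eq_bigr do rewrite -mulr_natl.
rewrite -mulr_sumr -mulrA ler_pM2l//.
set A := sign_matrix s ^+ p.
have sA : A^T = A by exact/trmx_expr/sign_matrix_sym.
(* The sum over i of |A v_i|^2 is read row by row: each row of [A] is a vector to which [vL]
   applies, and the squared norms of the rows add up to the trace of A A^T. *)
apply: (@le_trans _ _ (\sum_(i < n) \sum_a dotmul (v i) (row a A)^T ^+ 2)).
  apply: ler_sum => i _; rewrite dotmulE; apply: ler_sum => a _.
  rewrite -expr2 (_ : (A *m v i) a 0 = dotmul (v i) (row a A)^T)//.
  by rewrite dotmulC /dotmul trmxK !mxE; apply: eq_bigr => j _; rewrite !mxE.
rewrite exchange_big/=.
apply: le_trans (ler_sum _ (fun a _ => vL (row a A)^T)) _.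
rewrite -mulr_sumr -addnn exprD -/A -mulmxE le_eqVlt; apply/orP; left; apply/eqP; congr (_ * _).
have -> : \tr (A *m A) = \tr (A *m A^T) by rewrite sA.
apply: eq_bigr => a _; rewrite dotmulE !mxE.
by apply: eq_bigr => j _; rewrite !mxE.
Qed.

(** Iterate the step p times; each factor 2 (2k + 1) Q L with k < p is at most 4 p Q L. The trace of
    the identity contributes the dimension. *)
Lemma sum_sign_trace p :
  \sum_(s <- signs n) \tr (sign_matrix s ^+ p.*2) <=
  2 ^+ n * m%:R * (4 * p%:R * Q * L) ^+ p.
Proof.
have base : \sum_(s <- signs n) \tr (sign_matrix s ^+ 0.*2) = 2 ^+ n * m%:R.
  under eq_bigr do rewrite expr0 mxtrace1.
  by rewrite big_const_seq count_predT size_signs iter_addr_0 -[LHS]mulr_natl natrX.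
have [->|p0] := posnP p; first by rewrite base mulr1.
suff H k : (k <= p)%N -> \sum_(s <- signs n) \tr (sign_matrix s ^+ k.*2) <=
    2 ^+ n * m%:R * (4 * p%:R * Q * L) ^+ k by exact: H.
elim: k => [_|k IH kp]; first by rewrite base mulr1.
rewrite (le_trans (sum_sign_trace_step k))// exprS mulrCA.
have c0 : 0 <= 2 * k.*2.+1%:R * Q * L by rewrite !mulr_ge0.
rewrite (le_trans (ler_wpM2l c0 (IH (ltnW kp))))//.
apply: ler_wpM2r; first by rewrite !mulr_ge0// exprn_ge0// !mulr_ge0.
rewrite ler_wpM2r// ler_wpM2r//.
have -> : 4 * p%:R = 2 * (p.*2)%:R :> R by rewrite -muln2 natrM; ring.
by rewrite ler_pM2l// ler_nat ltn_double.
Qed.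

(** If |<u, W u>| > t |u|^2 then |W u| >= t |u|, and log-convexity propagates this to |W^p u| >= t^p
    |u|. Hence the trace of W^(2p), a squared Frobenius norm, is at least t^(2p), and Markov's
    inequality applies to the count. All directions u are covered at once. *)
Lemma sign_matrix_tail p (t : R) : (0 < p)%N -> 0 < t ->
  (count (fun s => `[< exists u, t * dotmul u u < `|quad (sign_matrix s) u| >])
     (signs n))%:R <= 2 ^+ n * (m%:R * (4 * p%:R * Q * L / t ^+ 2) ^+ p).
Proof.
move=> p0 t0.
have tp : 0 < t ^+ p.*2 by rewrite exprn_gt0.
have e : (4 * p%:R * Q * L / t ^+ 2) ^+ p * t ^+ p.*2 = (4 * p%:R * Q * L) ^+ p.
  by rewrite expr_div_n -exprM mul2n divfK ?gt_eqF.
set E := (_ / _) ^+ p in e *.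
rewrite -(ler_pM2r tp) [leRHS](_ : _ = 2 ^+ n * m%:R * (E * t ^+ p.*2)); last by ring.
rewrite e; apply: le_trans (sum_sign_trace p).
rewrite -sum1_count natr_sum mulr_suml [leLHS]big_mkcond/=; apply: ler_sum => s _.
set W := sign_matrix s; have sW : W^T = W := sign_matrix_sym s.
have trE : \tr (W ^+ p.*2) = \tr (W ^+ p *m (W ^+ p)^T).
  by rewrite trmx_expr// mulmxE -exprD addnn.
case: asboolP => [[u tu]|_]; last first.
  rewrite trE /mxtrace sumr_ge0// => i _; rewrite mxE sumr_ge0// => j _.
  by rewrite !mxE -expr2 sqr_ge0.
rewrite mul1r.
have u0 : u != 0.
  by apply/eqP => u0; move: tu; rewrite u0 /quad !dotmul0l normr0 mulr0 ltxx.
have uu : 0 < dotmul u u by rewrite lt_neqAle eq_sym dotmul_eq0 u0 dotmul_ge0.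
have eu : 0 < enorm u by rewrite sqrtr_gt0.
have H : t ^+ p * enorm u <= enorm (W ^+ p *m u).
  rewrite (_ : enorm u = enorm (W ^+ 0 *m u)); last by rewrite expr0 mul1mx.
  apply: (@logconvex_ge _ (fun j => enorm (W ^+ j *m u))) => //.
  - by move=> j; exact: enorm_ge0.
  - by move=> j; exact: enorm_power_logconvex.
  - by rewrite expr0 mul1mx.
  rewrite expr0 mul1mx expr1 -(ler_pM2l eu); apply: le_trans (dotmul_le_enorm _ _).
  by rewrite mulrCA -expr2 enorm_sqr ltW.
rewrite trE -(ler_pM2r uu); apply: le_trans (enorm_frobenius _ _).
rewrite -enorm_sqr -[leRHS]enorm_sqr -muln2 exprM -exprMn.
by rewrite ler_pXn2r ?nnegrE ?enorm_ge0// mulr_ge0 ?enorm_ge0// exprn_ge0// ltW.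
Qed.


End khintchine.

(** * Empirical Gram matrices *)

Section integer_density.
Context (R : realType) (m : nat).
Implicit Types (A : 'M[R]_m) (u : 'cV[R]_m).

(* An enumeration of Z^m. A quadratic form that is nonnegative on Z^m is nonnegative, which makes
   events about all directions countable, hence measurable. *)
Definition int_vector (k : nat) : 'cV[R]_m :=
  if @choice.unpickle {ffun 'I_m -> int} k is Some f then \col_i (f i)%:~R else 0.

Lemma mxtrace_mulmx_tr A : \tr (A *m A^T) = \sum_a \sum_b A a b ^+ 2.
Proof.
apply: eq_bigr => a _; rewrite mxE; apply: eq_bigr => b _.
by rewrite mxE expr2.
Qed.

Lemma enorm_mulmx A u : enorm (A *m u) <= Num.sqrt (\tr (A *m A^T)) * enorm u.
Proof.
have tr0 : 0 <= \tr (A *m A^T).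
  rewrite /mxtrace sumr_ge0// => i _; rewrite mxE sumr_ge0// => j _.
  by rewrite !mxE -expr2 sqr_ge0.
by rewrite /enorm -sqrtrM// ler_sqrt ?mulr_ge0 ?dotmul_ge0// enorm_frobenius.
Qed.

(** Round N u to an integer vector z. The rounding error has norm at most the square root of m, so
    the form at z differs from N^2 times the form at u by O(N); a negative value at u would make the
    form negative at z for large N. *)
Lemma quad_ge0_int A : (forall k, 0 <= quad A (int_vector k)) -> forall u, 0 <= quad A u.
Proof.
move=> Az u; rewrite leNgt; apply/negP => Au.
pose C := Num.sqrt (\tr (A *m A^T)); have C0 : 0 <= C by exact: sqrtr_ge0.
pose E := Num.sqrt (m%:R : R); have E0 : 0 <= E by exact: sqrtr_ge0.
pose B := E * (2 * C * enorm u + C * E).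
have B0 : 0 <= B by rewrite mulr_ge0// addr_ge0 ?mulr_ge0// enorm_ge0.
have key (N : nat) : (0 < N)%N -> N%:R * - quad A u <= B.
  move=> N0; have N0' : (0 : R) < N%:R by rewrite ltr0n.
  pose f : {ffun 'I_m -> int} := [ffun i => Num.floor (N%:R * u i 0)].
  pose z : 'cV[R]_m := \col_i (f i)%:~R.
  have zk : int_vector (choice.pickle f) = z by rewrite /int_vector choice.pickleK.
  pose e := N%:R *: u - z.
  have eE : enorm e <= E.
    rewrite /enorm ler_sqrt ?ler0n// dotmulE -[m in m%:R]card_ord -sum1_card natr_sum.
    apply: ler_sum => i _; rewrite !mxE ffunE.
    have := floor_itv (N%:R * u i 0); rewrite intrD => /andP[].
    move: (N%:R * u i 0) (_%:~R) => a b ba ab; have h : 0 <= a - b <= 1 by lra.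
    by nra.
  have := Az (choice.pickle f); rewrite zk.
  have -> : z = N%:R *: u - e by rewrite /e opprB addrC subrK.
  rewrite /quad mulmxBr -scalemxAr dotmulBl !dotmulBr !dotmulZl !dotmulZr -!/(quad _ _).
  have b1 : `|dotmul u (A *m e)| <= enorm u * (C * E).
    rewrite (le_trans (dotmul_le_enorm _ _))// ler_wpM2l ?enorm_ge0//.
    by rewrite (le_trans (enorm_mulmx _ _))// ler_wpM2l.
  have b2 : `|dotmul e (A *m u)| <= E * (C * enorm u).
    rewrite (le_trans (dotmul_le_enorm _ _))// ler_pM ?enorm_ge0//.
    exact: enorm_mulmx.
  have b3 : `|quad A e| <= E * (C * E).
    rewrite (le_trans (dotmul_le_enorm _ _))// ler_pM ?enorm_ge0//.
    by rewrite (le_trans (enorm_mulmx _ _))// ler_wpM2l.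
  move: b1 b2 b3 => /ler_normlP[b1 b1'] /ler_normlP[b2 b2'] /ler_normlP[b3 b3'] H.
  rewrite -(ler_pM2l N0').
  have N1 : 1 <= N%:R :> R by rewrite ler1n.
  have h1 : N%:R * - dotmul u (A *m e) <= N%:R * (enorm u * (C * E)) by rewrite ler_pM2l.
  have h2 : N%:R * - dotmul e (A *m u) <= N%:R * (E * (C * enorm u)) by rewrite ler_pM2l.
  have h3 : E * (C * E) <= N%:R * (E * (C * E)) by rewrite ler_peMl// !mulr_ge0.
  have -> : N%:R * B = N%:R * (enorm u * (C * E)) + N%:R * (E * (C * enorm u)) + N%:R * (E * (C * E)).
    by rewrite /B; ring.
  lra.
have := key (Num.truncn (B / - quad A u)).+1 isT.
rewrite leNgt => /negP; apply.
rewrite -ltr_pdivrMr; last by rewrite oppr_gt0.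
by rewrite truncnS_gt.
Qed.

Lemma quadB A W u : quad (A - W) u = quad A u - quad W u.
Proof. by rewrite /quad mulmxBl dotmulBr. Qed.

Lemma quad_scalar a u : quad a%:M u = a * dotmul u u.
Proof. by rewrite /quad mul_scalar_mx dotmulZr. Qed.

End integer_density.

Section bounded_functions.
Context d (X : measurableType d) (R : realType) (P : probability X R).
Implicit Types f : X -> R.

Lemma bounded_integrable f (B : R) : measurable_fun setT f ->
  (forall x, `|f x| <= B) -> P.-integrable setT (EFin \o f).
Proof.
move=> mf fB; apply: measurable_bounded_integrable => //.
  by rewrite -ge0_fin_numE ?fin_num_measure.
exists B; rewrite num_real; split => // x Bx y _ /=.
exact: le_trans (fB y) (ltW Bx).
Qed.

Lemma EFin_mean f : P.-integrable setT (EFin \o f) ->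
  (\int[P]_x (f x)%:E = (mean P f)%:E)%E.
Proof. by move=> fi; rewrite /mean /Rintegral fineK// integrable_fin_num. Qed.

Lemma centered_bounded f (B : R) : measurable_fun setT f -> (forall x, `|f x| <= B) ->
  [/\ P.-integrable setT (fun x => (f x - mean P f)%:E),
      (\int[P]_x (f x - mean P f)%:E = 0)%E,
      P.-integrable setT (fun x => ((f x - mean P f) ^+ 2)%:E) &
      (\int[P]_x ((f x - mean P f) ^+ 2)%:E <= \int[P]_x (f x ^+ 2)%:E)%E].
Proof.
move=> mf fB; set c := mean P f.
have fi := bounded_integrable mf fB.
have mfc : measurable_fun setT (fun x => f x - c) by exact: measurable_funB.
have ic : P.-integrable setT (cst c%:E) by exact: finite_measure_integrable_cst.
have i1 : P.-integrable setT (fun x => (f x - c)%:E).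
  apply: (@bounded_integrable _ (B + `|c|)) => // x.
  by rewrite (le_trans (ler_normB _ _))// lerD2r.
have z1 : (\int[P]_x (f x - c)%:E = 0)%E.
  under eq_integral do rewrite EFinB.
  rewrite integralB// EFin_mean// integral_cst// [X in (_ * X)%E]probability_setT mule1.
  by rewrite subee.
have B0 (x : X) : 0 <= B by rewrite (le_trans _ (fB x)).
have i2 : P.-integrable setT (EFin \o (fun x => (f x - c) ^+ 2)).
  apply: (@bounded_integrable _ ((B + `|c|) ^+ 2)) => [|x].
    exact: measurable_funX.
  rewrite normrX ler_pXn2r// ?nnegrE ?addr_ge0 ?(B0 x)//.
  by rewrite (le_trans (ler_normB _ _))// lerD2r.
split=> //.
have -> : (\int[P]_x (f x ^+ 2)%:E = \int[P]_x (((f x - c) ^+ 2)%:E + ((2 * c)%:E * (f x - c)%:E + (c ^+ 2)%:E)))%E.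
  by apply: eq_integral => x _; rewrite -EFinM -!EFinD; congr EFin; ring.
rewrite integralD//; last first.
  apply: integrableD => //; first exact: integrableZl.
  exact: finite_measure_integrable_cst.
rewrite leeDl// integralD//; last 2 first.
- exact: integrableZl.
- exact: finite_measure_integrable_cst.
rewrite integralZl// z1 mule0 add0e; apply: integral_ge0 => x _.
by rewrite lee_fin sqr_ge0.
Qed.

End bounded_functions.

Section symmetrization_bounded.
Context d (X : measurableType d) (R : realType) (P : probability X R).
Variable nu : probability (sequences X) R.
Hypothesis nuP : iid_law P nu.
Variables (m n : nat) (g : nat -> X -> 'cV[R]_m) (B : R).
Hypothesis mg : forall k a, measurable_fun setT (fun x => g k x a 0).
Hypothesis gB : forall k x a, `|g k x a 0| <= B.

Definition mean_vector k : 'cV[R]_m := \col_a mean P (fun x => g k x a 0).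

Lemma symmetrization_bounded (t s2 rho : R) (Gd : set (sequences X)) :
  (forall k, (\int[P]_x (dotmul (g k x) (g k x))%:E <= s2%:E)%E) ->
  0 < t -> 8 * n%:R * s2 <= t ^+ 2 -> measurable Gd -> 0 <= rho ->
  (forall x, Gd x ->
    (count (fun s => `[< signed_deviation n g s (t / 4) x >]) (signs n))%:R <= 2 ^+ n * rho) ->
  pr nu [set x : sequences X | exists k, t < deviation n g mean_vector x k] <=
  4 * (pr nu (~` Gd) + rho).
Proof.
move=> vg t0 ts2 mGd rho0 Gdrho.
have C k a := centered_bounded P (mg k a) (fun x => gB k x a).
have mE k a : mean_vector k a 0 = mean P (fun x => g k x a 0) by rewrite mxE.
apply: (symmetrization nuP mg (s2 := s2)) => //.
- by move=> k a; rewrite mE; case: (C k a).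
- by move=> k a; rewrite mE; case: (C k a).
- by move=> k a; rewrite mE; case: (C k a).
move=> k; apply: le_trans (vg k).
have -> : (\int[P]_x (dotmul (g k x) (g k x))%:E = \sum_a \int[P]_x (g k x a 0 ^+ 2)%:E)%E.
  rewrite -ge0_integral_sum//.
  - by apply: eq_integral => x _; rewrite sumEFin dotmulE; congr EFin; apply: eq_bigr.
  - by move=> a; apply/measurable_EFinP/measurable_funX.
  - by move=> a x _; rewrite lee_fin sqr_ge0.
by apply: lee_sum => a _; rewrite mE; case: (C k a).
Qed.

End symmetrization_bounded.

Section gram_concentration.
Context d (X : measurableType d) (R : realType) (P : probability X R).
Variable nu : probability (sequences X) R.
Hypothesis nuP : iid_law P nu.
Variables (m : nat) (w : X -> 'cV[R]_m) (Q : R).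
Hypothesis mw : forall a, measurable_fun setT (fun x => w x a 0).
Hypothesis Q0 : 0 < Q.
Hypothesis wQ : forall x, dotmul (w x) (w x) <= Q.
Hypothesis worth : forall a b, mean P (fun x => w x a 0 * w x b 0) = (a == b)%:R.

Definition sum_outer n (x : sequences X) : 'M[R]_m :=
  \sum_(i < n) w (x i) *m (w (x i))^T.

Lemma quad_outer1 (v u : 'cV[R]_m) : quad (v *m v^T) u = dotmul v u ^+ 2.
Proof.
rewrite /quad /dotmul -mulmxA mulmxA mxE big_ord1 expr2; congr (_ * _).
by rewrite -/(dotmul u v) dotmulC.
Qed.

Lemma quad_sum_outer n x u :
  quad (sum_outer n x) u = \sum_(i < n) dotmul (w (x i)) u ^+ 2.
Proof.
rewrite /quad mulmx_suml dotmul_sumr; apply: eq_bigr => i _.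
exact: quad_outer1.
Qed.

Lemma measurable_dotmul u : measurable_fun setT (fun x => dotmul (w x) u).
Proof.
rewrite (_ : (fun _ => _) = (fun x => \sum_a w x a 0 * u a 0)).
  by apply: measurable_sum => a; exact: measurable_funM.
by apply/funext => x; rewrite dotmulE.
Qed.

Lemma abs_coord_le x a : `|w x a 0| <= Num.sqrt Q.
Proof.
rewrite -sqrtr_sqr ler_sqrt ?(ltW Q0)//; apply: le_trans (wQ x).
rewrite dotmulE (bigD1 a)//= expr2 lerDl sumr_ge0// => i _.
by rewrite -expr2 sqr_ge0.
Qed.

Lemma integral_dotmul_sqr u :
  (\int[P]_x (dotmul (w x) u ^+ 2)%:E = (dotmul u u)%:E)%E.
Proof.
have i2 a b : P.-integrable setT (EFin \o (fun x => w x a 0 * w x b 0)).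
  apply: (@bounded_integrable _ _ _ _ _ (Num.sqrt Q * Num.sqrt Q)).
    exact: measurable_funM.
  by move=> x; rewrite normrM ler_pM// abs_coord_le.
transitivity (\int[P]_x \sum_a \sum_b ((u a 0 * u b 0)%:E * (w x a 0 * w x b 0)%:E))%E.
  apply: eq_integral => x _; rewrite expr2 dotmulE mulr_suml -sumEFin.
  apply: eq_bigr => a _; rewrite mulr_sumr -sumEFin; apply: eq_bigr => b _.
  by rewrite -EFinM; congr EFin; ring.
rewrite integral_sum//; last first.
  move=> a; apply: integrable_sum => // b _; exact: integrableZl (i2 a b).
rewrite dotmulE -sumEFin; apply: eq_bigr => a _.
rewrite integral_sum//; last by move=> b; exact: integrableZl (i2 a b).
rewrite (bigD1 a)//= [X in (_ + X)%E]big1 ?adde0.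
  by rewrite integralZl ?(i2 a a)// (EFin_mean (i2 a a)) worth eqxx mule1.
move=> b ba; rewrite integralZl ?(i2 a b)// (EFin_mean (i2 a b)) worth eq_sym (negbTE ba).
by rewrite mule0.
Qed.

Lemma dotmul_sqr_le x u : dotmul (w x) u ^+ 2 <= Q * dotmul u u.
Proof. by rewrite (le_trans (cauchy_schwarz _ _))// ler_wpM2r ?dotmul_ge0. Qed.

Let z k := int_vector R m k.

(* The zero vector is harmless: division by 0 gives 0. *)
Definition rayleigh k (x : X) : 'cV[R]_1 :=
  const_mx (dotmul (w x) (z k) ^+ 2 / dotmul (z k) (z k)).

Lemma enorm_const (a : R) : enorm (const_mx a : 'cV[R]_1) = `|a|.
Proof. by rewrite /enorm dotmulE big_ord1 !mxE -expr2 sqrtr_sqr. Qed.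

Lemma rayleigh_ge0 k x : 0 <= dotmul (w x) (z k) ^+ 2 / dotmul (z k) (z k).
Proof. by rewrite divr_ge0 ?sqr_ge0// dotmul_ge0. Qed.

Lemma rayleigh_le k x : dotmul (w x) (z k) ^+ 2 / dotmul (z k) (z k) <= Q.
Proof.
have [->|z0] := eqVneq (dotmul (z k) (z k)) 0; first by rewrite invr0 mulr0 ltW.
by rewrite ler_pdivrMr ?dotmul_sqr_le// lt_neqAle eq_sym z0 dotmul_ge0.
Qed.

Lemma measurable_rayleigh k a : measurable_fun setT (fun x => rayleigh k x a 0).
Proof.
rewrite (_ : (fun _ => _) = (fun x => dotmul (w x) (z k) ^+ 2 / dotmul (z k) (z k))).
  by apply: measurable_funM => //; apply: measurable_funX; exact: measurable_dotmul.
by apply/funext => x; rewrite mxE.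
Qed.

Lemma rayleigh_bounded k x a : `|rayleigh k x a 0| <= Q.
Proof. by rewrite mxE ger0_norm ?rayleigh_ge0// rayleigh_le. Qed.

Lemma integral_rayleigh k : (\int[P]_x (dotmul (w x) (z k) ^+ 2 / dotmul (z k) (z k))%:E =
  (dotmul (z k) (z k) != 0)%:R%:E)%E.
Proof.
under eq_integral do rewrite mulrC EFinM.
rewrite ge0_integralZl//; last 3 first.
- by apply/measurable_EFinP/measurable_funX; exact: measurable_dotmul.
- by move=> x _; rewrite lee_fin sqr_ge0.
- by rewrite lee_fin invr_ge0 dotmul_ge0.
rewrite integral_dotmul_sqr -EFinM; congr EFin.
by have [->|z0] := eqVneq (dotmul (z k) (z k)) 0; rewrite ?mulr0// mulVf.
Qed.

Lemma mean_rayleigh k : mean_vector P rayleigh k =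
  const_mx (dotmul (z k) (z k) != 0)%:R.
Proof.
apply/matrixP => a b; rewrite !mxE; apply: EFin_inj.
rewrite -EFin_mean; last first.
  by apply: bounded_integrable; [exact: measurable_rayleigh|move=> x; exact: rayleigh_bounded].
by rewrite -integral_rayleigh; apply: eq_integral => x _; rewrite mxE.
Qed.

(** The quotient takes values in [0, Q] and has mean at most 1. *)
Lemma rayleigh_second_moment k :
  (\int[P]_x (dotmul (rayleigh k x) (rayleigh k x))%:E <= Q%:E)%E.
Proof.
apply: (@le_trans _ _ (\int[P]_x (Q%:E * (dotmul (w x) (z k) ^+ 2 / dotmul (z k) (z k))%:E))%E).
  apply: ge0_le_integral => //.
  - by move=> x _; rewrite lee_fin dotmul_ge0.
  - apply/measurable_EFinP; rewrite (_ : (fun _ => _) = (fun x => rayleigh k x 0 0 * rayleigh k x 0 0)).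
      by apply: measurable_funM; exact: measurable_rayleigh.
    by apply/funext => x; rewrite dotmulE big_ord1.
  - apply: emeasurable_funM => //; apply/measurable_EFinP.
    by apply: measurable_funM => //; apply: measurable_funX; exact: measurable_dotmul.
  move=> x _; rewrite -EFinM lee_fin dotmulE big_ord1 mxE ler_wpM2r ?rayleigh_ge0//.
  exact: rayleigh_le.
rewrite ge0_integralZl//; last 3 first.
- apply/measurable_EFinP.
  by apply: measurable_funM => //; apply: measurable_funX; exact: measurable_dotmul.
- by move=> x _; rewrite lee_fin rayleigh_ge0.
- by rewrite lee_fin ltW.
by rewrite integral_rayleigh -EFinM lee_fin; case: (_ != _); rewrite ?mulr1 ?mulr0// ltW.
Qed.

Lemma deviation_rayleigh n x k : z k != 0 ->
  deviation n rayleigh (mean_vector P rayleigh) x k =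
  `|quad (sum_outer n x) (z k) / dotmul (z k) (z k) - n%:R|.
Proof.
move=> zk0; rewrite -enorm_const /deviation; congr enorm.
apply/matrixP => a b; rewrite summxE mxE quad_sum_outer mulr_suml.
have -> : n%:R = \sum_(i < n) (1 : R) by rewrite sumr_const card_ord.
rewrite -sumrB; apply: eq_bigr => i _.
by rewrite mean_rayleigh !mxE dotmul_eq0 zk0.
Qed.

Definition gram_below n (L : R) : set (sequences X) :=
  [set x : sequences X | forall k, quad (sum_outer n x) (z k) <= L * dotmul (z k) (z k)].

Lemma setC_gram_below n L : ~` gram_below n L =
  [set x : sequences X | exists k, 0 < quad (sum_outer n x) (z k) - L * dotmul (z k) (z k)].
Proof.
apply/seteqP; split => x /=.
  by move=> /existsNP[k /negP]; rewrite -ltNge => h; exists k; rewrite subr_gt0.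
by move=> [k]; rewrite subr_gt0 ltNge => /negP h /(_ k).
Qed.

Lemma measurable_gram_below n L : measurable (gram_below n L).
Proof.
rewrite -(setCK (gram_below n L)) setC_gram_below; apply: measurableC.
apply: (measurable_exists_gt (f := fun k (x : sequences X) => quad (sum_outer n x) (z k) - L * dotmul (z k) (z k))) => k.
apply: measurable_funB => //.
rewrite (_ : (fun _ => _) = (fun x : sequences X => \sum_(i < n) dotmul (w (x i)) (z k) ^+ 2)).
  apply: measurable_sum => i; apply: measurable_funX.
  exact: (measurableT_comp (measurable_dotmul (z k)) (measurable_coord i)).
by apply/funext => x; rewrite quad_sum_outer.
Qed.

Lemma gram_belowP n L x : gram_below n L x ->
  forall u, quad (sum_outer n x) u <= L * dotmul u u.
Proof.
move=> xL u; rewrite -subr_ge0 -quad_scalar -quadB; apply: quad_ge0_int => k.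
by rewrite quadB quad_scalar subr_ge0.
Qed.

(** Symmetrization conditioned on [gram_below n L]: there the form bound required by the trace
    moments holds with constant [L], and the single random matrix [sign_matrix] handles all
    directions [z k] simultaneously. *)
Lemma rayleigh_deviation_step n p t L : (0 < p)%N -> 0 < t -> 8 * n%:R * Q <= t ^+ 2 -> 0 <= L ->
  pr nu [set x : sequences X | exists k, t < deviation n rayleigh (mean_vector P rayleigh) x k] <=
  4 * (pr nu (~` gram_below n L) + m%:R * (4 * p%:R * Q * L / (t / 4) ^+ 2) ^+ p).
Proof.
move=> p0 t0 tQ L0.
have t40 : 0 < t / 4 by rewrite divr_gt0.
apply: (symmetrization_bounded nuP measurable_rayleigh rayleigh_bounded rayleigh_second_moment) => //.
- exact: measurable_gram_below.
- by rewrite mulr_ge0// exprn_ge0// divr_ge0 ?exprn_ge0 ?(ltW t40)// !mulr_ge0// ltW.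
move=> x xL.
have H := @sign_matrix_tail R m n (fun i => w (x i)) Q L (ltW Q0) L0 _ _ p (t / 4) p0 t40.
apply: le_trans (H _ _); last 2 first.
- by move=> i _; exact: wQ.
- by move=> u; rewrite -quad_sum_outer; exact: gram_belowP.
rewrite ler_nat; apply: sub_count => s /asboolP[k tk]; apply/asboolP; exists (z k).
have [z0|z0] := eqVneq (z k) 0.
  move: tk; rewrite /signed_sum big1 => [|i _]; first by rewrite enorm0 ltNge (ltW t40).
  rewrite /rayleigh z0 !dotmul0r invr0 mulr0.
  by apply/matrixP => ? ?; rewrite !mxE mulr0.
have zz : 0 < dotmul (z k) (z k) by rewrite lt_neqAle eq_sym dotmul_eq0 z0 dotmul_ge0.
rewrite -ltr_pdivlMr// -[X in _ < _ / X]gtr0_norm// -normf_div -enorm_const.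
move: tk; congr (_ < enorm _); apply/matrixP => a b; rewrite summxE !mxE.
rewrite /quad mulmx_suml dotmul_sumr mulr_suml; apply: eq_bigr => i _.
by rewrite !mxE -scalemxAl dotmulZr -/(quad _ _) quad_outer1 mulrA.
Qed.


Lemma gram_below_all n L : n%:R * Q <= L -> ~` gram_below n L = set0.
Proof.
move=> nQL; apply/seteqP; split => // x /=; apply => k.
rewrite quad_sum_outer (@le_trans _ _ (\sum_(i < n) Q * dotmul (z k) (z k)))//.
  by apply: ler_sum => i _; exact: dotmul_sqr_le.
by rewrite sumr_const card_ord -mulr_natl mulrA ler_wpM2r// dotmul_ge0.
Qed.

(** The form has mean n |z|^2, so a quotient above 2^(j+1) n deviates by more than (2^(j+1) - 1) n
    >= 2^j n. *)
Lemma gram_below_deviation n j : (0 < n)%N ->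
  ~` gram_below n (2 ^+ j.+1 * n%:R) `<=` [set x : sequences X |
    exists k, 2 ^+ j * n%:R < deviation n rayleigh (mean_vector P rayleigh) x k].
Proof.
move=> n0 x; rewrite setC_gram_below => -[k]; rewrite subr_gt0 => xk; exists k.
have [z0|z0] := eqVneq (z k) 0.
  by move: xk; rewrite z0 /quad !dotmul0l mulr0 ltxx.
have zz : 0 < dotmul (z k) (z k) by rewrite lt_neqAle eq_sym dotmul_eq0 z0 dotmul_ge0.
rewrite deviation_rayleigh//; apply: lt_le_trans (ler_norm _).
move: xk; rewrite -ltr_pdivlMr// exprS; set q := _ / _ => xk.
have : 1 <= 2 ^+ j :> R by rewrite exprn_ege1// ler1n.
have : (0 : R) < n%:R by rewrite ltr0n.
nra.
Qed.

Lemma measurable_rayleigh_deviation n t : measurable [set x : sequences X |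
  exists k, t < deviation n rayleigh (mean_vector P rayleigh) x k].
Proof.
apply: measurable_exists_gt => k; apply: measurable_deviation => k' a.
exact: measurable_rayleigh.
Qed.

(* Descending induction on the level: the conditional moment bound at level 2^j n only needs the
   upper bound 2^(j+1) n on the form, and levels above n Q are never exceeded. *)
Lemma gram_upper_tail n p : (0 < n)%N -> (3 <= p)%N -> 8 * Q <= n%:R ->
  forall j, pr nu (~` gram_below n (2 ^+ j.+1 * n%:R)) <=
    8 * (m%:R * (256 * (p%:R * Q / n%:R)) ^+ p) * (2^-1 ^+ p) ^+ j.
Proof.
move=> n0 p3 nQ j.
have n0' : (0 : R) < n%:R by rewrite ltr0n.
have k0 : 0 <= p%:R * Q / n%:R.
  by rewrite divr_ge0 ?(ltW n0')// mulr_ge0 ?ler0n ?(ltW Q0).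
set kap := p%:R * Q / n%:R in k0 *.
have k256 : 0 <= 256 * kap by lra.
set kap' := 256 * kap in k256 *.
set b := m%:R * _.
have b0 : 0 <= b by rewrite mulr_ge0 ?exprn_ge0 ?ler0n.
pose h : R := 2^-1 ^+ p.
have h0 : 0 <= h by rewrite exprn_ge0// invr_ge0.
(* This is where p >= 3 enters: 8 h <= 1 gives 4 (8 b h^(k+1) + b h^k) <= 8 b h^k, so the recursion
   closes with the same constant. *)
have h8 : h <= 8^-1.
  rewrite (_ : 8^-1 = 2^-1 ^+ 3); last by field.
  by rewrite /h ler_wiXn2l//; lra.
have two j' : (0 : R) < 2 ^+ j' by rewrite exprn_gt0.
have step i : pr nu (~` gram_below n (2 ^+ i.+1 * n%:R)) <=
    4 * (pr nu (~` gram_below n (2 ^+ i.+2 * n%:R)) + b * h ^+ i).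
  have H := le_pr nu (measurableC (measurable_gram_below n _))
    (measurable_rayleigh_deviation _ _) (@gram_below_deviation n i n0).
  apply: (le_trans H).
  have t0 : 0 < 2 ^+ i * n%:R :> R by rewrite mulr_gt0.
  have L0 : 0 <= 2 ^+ i.+2 * n%:R :> R by rewrite mulr_ge0 ?ler0n ?(ltW (two _)).
  have i1 : 1 <= 2 ^+ i :> R by rewrite exprn_ege1// ler1n.
  have tQ : 8 * n%:R * Q <= (2 ^+ i * n%:R) ^+ 2.
    apply: (@le_trans _ _ (n%:R ^+ 2)); first by rewrite expr2 mulrAC ler_pM2r.
    by rewrite ler_pXn2r// ?nnegrE ?(ltW t0) ?ler0n// ler_peMl// ler0n.
  have p0 : (0 < p)%N by rewrite (leq_trans _ p3).
  have := rayleigh_deviation_step p0 t0 tQ L0.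
  move=> /le_trans; apply; rewrite ler_pM2l// lerD2l /b -[leRHS]mulrA ler_wpM2l ?ler0n//.
  (* Here 4 p Q 2^(i+2) n / (2^i n / 4)^2 = 256 (p Q / n) 2^-i, whose p-th power produces the
     geometric factor [h ^+ i]. *)
  rewrite /h exprAC -exprMn le_eqVlt; apply/orP; left; apply/eqP; congr (_ ^+ p).
  rewrite /kap' /kap !exprS exprVn; field.
  by rewrite !gt_eqF.
(* Starting level of the descent: once 2^(J+1) >= Q the event is empty by [gram_below_all]. *)
have [J [J0 jJ]] : exists J, pr nu (~` gram_below n (2 ^+ J.+1 * n%:R)) = 0 /\ (j <= J)%N.
  pose J := maxn j (Num.truncn Q).+1; exists J; split; last exact: leq_maxl.
  rewrite gram_below_all /pr ?measure0// mulrC ler_pM2r//.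
  have QJ := truncnS_gt Q; apply: (le_trans (ltW QJ)).
  rewrite -natrX ler_nat (@leq_trans J)// ?leq_maxr//.
  by rewrite (leq_trans (ltnW (ltn_expl J (ltnSn 1))))// leq_exp2l.
suff H i : (i <= J)%N -> pr nu (~` gram_below n (2 ^+ (J - i).+1 * n%:R)) <= 8 * b * h ^+ (J - i).
  by have := H (J - j)%N (leq_subr _ _); rewrite subKn.
elim: i => [_|i IH iJ].
  by rewrite subn0 J0 mulr_ge0 ?exprn_ge0// mulr_ge0.
have e : (J - i)%N = (J - i.+1).+1 by rewrite subnSK.
have {}IH := IH (ltnW iJ); rewrite e (exprS h) in IH.
rewrite (le_trans (step _))//.
have hb : 0 <= b * h ^+ (J - i.+1) by rewrite mulr_ge0 ?exprn_ge0.
have : 8 * b * (h * h ^+ (J - i.+1)) <= b * h ^+ (J - i.+1).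
  have -> : 8 * b * (h * h ^+ (J - i.+1)) = (8 * h) * (b * h ^+ (J - i.+1)) by ring.
  by rewrite ler_piMl//; lra.
by lra.
Qed.

Definition gram_ill n : set (sequences X) :=
  [set x : sequences X | exists k, n%:R / 2 < deviation n rayleigh (mean_vector P rayleigh) x k].

Lemma gram_illP n x : ~ gram_ill n x ->
  forall u, n%:R / 2 * dotmul u u <= quad (sum_outer n x) u.
Proof.
move=> nx u; rewrite -subr_ge0 -quad_scalar -quadB; apply: quad_ge0_int => k.
rewrite quadB quad_scalar subr_ge0 -/(z k).
have [->|z0] := eqVneq (z k) 0; first by rewrite /quad !dotmul0l mulr0.
have zz : 0 < dotmul (z k) (z k) by rewrite lt_neqAle eq_sym dotmul_eq0 z0 dotmul_ge0.
have : deviation n rayleigh (mean_vector P rayleigh) x k <= n%:R / 2.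
  by rewrite leNgt; apply/negP => h; apply: nx; exists k.
rewrite deviation_rayleigh// ler_norml => /andP[h _].
rewrite -ler_pdivlMr//; lra.
Qed.

Lemma measurable_gram_ill n : measurable (gram_ill n).
Proof. exact: measurable_rayleigh_deviation. Qed.

(** The upper bound 2 n on the form, from [gram_upper_tail] at level 0, feeds one more
    symmetrization at t = n/2: the base is 4 p Q (2 n) / (n/8)^2 = 512 p Q / n, and 36 = 4 (8 +
    1). *)
Lemma gram_chernoff n p : (0 < n)%N -> (3 <= p)%N -> 32 * Q <= n%:R ->
  pr nu (gram_ill n) <= 36 * (m%:R * (512 * (p%:R * Q / n%:R)) ^+ p).
Proof.
move=> n0 p3 nQ; have n0' : (0 : R) < n%:R by rewrite ltr0n.
have nQ8 : 8 * Q <= n%:R by lra.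
have U := gram_upper_tail n0 p3 nQ8 0; rewrite expr0 mulr1 expr1 in U.
have p0 : (0 < p)%N by rewrite (leq_trans _ p3).
have t0 : 0 < n%:R / 2 :> R by rewrite divr_gt0.
have tQ : 8 * n%:R * Q <= (n%:R / 2) ^+ 2 by rewrite expr_div_n; nra.
have L0 : 0 <= 2 * n%:R :> R by rewrite mulr_ge0 ?ler0n.
apply: (le_trans (rayleigh_deviation_step p0 t0 tQ L0)).
have k0 : 0 <= p%:R * Q / n%:R.
  by rewrite divr_ge0 ?(ltW n0')// mulr_ge0 ?ler0n ?(ltW Q0).
have -> : 4 * p%:R * Q * (2 * n%:R) / (n%:R / 2 / 4) ^+ 2 = 512 * (p%:R * Q / n%:R).
  by field; rewrite gt_eqF.
set kap := p%:R * Q / n%:R in k0 U *.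
have : m%:R * (256 * kap) ^+ p <= m%:R * (512 * kap) ^+ p.
  by rewrite ler_wpM2l ?ler0n// lerXn2r ?nnegrE; lra.
move: U; set a := m%:R * (256 * kap) ^+ p; set c := m%:R * (512 * kap) ^+ p; lra.
Qed.

(** A one-sided event, contained both in [gram_ill] and in the event of a large Frobenius distance,
    so that (1a) and (1b) lead to the same exceptional set. *)
Definition gram_bad n : set (sequences X) :=
  [set x : sequences X | exists k,
     0 < n%:R / 2 * dotmul (z k) (z k) - quad (sum_outer n x) (z k)].

Lemma gram_badP n x : ~ gram_bad n x ->
  forall u, n%:R / 2 * dotmul u u <= quad (sum_outer n x) u.
Proof.
move=> nx u; rewrite -subr_ge0 -quad_scalar -quadB; apply: quad_ge0_int => k.
by rewrite quadB quad_scalar subr_ge0 -subr_le0 leNgt; apply/negP => h; apply: nx; exists k.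
Qed.

Lemma measurable_quad_sum_outer n u :
  measurable_fun setT (fun x : sequences X => quad (sum_outer n x) u).
Proof.
rewrite (_ : (fun _ => _) = (fun x : sequences X => \sum_(i < n) dotmul (w (x i)) u ^+ 2)).
  apply: measurable_sum => i; apply: measurable_funX.
  exact: (measurableT_comp (measurable_dotmul u) (measurable_coord i)).
by apply/funext => x; rewrite quad_sum_outer.
Qed.

Lemma measurable_gram_bad n : measurable (gram_bad n).
Proof.
apply: (measurable_exists_gt (f := fun k (x : sequences X) =>
  n%:R / 2 * dotmul (z k) (z k) - quad (sum_outer n x) (z k))) => k.
by apply: measurable_funB => //; exact: measurable_quad_sum_outer.
Qed.

Lemma gram_bad_sub n (D : set (sequences X)) :
  (forall x, ~ D x -> forall u, n%:R / 2 * dotmul u u <= quad (sum_outer n x) u) ->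
  gram_bad n `<=` D.
Proof.
move=> H x [k]; rewrite subr_gt0 => xk; apply: contrapT => /H /(_ (z k)).
by rewrite leNgt xk.
Qed.

Lemma gram_bad_chernoff n p : (0 < n)%N -> (3 <= p)%N -> 32 * Q <= n%:R ->
  pr nu (gram_bad n) <= 36 * (m%:R * (512 * (p%:R * Q / n%:R)) ^+ p).
Proof.
move=> n0 p3 nQ; apply: le_trans (gram_chernoff n0 p3 nQ).
by apply: le_pr (gram_bad_sub (@gram_illP n)); [exact: measurable_gram_bad|exact: measurable_gram_ill].
Qed.

(** The entries of sum_i w w^T - n I are centred sums, so the expected squared Frobenius norm is at
    most n times the sum over a, b of P(w_a^2 w_b^2), which is n P(|w|^4). Markov's inequality at
    level (n/2)^2 then costs no factor for the dimension. *)
Lemma gram_bad_frobenius n (V : R) : (0 < n)%N ->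
  (\int[P]_x (dotmul (w x) (w x) ^+ 2)%:E <= V%:E)%E ->
  pr nu (gram_bad n) <= 4 * V / n%:R.
Proof.
move=> n0 wV; have n0' : (0 : R) < n%:R by rewrite ltr0n.
pose M (x : sequences X) := sum_outer n x - n%:R%:M.
pose f a b (x : X) := w x a 0 * w x b 0.
have mf a b : measurable_fun setT (f a b) by exact: measurable_funM.
have fB a b x : `|f a b x| <= Num.sqrt Q * Num.sqrt Q by rewrite normrM ler_pM// abs_coord_le.
have ME x a b : M x a b = \sum_(i < n) (f a b (x i) - mean P (f a b)).
  rewrite sumrB sumr_const card_ord !mxE; congr (_ + - _); last by rewrite worth; case: (a == b); rewrite ?mulr1n ?mulr0n ?mul0rn.
  by rewrite summxE; apply: eq_bigr => i _; rewrite !mxE big_ord1 !mxE.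
pose F x := \tr (M x *m (M x)^T).
have FE x : F x = \sum_a \sum_b M x a b ^+ 2.
  exact: mxtrace_mulmx_tr.
have F0 x : 0 <= F x by rewrite FE !sumr_ge0// => a _; rewrite sumr_ge0// => b _; rewrite sqr_ge0.
have mM a b : measurable_fun setT (fun x : sequences X => M x a b).
  rewrite (_ : (fun _ => _) = (fun x : sequences X => \sum_(i < n) (f a b (x i) - mean P (f a b)))).
    apply: measurable_sum => i; apply: measurable_funB => //.
    exact: (measurableT_comp (mf a b) (measurable_coord i)).
  by apply/funext => x; rewrite ME.
have mF : measurable_fun setT F.
  rewrite (_ : F = (fun x => \sum_a \sum_b M x a b ^+ 2)); last by apply/funext.
  by apply: measurable_sum => a; apply: measurable_sum => b; exact: measurable_funX.
have FV : (\int[nu]_x (F x)%:E <= (n%:R * V)%:E)%E.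
  under eq_integral do rewrite FE -sumEFin.
  rewrite ge0_integral_sum//; last 2 first.
  - move=> a; apply/measurable_EFinP; apply: measurable_sum => b; exact: measurable_funX.
  - by move=> a x _; rewrite lee_fin sumr_ge0// => b _; rewrite sqr_ge0.
  have V1 : (\sum_a \sum_b \int[P]_x (f a b x ^+ 2)%:E <= V%:E)%E.
    apply: le_trans wV; rewrite (eq_bigr (fun a => \int[P]_x \sum_b (f a b x ^+ 2)%:E)%E); last first.
      move=> a _; rewrite ge0_integral_sum//.
      + by move=> b; apply/measurable_EFinP/measurable_funX.
      + by move=> b x _; rewrite lee_fin sqr_ge0.
    rewrite -ge0_integral_sum//; last 2 first.
    - by move=> a; apply: emeasurable_sum => b; apply/measurable_EFinP/measurable_funX.
    - by move=> a x _; rewrite sume_ge0// => b _; rewrite lee_fin sqr_ge0.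
    rewrite le_eqVlt; apply/orP; left; apply/eqP; apply: eq_integral => x _.
    rewrite expr2 dotmulE mulr_suml -sumEFin; apply: eq_bigr => a _.
    rewrite mulr_sumr -sumEFin; apply: eq_bigr => b _.
    by congr EFin; rewrite /f; ring.
  rewrite EFinM; apply: le_trans (lee_wpmul2l _ V1); last by rewrite lee_fin ltW.
  rewrite ge0_sume_distrr; last first.
    by move=> a _; rewrite sume_ge0// => b _; apply: integral_ge0 => x _; rewrite lee_fin sqr_ge0.
  apply: lee_sum => a _; under eq_integral do rewrite -sumEFin.
  rewrite ge0_integral_sum//; last 2 first.
  - by move=> b; apply/measurable_EFinP/measurable_funX.
  - by move=> b x _; rewrite lee_fin sqr_ge0.
  rewrite ge0_sume_distrr; last by move=> b _; apply: integral_ge0 => x _; rewrite lee_fin sqr_ge0.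
  apply: lee_sum => b _; under eq_integral do rewrite ME.
  have [i1 z1 i2 l2] := centered_bounded P (mf a b) (fB a b).
  rewrite (integral_sqr_sum nuP n i1 z1 i2).
  by rewrite lee_wpmul2l// lee_fin ltW.
have H := pr_markov mF F0 (sqr_ge0 (n%:R / 2)) FV.
have mD : measurable [set x : sequences X | (n%:R / 2) ^+ 2 < F x] by exact: measurable_gt.
have Hs : gram_bad n `<=` [set x : sequences X | (n%:R / 2) ^+ 2 < F x].
  apply: gram_bad_sub => x /negP; rewrite -leNgt => Fx u.
  have -> : quad (sum_outer n x) u = quad (M x) u + n%:R * dotmul u u.
    by rewrite /M quadB quad_scalar subrK.
  have h1 : `|quad (M x) u| <= n%:R / 2 * dotmul u u.
    rewrite (le_trans (dotmul_le_enorm _ _))//.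
    rewrite -enorm_sqr expr2 mulrCA ler_wpM2l ?enorm_ge0//.
    rewrite (le_trans (enorm_mulmx _ _))// ler_wpM2r ?enorm_ge0//.
    rewrite -(ler_pXn2r (n := 2))// ?nnegrE ?sqrtr_ge0 ?divr_ge0 ?(ltW n0')// sqr_sqrtr//.
    exact: F0.
  move: h1; rewrite ler_norml => /andP[h _]; lra.
have := le_pr nu (measurable_gram_bad n) mD Hs => /le_trans; apply.
set p := pr _ _ in H *.
rewrite -(ler_pM2l n0') -(ler_pM2l n0').
have -> : n%:R * (n%:R * (4 * V / n%:R)) = 4 * (n%:R * V) by field; rewrite gt_eqF.
have -> : n%:R * (n%:R * p) = 4 * ((n%:R / 2) ^+ 2 * p) by field.
by rewrite ler_pM2l.
Qed.

End gram_concentration.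

(** * Whitened regression *)

Section whitening.
Context (R : realType).

(** Cholesky elimination by induction on the size: [D'] is the Schur complement of the corner [a],
    whitened by [T'], and the witness is block lower triangular. *)
Lemma whitening m (G : 'M[R]_m) : G^T = G -> (forall u, u != 0 -> 0 < quad G u) ->
  exists T : 'M[R]_m, T *m G *m T^T = 1%:M.
Proof.
elim: m G => [|m IH] G sG pG; first by exists 0; rewrite [LHS]flatmx0 [RHS]flatmx0.
rewrite -[m.+1]/(1 + m)%N in G sG pG *.
pose a := ulsubmx G 0 0; pose b := dlsubmx G; pose D := drsubmx G.
have GE : G = block_mx a%:M b^T b D.
  rewrite -[LHS]submxK; congr block_mx; first exact: mx11_scalar.
  by rewrite /b -[in RHS]sG trmx_dlsub trmxK.
have sD : D^T = D by rewrite /D trmx_drsub sG.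
have a0 : 0 < a.
  have n0 : col_mx 1%:M (0 : 'cV[R]_m) != 0.
    apply/eqP => /matrixP /(_ (lshift m 0) 0); rewrite col_mxEu !mxE => /eqP.
    by rewrite oner_eq0.
  have := pG _ n0; rewrite /quad GE mul_block_col !mulmx0 !addr0 /dotmul tr_col_mx mul_row_col.
  by rewrite trmx0 mul0mx addr0 trmx1 mul1mx mulmx1 !mxE mulr1n.
pose D' := D - a^-1 *: (b *m b^T).
have sD' : D'^T = D' by rewrite /D' linearB linearZ/= trmx_mul trmxK sD.
have pD' u : u != 0 -> 0 < quad D' u.
  (* This first coordinate minimizes the form at (s, u), where it takes the value [quad D' u];
     positivity thus passes to the Schur complement. *)
  move=> u0; pose s := - (a^-1 * dotmul b u).
  have n0 : col_mx s%:M u != 0.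
    apply: contraNneq u0 => e; have := congr1 dsubmx e; rewrite col_mxKd => ->.
    by apply/eqP/matrixP => i j; rewrite !mxE.
  have := pG _ n0; congr (0 < _).
  have bu : b^T *m u = (dotmul b u)%:M by rewrite [LHS]mx11_scalar.
  have ub : u^T *m b = (dotmul b u)%:M by rewrite dotmulC [LHS]mx11_scalar.
  rewrite GE /quad {1}/dotmul mul_block_col tr_col_mx mul_row_col bu tr_scalar_mx.
  have -> : u^T *m (b *m s%:M + D *m u) = (s * dotmul b u)%:M + u^T *m (D *m u).
    by rewrite mulmxDr mulmxA ub -scalar_mxM mulrC.
  rewrite -scalar_mxM mul_scalar_mx.
  have entry (x y y' y'' : R) (M : 'M[R]_1) :
    (x *: (y%:M + y'%:M) + (y''%:M + M)) 0 0 = x * (y + y') + (y'' + M 0 0).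
    by rewrite !mxE !mulr1n.
  rewrite entry -[_ 0 0]/(dotmul u (D *m u)).
  rewrite /D' mulmxBl dotmulBr -scalemxAl dotmulZr -mulmxA bu mul_mx_scalar dotmulZr (dotmulC u b).
  by rewrite /s; field; rewrite gt_eqF.
have [T' hT'] := IH D' sD' pD'.
pose s := (Num.sqrt a)^-1.
have s0 : 0 < Num.sqrt a by rewrite sqrtr_gt0.
have ass : a * s ^+ 2 = 1 by rewrite /s exprVn sqr_sqrtr ?ltW// divff ?gt_eqF.
pose c := T' *m b.
exists (block_mx s%:M 0 (- (a^-1 *: c)) T').
rewrite GE mulmx_block !mul0mx !addr0 tr_block_mx trmx0 tr_scalar_mx mulmx_block.
rewrite !mulmx0 !addr0 [RHS](@scalar_mx_block _ 1 m).
have zero1 : - (a^-1 *: c) *m a%:M + T' *m b = 0.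
  by rewrite mul_mx_scalar scalerN scalerA divff ?gt_eqF// scale1r addNr.
rewrite zero1 !mul0mx !add0r.
have row1 : s%:M *m a%:M *m (- (a^-1 *: c))^T + s%:M *m b^T *m T'^T = 0.
  rewrite -scalar_mxM !mul_scalar_mx -scalemxAl -trmx_mul -/c linearN/= linearZ/=.
  by rewrite scalerN scalerA mulfK ?gt_eqF// addNr.
have row2 : (- (a^-1 *: c) *m b^T + T' *m D) *m T'^T = 1%:M.
  rewrite -hT'; congr (_ *m _); rewrite /D' mulmxBr addrC -scalemxAr mulNmx -scalemxAl.
  by rewrite /c mulmxA.
rewrite row1 row2 -!scalar_mxM; congr block_mx; congr scalar_mx.
by rewrite -ass; ring.
Qed.

End whitening.

Section mean_theory.
Context d (X : measurableType d) (R : realType) (P : probability X R).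
Local Notation intg f := (P.-integrable setT (EFin \o f)).

Lemma integrable_lincomb (I : Type) (s : seq I) (c : I -> R) (F : I -> X -> R) :
  (forall i, intg (F i)) -> intg (fun x => \sum_(i <- s) c i * F i x).
Proof.
move=> iF; rewrite (_ : EFin \o _ = (fun x => \sum_(i <- s) (c i)%:E * (F i x)%:E)%E).
  by apply: integrable_sum => // i _; exact: integrableZl (iF i).
by apply/funext => x /=; rewrite -sumEFin; apply: eq_bigr => i _; rewrite EFinM.
Qed.

Lemma mean_lincomb (I : Type) (s : seq I) (c : I -> R) (F : I -> X -> R) :
  (forall i, intg (F i)) ->
  mean P (fun x => \sum_(i <- s) c i * F i x) = \sum_(i <- s) c i * mean P (F i).
Proof.
move=> iF; apply: EFin_inj; rewrite -EFin_mean; last exact: integrable_lincomb.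
under eq_integral do rewrite -sumEFin.
rewrite integral_sum//; last first.
  by move=> i; under [X in integrable _ _ X]eq_fun do rewrite EFinM; exact: integrableZl (iF i).
rewrite -sumEFin; apply: eq_bigr => i _; under eq_integral do rewrite EFinM.
by rewrite integralZl ?(iF i)// (EFin_mean (iF i)) EFinM.
Qed.

Lemma meanD f g : intg f -> intg g -> mean P (fun x => f x + g x) = mean P f + mean P g.
Proof. by move=> fi gi; rewrite /mean RintegralD. Qed.

Lemma mean_ge0 f : (forall x, 0 <= f x) -> 0 <= mean P f.
Proof. by move=> f0; apply: Rintegral_ge0 => x _. Qed.

End mean_theory.

Section whitened_regression.
Context d (X : measurableType d) (R : realType) (P : probability X R).
Context (m : nat) (h : X -> 'cV[R]_m).
Hypothesis hfm : feature_map P h.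

Let m0 : (0 < m)%N. Proof. by case: hfm. Qed.
Let G := gram (mean P) h.
Let G_unit : G \in unitmx. Proof. by case: hfm. Qed.

Lemma measurable_feature a : measurable_fun setT (fun x => h x a 0).
Proof. by case: hfm => _ /(_ a) /sub_Lfun_mfun + _ _; rewrite inE. Qed.

Lemma integrable_feature2 a b : P.-integrable setT (EFin \o (fun x => h x a 0 * h x b 0)).
Proof.
by apply/Lfun1_integrable; apply: Lfun2_mul_Lfun1; case: hfm.
Qed.

Lemma quad_gram u : quad G u = mean P (fun x => dotmul (h x) u ^+ 2).
Proof.
transitivity (mean P (fun x => \sum_(ab : 'I_m * 'I_m)
   (u ab.1 0 * u ab.2 0) * (h x ab.1 0 * h x ab.2 0))).
  rewrite mean_lincomb; last by move=> [a b]; exact: integrable_feature2.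
  rewrite -(pair_big xpredT xpredT (fun a b => u a 0 * u b 0 * mean P (fun x => h x a 0 * h x b 0)))/=.
  rewrite /quad dotmulE; apply: eq_bigr => a _; rewrite mxE mulr_sumr.
  by apply: eq_bigr => b _; rewrite !mxE; ring.
congr (mean P _); apply/funext => x.
rewrite -(pair_big xpredT xpredT (fun a b => u a 0 * u b 0 * (h x a 0 * h x b 0)))/=.
rewrite expr2 dotmulE mulr_suml; apply: eq_bigr => a _; rewrite mulr_sumr.
by apply: eq_bigr => b _; ring.
Qed.

Lemma gram_sym (E : (X -> R) -> R) : (gram E h)^T = gram E h.
Proof.
by apply/matrixP => a b; rewrite !mxE; congr E; apply/funext => x; rewrite mulrC.
Qed.

(** A semidefinite invertible matrix is definite: if <u, G u> = 0 and e = G u, the form at u - s e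
    is -2 s |e|^2 + s^2 <e, G e>, which is negative for small s > 0 unless e = 0. *)
Lemma quad_gram_gt0 u : u != 0 -> 0 < quad G u.
Proof.
move=> u0; have G0 v : 0 <= quad G v by rewrite quad_gram mean_ge0// => x; rewrite sqr_ge0.
rewrite lt_neqAle G0 andbT eq_sym; apply: contraNneq u0 => Gu.
suff e0 : G *m u = 0 by rewrite -(mulKmx G_unit u) e0 mulmx0.
apply/eqP; rewrite -dotmul_eq0; set e := G *m u; apply/eqP.
have ee := dotmul_ge0 e; have ge := G0 e.
pose s := dotmul e e / (quad G e + 1).
have q1 : 0 < quad G e + 1 by rewrite ltr_wpDl.
have sq : s * (quad G e + 1) = dotmul e e by rewrite /s divfK// gt_eqF.
have s0 : 0 <= s by rewrite divr_ge0// ltW.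
have := G0 (u - s *: e).
have -> : quad G (u - s *: e) = - (2 * s * dotmul e e) + s ^+ 2 * quad G e.
  rewrite {1}/quad mulmxBr -scalemxAr dotmulBl !dotmulBr !dotmulZl !dotmulZr.
  rewrite -!/(quad _ _) Gu -(dotmul_sym u e (gram_sym _)) -/e -/G -/e; ring.
set q := quad G e in ge q1 sq *; set y := dotmul e e in ee sq *.
move=> H; have : s * y <= 0 by nra.
rewrite -sq mulrA => H2.
have : s = 0 by nra.
by move=> ->; rewrite mul0r.
Qed.

Lemma exists_whitening : exists T : 'M[R]_m, T *m G *m T^T = 1%:M.
Proof. by apply: whitening; [exact: gram_sym|exact: quad_gram_gt0]. Qed.

Variable T : 'M[R]_m.
Hypothesis hT : T *m G *m T^T = 1%:M.

Definition whitened x : 'cV[R]_m := T *m h x.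
Local Notation w := whitened.

Lemma invmx_gram : invmx G = T^T *m T.
Proof.
have e : G *m (T^T *m T) = 1%:M by rewrite mulmxA; apply: mulmx1C; rewrite mulmxA.
by rewrite -[LHS]mulmx1 -e mulKmx.
Qed.

Lemma T_unit : T \in unitmx.
Proof. by move: hT; rewrite -mulmxA => /mulmx1_unit[]. Qed.

Lemma dotmul_mulmxl (A : 'M[R]_m) u v : dotmul (A *m u) v = dotmul u (A^T *m v).
Proof. by rewrite /dotmul trmx_mul mulmxA. Qed.

Lemma leverage_whitened x : leverage P h x = dotmul (w x) (w x).
Proof. by rewrite /leverage invmx_gram /w dotmul_mulmxl !mulmxA. Qed.

Local Notation Q := (leverage_sup P h).

Lemma supnormP (g : X -> R) : (supnorm g < +oo)%E ->
  forall x, `|g x| <= fine (supnorm g).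
Proof.
move=> gfin x; have gx : (`|g x|%:E <= supnorm g)%E.
  by apply: ereal_sup_ubound; right; exists x.
rewrite -lee_fin fineK// ge0_fin_numE// (le_trans _ gx)//.
Qed.

Lemma whitened_le x : dotmul (w x) (w x) <= Q.
Proof.
rewrite -leverage_whitened (le_trans (ler_norm _))//.
by apply: (supnormP (g := leverage P h)); case: hfm.
Qed.

Lemma measurable_whitened a : measurable_fun setT (fun x => w x a 0).
Proof.
rewrite (_ : (fun _ => _) = (fun x => \sum_b T a b * h x b 0)).
  by apply: measurable_sum => b; apply: measurable_funM => //; exact: measurable_feature.
by apply/funext => x; rewrite mxE.
Qed.

Lemma whitened_orth a b : mean P (fun x => w x a 0 * w x b 0) = (a == b)%:R.
Proof.
transitivity (mean P (fun x => \sum_(cd : 'I_m * 'I_m)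
   (T a cd.1 * T b cd.2) * (h x cd.1 0 * h x cd.2 0))).
  congr (mean P _); apply/funext => x.
  rewrite -(pair_big xpredT xpredT (fun i j => T a i * T b j * (h x i 0 * h x j 0)))/=.
  rewrite !mxE mulr_suml; apply: eq_bigr => i _; rewrite mulr_sumr.
  by apply: eq_bigr => j _; ring.
rewrite mean_lincomb; last by move=> [i j]; exact: integrable_feature2.
rewrite -(pair_big xpredT xpredT (fun i j => T a i * T b j * mean P (fun x => h x i 0 * h x j 0)))/=.
transitivity ((T *m G *m T^T) a b); last by rewrite hT mxE.
rewrite mxE exchange_big/=; apply: eq_bigr => j _; rewrite !mxE mulr_suml.
by apply: eq_bigr => i _; rewrite mxE; ring.
Qed.

Lemma whitened_mean_sqr : mean P (fun x => dotmul (w x) (w x)) = m%:R.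
Proof.
transitivity (mean P (fun x => \sum_a 1 * (w x a 0 * w x a 0))).
  by congr (mean P _); apply/funext => x; rewrite dotmulE; apply: eq_bigr => a _; rewrite mul1r.
rewrite mean_lincomb; last first.
  move=> a; apply: (@bounded_integrable _ _ _ _ _ Q) => [|x].
    by apply: measurable_funM; exact: measurable_whitened.
  rewrite -expr2 ger0_norm ?sqr_ge0// (le_trans _ (whitened_le x))// dotmulE.
  by rewrite (bigD1 a)//= -expr2 lerDl sumr_ge0// => i _; rewrite -expr2 sqr_ge0.
under eq_bigr do rewrite whitened_orth eqxx mulr1.
by rewrite sumr_const card_ord.
Qed.

Lemma leverage_sup_ge_dim : m%:R <= Q.
Proof.
rewrite -whitened_mean_sqr -lee_fin -EFin_mean; last first.
  apply: (@bounded_integrable _ _ _ _ _ Q) => [|x].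
    rewrite (_ : (fun _ => _) = (fun x => \sum_a w x a 0 * w x a 0)).
      by apply: measurable_sum => a; apply: measurable_funM; exact: measurable_whitened.
    by apply/funext => x; rewrite dotmulE.
  by rewrite ger0_norm ?dotmul_ge0// whitened_le.
apply: (@le_trans _ _ (\int[P]_x Q%:E)%E); last first.
  by rewrite integral_cst// [X in (_ * X)%E]probability_setT mule1.
apply: ge0_le_integral => //.
- by move=> x _; rewrite lee_fin dotmul_ge0.
- apply/measurable_EFinP; rewrite (_ : (fun _ => _) = (fun x => \sum_a w x a 0 * w x a 0)).
    by apply: measurable_sum => a; apply: measurable_funM; exact: measurable_whitened.
  by apply/funext => x; rewrite dotmulE.
- by move=> x _; rewrite lee_fin whitened_le.
Qed.

Lemma leverage_sup_ge1 : 1 <= Q.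
Proof. by rewrite (le_trans _ leverage_sup_ge_dim)// ler1n. Qed.


Lemma abs_whitened_le x a : `|w x a 0| <= Num.sqrt Q.
Proof. exact: (abs_coord_le (lt_le_trans ltr01 leverage_sup_ge1) whitened_le). Qed.

(** Fourier coefficients of [f] with respect to the orthonormal system of whitened features. *)
Definition projection (f : X -> R) : 'cV[R]_m :=
  \col_a mean P (fun x => w x a 0 * f x).

Section bounded_response.
Variables (f : X -> R) (B : R).
Hypothesis mf : measurable_fun setT f.
Hypothesis fB : forall x, `|f x| <= B.

Lemma integrable_whitened_response a : P.-integrable setT (EFin \o (fun x => w x a 0 * f x)).
Proof.
apply: (@bounded_integrable _ _ _ _ _ (Num.sqrt Q * B)) => [|x].
  by apply: measurable_funM => //; exact: measurable_whitened.
by rewrite normrM ler_pM// abs_whitened_le.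
Qed.

Lemma integrable_whitened2 a b : P.-integrable setT (EFin \o (fun x => w x a 0 * w x b 0)).
Proof.
apply: (@bounded_integrable _ _ _ _ _ (Num.sqrt Q * Num.sqrt Q)) => [|x].
  by apply: measurable_funM => //; exact: measurable_whitened.
by rewrite normrM ler_pM// abs_whitened_le.
Qed.

Lemma integrable_response2 : P.-integrable setT (EFin \o (fun x => f x ^+ 2)).
Proof.
apply: (@bounded_integrable _ _ _ _ _ (B ^+ 2)) => [|x].
  exact: measurable_funX.
by rewrite normrX ler_pXn2r// nnegrE// (le_trans _ (fB x)).
Qed.

Lemma mean_sqr_residual b : mean P (fun x => (f x - dotmul (w x) b) ^+ 2) =
  mean P (fun x => f x ^+ 2) - 2 * dotmul b (projection f) + dotmul b b.
Proof.
transitivity (mean P (fun x => f x ^+ 2 + (\sum_a (- (2 * b a 0)) * (w x a 0 * f x) +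
   \sum_(ab : 'I_m * 'I_m) (b ab.1 0 * b ab.2 0) * (w x ab.1 0 * w x ab.2 0)))).
  congr (mean P _); apply/funext => x.
  rewrite -(pair_big xpredT xpredT (fun i j => b i 0 * b j 0 * (w x i 0 * w x j 0)))/=.
  rewrite sqrrB addrA; congr (_ + _).
    congr (_ + _); rewrite dotmulE -[X in - X]mulr_natl !mulr_sumr -sumrN.
    by apply: eq_bigr => a _; ring.
  rewrite expr2 dotmulE mulr_suml; apply: eq_bigr => a _; rewrite mulr_sumr.
  by apply: eq_bigr => c _; ring.
have i1 := integrable_lincomb (index_enum 'I_m) (fun a => - (2 * b a 0)) integrable_whitened_response.
have i2 := integrable_lincomb (index_enum ('I_m * 'I_m)%type) (fun ab => b ab.1 0 * b ab.2 0)
  (fun ab => integrable_whitened2 ab.1 ab.2).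
rewrite meanD//; last 2 first.
- exact: integrable_response2.
- by apply: eq_integrable (integrableD _ i1 i2) => // x _ /=; rewrite EFinD.
rewrite meanD//.
rewrite (mean_lincomb _ _ integrable_whitened_response).
rewrite (mean_lincomb _ _ (fun ab => integrable_whitened2 ab.1 ab.2)) addrA; congr (_ + _ + _).
  rewrite dotmulE mulr_sumr -sumrN; apply: eq_bigr => a _; rewrite !mxE; ring.
rewrite -(pair_big xpredT xpredT (fun i j => b i 0 * b j 0 * mean P (fun x => w x i 0 * w x j 0)))/=.
rewrite dotmulE; apply: eq_bigr => a _.
rewrite (bigD1 a)//= big1 ?addr0 => [|c ca]; rewrite whitened_orth ?eqxx ?mulr1//.
by rewrite eq_sym (negbTE ca) mulr0.
Qed.

Lemma bessel : dotmul (projection f) (projection f) <= mean P (fun x => f x ^+ 2).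
Proof.
have := mean_sqr_residual (projection f).
have : 0 <= mean P (fun x => (f x - dotmul (w x) (projection f)) ^+ 2).
  by apply: mean_ge0 => x; exact: sqr_ge0.
by move=> h1 h2; rewrite h2 in h1; lra.
Qed.

Lemma cross_whitened : cross (mean P) h f = invmx T *m projection f.
Proof.
apply/matrixP => a j; rewrite ord1 !mxE.
transitivity (mean P (fun x => \sum_b invmx T a b * (w x b 0 * f x))).
  congr (mean P _); apply/funext => x.
  have -> : h x a 0 = (invmx T *m w x) a 0 by rewrite /w mulKmx ?T_unit.
  by rewrite mxE mulr_suml; apply: eq_bigr => b _; rewrite mulrA.
rewrite (mean_lincomb _ _ integrable_whitened_response).
by apply: eq_bigr => b _; rewrite mxE.
Qed.

Lemma beta_whitened : beta P h f = T^T *m projection f.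
Proof. by rewrite /beta -/G invmx_gram cross_whitened -mulmxA mulKVmx ?T_unit. Qed.

Lemma dotmul_feature x b : dotmul (h x) (T^T *m b) = dotmul (w x) b.
Proof. by rewrite /w dotmul_mulmxl. Qed.

Lemma resid_whitened x : resid P h f x = f x - dotmul (w x) (projection f).
Proof. by rewrite /resid beta_whitened dotmul_feature. Qed.

Lemma measurable_resid : measurable_fun setT (resid P h f).
Proof.
rewrite (_ : resid P h f = (fun x => f x - \sum_a w x a 0 * projection f a 0)).
  apply: measurable_funB => //; apply: measurable_sum => a.
  by apply: measurable_funM => //; exact: measurable_whitened.
by apply/funext => x; rewrite resid_whitened dotmulE.
Qed.

Lemma enorm_whitened_le x : enorm (w x) <= Num.sqrt Q.
Proof.
by rewrite /enorm ler_sqrt ?whitened_le// (le_trans ler01 leverage_sup_ge1).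
Qed.

Lemma resid_le x : `|resid P h f x| <= B + Num.sqrt Q * B.
Proof.
have B0 : 0 <= B by rewrite (le_trans _ (fB x)).
rewrite resid_whitened (le_trans (ler_normB _ _))// lerD//.
rewrite (le_trans (dotmul_le_enorm _ _))// ler_pM ?enorm_ge0 ?enorm_whitened_le//.
rewrite -(ler_pXn2r (n := 2))// ?nnegrE ?enorm_ge0// enorm_sqr (le_trans bessel)//.
rewrite -lee_fin -EFin_mean; last exact: integrable_response2.
apply: (@le_trans _ _ (\int[P]_x (B ^+ 2)%:E)%E); last first.
  by rewrite integral_cst// [X in (_ * X)%E]probability_setT mule1.
apply: ge0_le_integral => //.
- by move=> y _; rewrite lee_fin sqr_ge0.
- by apply/measurable_EFinP; exact: measurable_funX.
- by move=> y _; rewrite lee_fin -real_normK ?num_real// ler_pXn2r// nnegrE.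
Qed.

End bounded_response.

(** The normal equations: they centre every summand of the process, so [process_tail] bounds it
    without subtracting a mean. *)
Lemma projection_resid (f : X -> R) (B : R) : measurable_fun setT f -> (forall x, `|f x| <= B) ->
  projection (resid P h f) = 0.
Proof.
move=> mf fB; apply/matrixP => a j; rewrite ord1 !mxE.
transitivity (mean P (fun x => w x a 0 * f x + \sum_b (- projection f b 0) * (w x a 0 * w x b 0))).
  congr (mean P _); apply/funext => x; rewrite (resid_whitened mf fB) mulrBr; congr (_ + _).
  by rewrite dotmulE mulr_sumr -sumrN; apply: eq_bigr => b _; ring.
rewrite meanD; last 2 first.
- exact: integrable_whitened_response mf fB a.
- exact: (integrable_lincomb _ _ (integrable_whitened2 a)).
rewrite (mean_lincomb _ _ (integrable_whitened2 a)) (bigD1 a)//= big1 => [|b ba].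
  by rewrite addr0 whitened_orth eqxx mulr1 mxE subrr.
by rewrite whitened_orth eq_sym (negbTE ba) mulr0.
Qed.

Lemma projectionB (f g : X -> R) (B : R) : measurable_fun setT f -> (forall x, `|f x| <= B) ->
  measurable_fun setT g -> (forall x, `|g x| <= B) ->
  projection (f \- g) = projection f - projection g.
Proof.
move=> mf fB mg gB; apply/matrixP => a j; rewrite !mxE.
rewrite /mean -RintegralB//; last 2 first.
- exact: integrable_whitened_response mf fB a.
- exact: integrable_whitened_response mg gB a.
by apply: eq_Rintegral => x _; rewrite mulrBr.
Qed.

(** Pythagoras in L2(P): the residual is orthogonal to the features, and whitening makes |b| the
    L2(P) norm of the shift. *)
Lemma risk_beta_shift (f : X -> R) (B : R) b : measurable_fun setT f -> (forall x, `|f x| <= B) ->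
  risk P h f (beta P h f + T^T *m b) - risk P h f (beta P h f) = dotmul b b.
Proof.
move=> mf fB; have me := measurable_resid mf fB; have eB := resid_le mf fB.
have rE c : risk P h f (beta P h f + T^T *m c) = mean P (fun x => (resid P h f x - dotmul (w x) c) ^+ 2).
  congr (mean P _); apply/funext => x.
  by rewrite dotmulDr dotmul_feature opprD addrA -/(resid P h f x).
have -> : risk P h f (beta P h f) = risk P h f (beta P h f + T^T *m 0) by rewrite mulmx0 addr0.
rewrite !rE !(mean_sqr_residual me eB) (projection_resid mf fB) !dotmul0r; ring.
Qed.

Lemma gram_empirical n (xs : nat -> X) : gram (empirical_mean n xs) h =
  n%:R^-1 *: \sum_(i < n) h (xs i) *m (h (xs i))^T.
Proof.
apply/matrixP => a b; rewrite !mxE summxE; congr (_ * _); apply: eq_bigr => i _.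
by rewrite mxE big_ord1 mxE.
Qed.

Lemma cross_empirical n (xs : nat -> X) f : cross (empirical_mean n xs) h f =
  n%:R^-1 *: \sum_(i < n) f (xs i) *: h (xs i).
Proof.
apply/matrixP => a b; rewrite ord1 !mxE summxE; congr (_ * _); apply: eq_bigr => i _.
by rewrite mxE mulrC.
Qed.

Lemma sum_outer_whitened n (xs : nat -> X) :
  T *m (\sum_(i < n) h (xs i) *m (h (xs i))^T) *m T^T = sum_outer w n xs.
Proof.
rewrite mulmx_sumr mulmx_suml; apply: eq_bigr => i _.
by rewrite /w trmx_mul !mulmxA.
Qed.

(** Write the estimator as beta + T^T b. The empirical normal equations become S b = z in whitened
    coordinates, so (n/2) |b|^2 <= <b, S b> <= |b| |z|, and |b|^2 is the excess risk. The lower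
    bound on S makes the empirical Gram matrix invertible, so any generalized inverse is its
    inverse. *)
Lemma excess_risk_le n (xs : nat -> X) (pinv : 'M[R]_m -> 'M[R]_m)
    (f : X -> R) (B : R) :
  (0 < n)%N -> (forall A, A *m pinv A *m A = A) ->
  (forall u, n%:R / 2 * dotmul u u <= quad (sum_outer w n xs) u) ->
  measurable_fun setT f -> (forall x, `|f x| <= B) ->
  risk P h f (ols h pinv n xs f) - risk P h f (beta P h f) <=
  (2 / n%:R * enorm (\sum_(i < n) resid P h f (xs i) *: w (xs i))) ^+ 2.
Proof.
move=> n0 pinvP Sge mf fB; have n0' : (0 : R) < n%:R by rewrite ltr0n.
set S := sum_outer w n xs in Sge; set z := \sum_(i < n) _.
set Gn := gram (empirical_mean n xs) h.
have S_unit : S \in unitmx.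
  rewrite -unitmx_tr -row_free_unit; apply: inj_row_free => v vS.
  have Sv : S *m v^T = 0 by rewrite -[S]trmxK -trmx_mul vS trmx0.
  have := Sge v^T; rewrite /quad Sv dotmul0r => H.
  have : dotmul v^T v^T <= 0 by have := dotmul_ge0 v^T; nra.
  rewrite le_eqVlt ltNge dotmul_ge0 orbF dotmul_eq0 => /eqP v0.
  by rewrite -[v]trmxK v0 trmx0.
have TGT : T *m Gn *m T^T = n%:R^-1 *: S.
  by rewrite /Gn gram_empirical -scalemxAr -scalemxAl sum_outer_whitened.
have Gn_unit : Gn \in unitmx.
  have : T *m Gn *m T^T \in unitmx by rewrite TGT unitmxZ// unitfE invr_eq0 gt_eqF.
  by rewrite !unitmx_mul => /andP[/andP[]].
have pinvE : pinv Gn = invmx Gn.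
  rewrite -[LHS](mulKmx Gn_unit) -[Gn *m _](mulmxK Gn_unit) pinvP.
  by rewrite mulmxV// mulmx1.
set bh := ols h pinv n xs f.
have Gbh : Gn *m bh = cross (empirical_mean n xs) h f by rewrite /bh /ols pinvE mulKVmx.
pose b := invmx T^T *m (bh - beta P h f).
have bE : T^T *m b = bh - beta P h f by rewrite mulKVmx// unitmx_tr T_unit.
have -> : bh = beta P h f + T^T *m b by rewrite bE addrC subrK.
rewrite (risk_beta_shift b mf fB).
have Sb : S *m b = z.
  have : n%:R^-1 *: (S *m b) = n%:R^-1 *: z.
    rewrite scalemxAl -TGT -(mulmxA (T *m Gn)) bE -mulmxA mulmxBr Gbh /Gn gram_empirical cross_empirical.
    rewrite -scalemxAl -scalerBr -scalemxAr; congr (_ *: _).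
    rewrite mulmx_suml -sumrB mulmx_sumr; apply: eq_bigr => i _.
    rewrite -mulmxA [_ *m beta P h f]mx11_scalar mul_mx_scalar -scalerBl -scalemxAr.
    by [].
  by move=> /(congr1 (fun v => n%:R *: v)); rewrite !scalerA divff ?gt_eqF// !scale1r.
have := Sge b; rewrite /quad Sb => H.
have bz : enorm b <= 2 / n%:R * enorm z.
  have := le_trans (ler_norm _) (dotmul_le_enorm b z) => H2.
  have {H2}H : n%:R / 2 * enorm b ^+ 2 <= enorm b * enorm z by rewrite enorm_sqr; exact: le_trans H2.
  have b0 := enorm_ge0 b; have z0 := enorm_ge0 z.
  rewrite mulrAC ler_pdivlMr//.
  have [->|bn0] := eqVneq (enorm b) 0; first by rewrite mul0r mulr_ge0.
  have bp : 0 < enorm b by rewrite lt_neqAle eq_sym bn0.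
  rewrite -(ler_pM2l bp); nra.
by rewrite -enorm_sqr ler_pXn2r ?nnegrE ?enorm_ge0// mulr_ge0 ?enorm_ge0// divr_ge0.
Qed.

End whitened_regression.

(** * The residual process *)

Section process.
Context d (X : measurableType d) (R : realType) (P : probability X R).
Variable nu : probability (sequences X) R.
Hypothesis nuP : iid_law P nu.

(** A value beyond 2 tau at k forces one beyond tau at its net point, because the summed distance
    bounds the signed sum of differences for every sign pattern. A union bound over the net
    remains. *)
Lemma net_count m n (g : nat -> nat -> 'cV[R]_m) (s : seq nat) (W tau : R) :
  0 < W -> 0 <= tau ->
  (forall k, exists2 j, j \in s & \sum_(i < n) enorm (g k i - g j i) <= tau) ->
  (forall j, \sum_(i < n) dotmul (g j i) (g j i) <= W) ->
  (count (fun e => `[< exists k, 2 * tau < enorm (signed_sum n e (g k)) >]) (signs n))%:R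
  <= (size s)%:R * (2 ^+ n * (2 * expR (- (tau ^+ 2 / (16 * W))))) :> R.
Proof.
move=> W0 tau0 net gW.
pose A j e := tau < enorm (signed_sum n e (g j)).
apply: (@le_trans _ _ (\sum_(j <- s) (count (A j) (signs n))%:R)); last first.
  rewrite mulr_natl -iter_addr_0 -(count_predT s) -big_const_seq.
  by apply: ler_sum => j _; exact: hoeffding_signs.
rewrite -natr_sum ler_nat.
apply: (@leq_trans (count (fun e => has (fun j => A j e) s) (signs n))).
  apply: sub_count => e /asboolP[k ke]; have [j js kj] := net k.
  apply/hasP; exists j => //; rewrite /A ltNge; apply/negP => je.
  have : enorm (signed_sum n e (g k)) <= enorm (signed_sum n e (g j)) + tau.
    rewrite -[signed_sum n e (g k)](subrK (signed_sum n e (g j))) addrC.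
    rewrite (le_trans (enormD _ _))// lerD2l -sumrB (le_trans (enorm_sum _ _ _))//.
    apply: le_trans kj; apply: ler_sum => i _; rewrite -scalerBr enormZ.
    by rewrite normrX normrN1 expr1n mul1r.
  lra.
elim: s {net} => [|j s IH]; first by rewrite big_nil /= (eq_count (a2 := pred0)) ?count_pred0.
rewrite big_cons (leq_trans _ (leq_add (leqnn _) IH))//=.
by rewrite -count_predUI leq_addr.
Qed.

Variables (m n : nat) (w : X -> 'cV[R]_m) (Q : R).
Hypothesis mw : forall a, measurable_fun setT (fun x => w x a 0).
Hypothesis Q0 : 0 < Q.
Hypothesis wQ : forall x, dotmul (w x) (w x) <= Q.
Variables (e : nat -> X -> R) (M gam2 Delta Nmax : R).
Hypothesis me : forall k, measurable_fun setT (e k).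
Hypothesis M0 : 0 < M.
Hypothesis eM : forall k x, `|e k x| <= M.
Hypothesis ew : forall k a, mean P (fun x => w x a 0 * e k x) = 0.
Hypothesis egam : forall k, (\int[P]_x (dotmul (w x) (w x) * e k x ^+ 2)%:E <= gam2%:E)%E.
Hypothesis n0 : (0 < n)%N.
Hypothesis Nmax0 : 0 <= Nmax.
Hypothesis cover : forall x : sequences X, exists2 s : seq nat, (size s)%:R <= Nmax &
  forall k, exists2 j, j \in s & \sum_(i < n) `|e k (x i) - e j (x i)| <= n%:R * Delta.

Let n0' : (0 : R) < n%:R. Proof. by rewrite ltr0n. Qed.

Definition energy k x : R := dotmul (w x) (w x) * e k x ^+ 2.

Lemma measurable_sqr_feature : measurable_fun setT (fun x => dotmul (w x) (w x)).
Proof.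
rewrite (_ : (fun _ => _) = (fun x => \sum_a w x a 0 * w x a 0)).
  by apply: measurable_sum => a; exact: measurable_funM.
by apply/funext => x; rewrite dotmulE.
Qed.

Lemma measurable_energy k : measurable_fun setT (energy k).
Proof. by apply: measurable_funM; [exact: measurable_sqr_feature|exact: measurable_funX]. Qed.

Lemma energy_ge0 k x : 0 <= energy k x.
Proof. by rewrite mulr_ge0 ?dotmul_ge0 ?sqr_ge0. Qed.

Lemma sqr_le k x : e k x ^+ 2 <= M ^+ 2.
Proof. by rewrite -real_normK ?num_real// ler_pXn2r ?nnegrE ?(ltW M0). Qed.

Lemma energy_le k x : energy k x <= Q * M ^+ 2.
Proof. by rewrite /energy ler_pM ?dotmul_ge0 ?sqr_ge0 ?sqr_le. Qed.

Lemma mean_energy_le k : mean P (energy k) <= gam2.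
Proof.
rewrite -lee_fin -EFin_mean; first exact: egam.
apply: (@bounded_integrable _ _ _ _ _ (Q * M ^+ 2)); first exact: measurable_energy.
by move=> x; rewrite ger0_norm ?energy_ge0 ?energy_le.
Qed.

Definition energy_good (u : R) : set (sequences X) :=
  [set x : sequences X | forall k, \sum_(i < n) energy k (x i) <= n%:R * (gam2 + u)].

Lemma setC_energy_good u : ~` energy_good u = [set x : sequences X |
  exists k, n%:R * (gam2 + u) < \sum_(i < n) energy k (x i)].
Proof.
apply/seteqP; split => x /=.
  by move=> /existsNP[k /negP]; rewrite -ltNge => h; exists k.
by move=> [k]; rewrite ltNge => /negP h /(_ k).
Qed.

Lemma measurable_energy_good u : measurable (energy_good u).
Proof.
rewrite -(setCK (energy_good u)) setC_energy_good; apply: measurableC.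
apply: (measurable_exists_gt (f := fun k (x : sequences X) => \sum_(i < n) energy k (x i))) => k.
apply: measurable_sum => i.
exact: (measurableT_comp (measurable_energy k) (measurable_coord i)).
Qed.

(* Controls the conditional variances that Hoeffding's inequality needs in process_tail. *)
Lemma energy_tail u : 0 < u -> 8 * (Q * M ^+ 2) ^+ 2 <= n%:R * u ^+ 2 ->
  16 * Q * M * Delta <= u ->
  pr nu (~` energy_good u) <=
  4 * (Nmax * (2 * expR (- (n%:R * u ^+ 2 / (1024 * (Q * M ^+ 2) ^+ 2))))).
Proof.
move=> u0 hu hD; set L := Q * M ^+ 2 in hu *.
have L0 : 0 < L by rewrite mulr_gt0 ?exprn_gt0.
pose g k x : 'cV[R]_1 := const_mx (energy k x).
have mg k a : measurable_fun setT (fun x => g k x a 0).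
  by rewrite (_ : (fun _ => _) = energy k); [exact: measurable_energy|apply/funext => x; rewrite mxE].
have gB k x a : `|g k x a 0| <= L by rewrite mxE ger0_norm ?energy_ge0 ?energy_le.
have gg k x : dotmul (g k x) (g k x) = energy k x ^+ 2 by rewrite dotmulE big_ord1 !mxE expr2.
have gL k x : dotmul (g k x) (g k x) <= L ^+ 2.
  by rewrite gg ler_pXn2r ?nnegrE ?energy_ge0 ?energy_le// ltW.
have vg k : (\int[P]_x (dotmul (g k x) (g k x))%:E <= (L ^+ 2)%:E)%E.
  apply: (@le_trans _ _ (\int[P]_x (L ^+ 2)%:E)%E); last first.
    by rewrite integral_cst// [X in (_ * X)%E]probability_setT mule1.
  apply: ge0_le_integral => //.
  - by move=> x _; rewrite lee_fin dotmul_ge0.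
  - apply/measurable_EFinP; rewrite (_ : (fun _ => _) = (fun x => energy k x ^+ 2)).
      by apply: measurable_funX; exact: measurable_energy.
    by apply/funext => x; rewrite gg.
  - by move=> x _; rewrite lee_fin gL.
pose t := n%:R * u; have t0 : 0 < t by rewrite mulr_gt0.
have ht : 8 * n%:R * L ^+ 2 <= t ^+ 2.
  have -> : t ^+ 2 = n%:R * (n%:R * u ^+ 2) by rewrite /t; ring.
  have -> : 8 * n%:R * L ^+ 2 = n%:R * (8 * L ^+ 2) by ring.
  by rewrite ler_pM2l.
set rho := Nmax * _.
have rho0 : 0 <= rho by rewrite mulr_ge0 ?mulr_ge0 ?expR_ge0.
have W0 : 0 < n%:R * L ^+ 2 by rewrite mulr_gt0 ?exprn_gt0.
have count_le x : setT x ->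
    (count (fun e => `[< signed_deviation n g e (t / 4) x >]) (signs n))%:R <= 2 ^+ n * rho.
  move=> _; have [s sN net] := cover x.
  have t8 : 0 <= t / 8 by rewrite divr_ge0 ?(ltW t0).
  have := @net_count 1 n (fun k i => g k (x i)) s (n%:R * L ^+ 2) (t / 8) W0 t8.
  move=> /(_ _ _)/le_trans; rewrite (_ : 2 * (t / 8) = t / 4); last by field.
  apply.
  - move=> k; have [j js kj] := net k; exists j => //.
    (* The energy is Lipschitz in the residual with constant 2 Q M; as 16 Q M Delta <= u, the summed
       distance to the net is at most t/8. *)
    apply: (@le_trans _ _ (\sum_(i < n) (2 * Q * M) * `|e k (x i) - e j (x i)|)).
      apply: ler_sum => i _.
      have -> : g k (x i) - g j (x i) = const_mx (energy k (x i) - energy j (x i)).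
        by apply/matrixP => a b; rewrite !mxE.
      rewrite enorm_const /energy -mulrBr subr_sqr normrM (ger0_norm (dotmul_ge0 _)).
      rewrite normrM; set D := `|e k (x i) - e j (x i)|.
      rewrite [leRHS](_ : _ = Q * (D * (M + M))); last by ring.
      rewrite ler_pM ?dotmul_ge0 ?mulr_ge0 ?normr_ge0 ?wQ// ler_wpM2l ?normr_ge0//.
      by rewrite (le_trans (ler_normD _ _))// lerD.
    rewrite -mulr_sumr (@le_trans _ _ (2 * Q * M * (n%:R * Delta)))//.
      by rewrite ler_wpM2l// !mulr_ge0// ltW.
    have -> : 2 * Q * M * (n%:R * Delta) = n%:R * (16 * Q * M * Delta) / 8 by field.
    by rewrite ler_pM2r ?invr_gt0// /t ler_pM2l.
  - move=> j; rewrite (@le_trans _ _ (\sum_(i < n) L ^+ 2))//.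
      by apply: ler_sum => i _; exact: gL.
    by rewrite sumr_const card_ord -[leLHS]mulr_natl.
  (* The threshold t/4 is split into t/8 for the net error and t/8 for the deviation at a net point;
     64 times the 16 of Hoeffding's bound gives 1024. *)
  have -> : (t / 8) ^+ 2 / (16 * (n%:R * L ^+ 2)) = n%:R * u ^+ 2 / (1024 * L ^+ 2).
    by rewrite /t; field; rewrite !gt_eqF.
  rewrite /rho; have := expR_ge0 (- (n%:R * u ^+ 2 / (1024 * L ^+ 2))).
  move: (expR _) => E E0; rewrite mulrCA ler_pM2l ?exprn_gt0// ler_wpM2r// mulr_ge0//.
have H := symmetrization_bounded nuP mg gB vg t0 ht measurableT rho0 count_le.
have p0 : pr nu (~` setT) = 0 by rewrite setCT /pr measure0.
rewrite p0 add0r in H.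
apply: le_trans H; apply: le_pr.
- by apply: measurableC; exact: measurable_energy_good.
- by apply: measurable_exists_gt => k; exact: measurable_deviation.
rewrite setC_energy_good => x [k xk]; exists k.
rewrite /deviation (_ : \sum_(i < n) _ = const_mx (\sum_(i < n) energy k (x i) - n%:R * mean P (energy k))).
  rewrite enorm_const (lt_le_trans _ (ler_norm _))// ltrBrDr.
  apply: le_lt_trans xk; rewrite mulrDr addrC lerD2r ler_pM2l//.
  exact: mean_energy_le.
apply/matrixP => a b; rewrite summxE !mxE.
have -> : n%:R * mean P (energy k) = \sum_(i < n) mean P (energy k).
  by rewrite sumr_const card_ord mulr_natl.
rewrite -sumrB.
apply: eq_bigr => i _; rewrite !mxE; congr (_ - mean P _).
by apply/funext => y; rewrite mxE.
Qed.

(** Symmetrization conditioned on [energy_good u], where the squared norms of the summands add up to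
    at most n (gam2 + u). Hoeffding's inequality then sees the variance level gam2 + u instead of
    the crude Q M^2, and the complement is paid for by [energy_tail]. *)
Lemma process_tail u tau : 0 < u -> 8 * (Q * M ^+ 2) ^+ 2 <= n%:R * u ^+ 2 ->
  16 * Q * M * Delta <= u -> 0 < tau -> 8 * gam2 <= n%:R * tau ^+ 2 ->
  8 * Num.sqrt Q * Delta <= tau -> 0 <= gam2 ->
  pr nu [set x : sequences X | exists k, n%:R * tau < enorm (\sum_(i < n) e k (x i) *: w (x i))] <=
  4 * (4 * (Nmax * (2 * expR (- (n%:R * u ^+ 2 / (1024 * (Q * M ^+ 2) ^+ 2))))) +
       Nmax * (2 * expR (- (n%:R * tau ^+ 2 / (1024 * (gam2 + u)))))).
Proof.
move=> u0 hu hD tau0 htau hD2 gam0.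
pose g k x : 'cV[R]_m := e k x *: w x.
have mg k a : measurable_fun setT (fun x => g k x a 0).
  rewrite (_ : (fun _ => _) = (fun x => e k x * w x a 0)); first exact: measurable_funM.
  by apply/funext => x; rewrite mxE.
have gB k x a : `|g k x a 0| <= M * Num.sqrt Q.
  by rewrite mxE normrM ler_pM// (abs_coord_le Q0 wQ).
have gg k x : dotmul (g k x) (g k x) = energy k x.
  by rewrite dotmulZl dotmulZr /energy; ring.
have vg k : (\int[P]_x (dotmul (g k x) (g k x))%:E <= gam2%:E)%E.
  by under eq_integral do rewrite gg; exact: egam.
pose t := n%:R * tau; have t0 : 0 < t by rewrite mulr_gt0.
have ht : 8 * n%:R * gam2 <= t ^+ 2.
  have -> : t ^+ 2 = n%:R * (n%:R * tau ^+ 2) by rewrite /t; ring.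
  have -> : 8 * n%:R * gam2 = n%:R * (8 * gam2) by ring.
  by rewrite ler_pM2l.
have gu0 : 0 < gam2 + u by rewrite ltr_wpDl.
pose rho := Nmax * (2 * expR (- (n%:R * tau ^+ 2 / (1024 * (gam2 + u))))).
rewrite -/rho.
have rho0 : 0 <= rho by rewrite mulr_ge0 ?mulr_ge0 ?expR_ge0.
have W0 : 0 < n%:R * (gam2 + u) by rewrite mulr_gt0.
have count_le x : energy_good u x ->
    (count (fun e => `[< signed_deviation n g e (t / 4) x >]) (signs n))%:R <= 2 ^+ n * rho.
  move=> xgood; have [s sN net] := cover x.
  have t8 : 0 <= t / 8 by rewrite divr_ge0 ?(ltW t0).
  have := @net_count m n (fun k i => g k (x i)) s (n%:R * (gam2 + u)) (t / 8) W0 t8.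
  move=> /(_ _ _)/le_trans; rewrite (_ : 2 * (t / 8) = t / 4); last by field.
  apply.
  - move=> k; have [j js kj] := net k; exists j => //.
    apply: (@le_trans _ _ (\sum_(i < n) Num.sqrt Q * `|e k (x i) - e j (x i)|)).
      apply: ler_sum => i _; rewrite /g -scalerBl enormZ mulrC ler_wpM2r//.
      by rewrite /enorm ler_sqrt ?wQ// ltW.
    rewrite -mulr_sumr (@le_trans _ _ (Num.sqrt Q * (n%:R * Delta)))//.
      by rewrite ler_wpM2l ?sqrtr_ge0.
    have -> : Num.sqrt Q * (n%:R * Delta) = n%:R * (8 * Num.sqrt Q * Delta) / 8 by field.
    by rewrite ler_pM2r ?invr_gt0// /t ler_pM2l.
  - by move=> j; under eq_bigr do rewrite gg; exact: xgood.
  have -> : (t / 8) ^+ 2 / (16 * (n%:R * (gam2 + u))) = n%:R * tau ^+ 2 / (1024 * (gam2 + u)).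
    by rewrite /t; field; rewrite !gt_eqF.
  rewrite /rho; have := expR_ge0 (- (n%:R * tau ^+ 2 / (1024 * (gam2 + u)))).
  move: (expR _) => E E0; rewrite mulrCA ler_pM2l ?exprn_gt0// ler_wpM2r// mulr_ge0//.
have H := symmetrization_bounded nuP mg gB vg t0 ht (measurable_energy_good u) rho0 count_le.
have c0 k : mean_vector P g k = 0.
  apply/matrixP => a b; rewrite !mxE -[RHS](ew k a); congr (mean P _).
  by apply/funext => y; rewrite mxE mulrC.
have -> : [set x : sequences X | exists k, n%:R * tau < enorm (\sum_(i < n) e k (x i) *: w (x i))] =
   [set x | exists k, t < deviation n g (mean_vector P g) x k].
  have E x k : deviation n g (mean_vector P g) x k = enorm (\sum_(i < n) e k (x i) *: w (x i)).
    by rewrite /deviation c0; congr enorm; apply: eq_bigr => i _; rewrite subr0.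
  by apply/seteqP; split => x [k]; rewrite ?E => ?; exists k; rewrite ?E.
apply: (le_trans H); rewrite ler_pM2l// lerD2r.
exact: energy_tail.
Qed.

End process.

(** * Nets for the residuals *)

Section covering.
Context d (X : measurableType d) (R : realType).

(* ge0_le_integral requires measurability, which the envelope may lack. *)
Lemma le_integralT_ge0 (mu : {measure set X -> \bar R}) (f g : X -> \bar R) :
  (forall x, 0 <= f x)%E -> (forall x, f x <= g x)%E ->
  (\int[mu]_x f x <= \int[mu]_x g x)%E.
Proof.
move=> f0 fg; have g0 x : (0 <= g x)%E by exact: le_trans (fg x).
rewrite !ge0_integralTE//; apply: ge_ereal_sup => _ [h /= hf <-].
by apply: ereal_sup_ubound; exists h => //= x; exact: le_trans (fg x).
Qed.

(* A net in L2 of the mixture of P and the sample points controls the values at the sample points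
   and, through Bessel's inequality, the projection coefficients. *)
Lemma sample_mixture (P : probability X R) n (x : nat -> X) :
  exists Qm : probability X R, forall g : X -> R, measurable_fun setT g ->
  (forall y, 0 <= g y) ->
  (\int[P]_y (g y)%:E <= n.+1%:R%:E * \int[Qm]_y (g y)%:E)%E /\
  forall i, (i < n)%N -> ((g (x i))%:E <= n.+1%:R%:E * \int[Qm]_y (g y)%:E)%E.
Proof.
(* The n + 1 unit masses are [P] and the Dirac masses at the sample points; normalizing their sum
   costs the factor n + 1. *)
pose mi i : {measure set X -> \bar R} := if i is j.+1 then \d_(x j) else P.
pose mm : {measure set X -> \bar R} := msum mi n.+1.
have mi1 i : mi i setT = 1%E.
  by case: i => [|j] /=; [exact: probability_setT|rewrite diracT].
have mmT : mm setT = n.+1%:R%:E.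
  rewrite (_ : mm setT = (\sum_(i < n.+1) mi i setT)%E)//.
  under eq_bigr do rewrite mi1.
  by rewrite sumEFin sumr_const card_ord.
have n1 : (0 : R) < n.+1%:R by rewrite ltr0n.
exists (mnormalize mm P) => g mg g0.
have mg' : measurable_fun setT (EFin \o g) by apply/measurable_EFinP.
have g0' y : setT y -> (0 <= (EFin \o g) y)%E by move=> _; rewrite lee_fin.
have E : (n.+1%:R%:E * \int[mnormalize mm P]_y (g y)%:E = \sum_(i < n.+1) \int[mi i]_y (g y)%:E)%E.
  have k0 : 0 <= (n.+1%:R : R)^-1 by rewrite invr_ge0 ltW.
  rewrite (eq_measure_integral (mscale (NngNum k0) mm)); last first.
    move=> B mB _; rewrite /= /mnormalize.
    have E : forall z : \bar R, z = n.+1%:R%:E ->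
        (if (z == 0%E) || (z == +oo%E) then [eta P]
         else fun U : set X => (mm U * ((fine z)^-1)%:E)%E) B = mscale (NngNum k0) mm B.
      by move=> z ->; rewrite eqe (gt_eqF n1)/= /mscale/= muleC.
    exact: E.
  rewrite (ge0_integral_mscale _ measurableT (NngNum k0) mg' g0')/=.
  rewrite muleA -EFinM divff ?gt_eqF// mul1e.
  exact: (ge0_integral_measure_sum mi measurableT g0' mg' n.+1).
rewrite E big_ord_recl/=.
have S0 i : (0 <= \int[mi i]_y (g y)%:E)%E by apply: integral_ge0 => y _; rewrite lee_fin.
split; first by rewrite leeDl//; apply: sume_ge0 => i _; exact: (S0 i.+1).
move=> i ltin; rewrite (bigD1 (Ordinal ltin))//=.
rewrite [X in (_ <= _ + (X + _))%E](integral_dirac (x i) measurableT mg') diracT mul1e/=.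
rewrite addeCA leeDl// adde_ge0 ?(S0 0%N)//; apply: sume_ge0 => j _; exact: (S0 j.+1).
Qed.

Lemma measurable_sqr_diff (f g : X -> R) : measurable_fun setT f -> measurable_fun setT g ->
  measurable_fun setT (fun x => (f x - g x) ^+ 2).
Proof. by move=> mf mg; apply: measurable_funX; exact: measurable_funB. Qed.

Lemma L2norm_sqr (Qm : probability X R) (g : X -> R) :
  (L2norm Qm g `^ 2)%E = (\int[Qm]_x (g x ^+ 2)%:E)%E.
Proof.
rewrite /L2norm poweR_Lnorm//; apply: eq_integral => x _.
rewrite [X in (X `^ _)%E](_ : _ = `|g x|%:E)// poweR_EFin powR_mulrn//.
by rewrite real_normK ?num_real.
Qed.

(** The function need not be measurable and its norm may be infinite, so the claim is negated and
    squares are compared. *)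
Lemma L2norm_le (Qm : probability X R) (g : X -> R) (B : R) :
  (forall x, `|g x| <= B) -> 0 <= B -> (L2norm Qm g <= B%:E)%E.
Proof.
move=> gB B0; rewrite leNgt; apply/negP => Bg.
have : ((B ^+ 2)%:E < L2norm Qm g `^ 2)%E.
  case: (L2norm Qm g) Bg => [r| |]//=.
    rewrite lte_fin => Br; have r0 : 0 <= r by rewrite (le_trans B0)// ltW.
    by rewrite lte_fin powR_mulrn// ltr_pXn2r ?nnegrE.
  by move=> _; rewrite pnatr_eq0/= ltry.
rewrite L2norm_sqr; apply/negP; rewrite -leNgt.
apply: (@le_trans _ _ (\int[Qm]_x (B ^+ 2)%:E)%E); last first.
  by rewrite integral_cst// [X in (_ * X)%E]probability_setT mule1.
apply: le_integralT_ge0 => x; rewrite lee_fin ?sqr_ge0//.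
by rewrite -real_normK ?num_real// ler_pXn2r ?nnegrE.
Qed.

Lemma sqr_diff_triangle (Qm : probability X R) (f g c : X -> R) (r : R) :
  measurable_fun setT f -> measurable_fun setT g -> measurable_fun setT c ->
  (L2norm Qm (c \- f)%R <= r%:E)%E -> (L2norm Qm (c \- g)%R <= r%:E)%E ->
  (\int[Qm]_x ((f x - g x) ^+ 2)%:E <= (4 * r ^+ 2)%:E)%E.
Proof.
move=> mf mg mc cf cg.
have r0 : 0 <= r by rewrite -lee_fin (le_trans _ cf)// Lnorm_ge0.
have sq u : (L2norm Qm u <= r%:E)%E -> (\int[Qm]_x (u x ^+ 2)%:E <= (r ^+ 2)%:E)%E.
  move=> ur; rewrite -L2norm_sqr -(powR_mulrn 2 r0) -poweR_EFin.
  apply: (@gt0_ler_poweR R 2 _ (L2norm Qm u) r%:E) => //.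
    by rewrite in_itv/= leey Lnorm_ge0.
  by rewrite in_itv/= leey lee_fin r0.
have ms u : measurable_fun setT u -> measurable_fun setT (fun x => (2 * ((c \- u) x) ^+ 2)%:E).
  move=> mu; apply/measurable_EFinP; apply: measurable_funM => //.
  by apply: measurable_sqr_diff.
have ge0 u x : (0 <= (2 * ((c \- u) x) ^+ 2)%:E)%E by rewrite lee_fin mulr_ge0 ?sqr_ge0.
apply: (@le_trans _ _ (\int[Qm]_x ((2 * ((c \- f) x) ^+ 2)%:E + (2 * ((c \- g) x) ^+ 2)%:E))%E).
  apply: le_integralT_ge0 => x; first by rewrite lee_fin sqr_ge0.
  rewrite -EFinD lee_fin /= -subr_ge0.
  by rewrite [leRHS](_ : _ = (c x - f x + (c x - g x)) ^+ 2) ?sqr_ge0//; ring.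
rewrite ge0_integralD//; [|exact: ms..].
have zint u : measurable_fun setT u -> (L2norm Qm (c \- u)%R <= r%:E)%E ->
    (\int[Qm]_x (2 * ((c \- u) x) ^+ 2)%:E <= (2 * r ^+ 2)%:E)%E.
  move=> mu ur; under eq_integral do rewrite EFinM.
  rewrite ge0_integralZl_EFin//; first by rewrite EFinM lee_wpmul2l// sq.
  - by move=> x _; rewrite lee_fin sqr_ge0.
  - by apply/measurable_EFinP; exact: measurable_sqr_diff.
rewrite (_ : (4 * r ^+ 2) = 2 * r ^+ 2 + 2 * r ^+ 2); last by ring.
by rewrite EFinD leeD// zint.
Qed.

(** The centres of the covering balls are arbitrary L2 functions; replacing each by some [F j] in
    its ball doubles the radius, hence the factor 4. The covering number is an infimum, and the
    added 1 leaves room for an actual cover. *)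
Lemma VC_net (Fam : set (X -> R)) (Fenv : X -> R) (v A B eta : R) (Qm : probability X R)
    (F : nat -> X -> R) :
  (forall f, Fam f -> measurable_fun setT f) -> (forall k, Fam (F k)) ->
  (forall x, 0 <= Fenv x <= B) -> 0 < eta < 1 -> VC_class Fam Fenv v A ->
  exists2 s : seq nat, (size s)%:R <= (A / eta) `^ v + 1 &
  forall k, exists2 j, j \in s &
    (\int[Qm]_x ((F k x - F j x) ^+ 2)%:E <= (4 * (eta * B) ^+ 2)%:E)%E.
Proof.
move=> mF FamF FB eta01 vc.
have [eta0 _] := andP eta01.
have [y [k /= [c cL cov] <-] ky] : exists2 y, [set k%:R%:E | k in [set k : nat |
    exists2 c : 'I_k -> X -> R, (forall i, [set g | g \in Lfun Qm 2%:E] (c i)) &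
      Fam `<=` \bigcup_(i in setT) [set f | (L2norm Qm (c i \- f)%R < eta%:E * L2norm Qm Fenv)%E]]] y &
    (y < ((A / eta) `^ v + 1)%:E)%E.
  apply: ereal_inf_lt; apply: (le_lt_trans (vc Qm eta eta01)).
  by rewrite lte_fin ltrDl.
pose near (i : 'I_k) j := (L2norm Qm (c i \- F j)%R < eta%:E * L2norm Qm Fenv)%E.
(* The default 0 concerns only balls that meet no [F j], and no index is ever assigned to such a
   ball. *)
pose rep i := xget 0%N [set j | near i j].
exists [seq rep i | i : 'I_k]; first by rewrite size_map size_enum_ord -lee_fin ltW.
move=> j; have [i _ ij] := cov _ (FamF j).
exists (rep i); first by apply/mapP; exists i => //; rewrite mem_enum.
have irep : near i (rep i) by rewrite /rep; case: xgetP => [? _ //|/(_ j)]; exact.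
have B0 : 0 <= B.
  by have /andP[F0 FB'] := FB point; exact: le_trans FB'.
have rB : (eta%:E * L2norm Qm Fenv <= (eta * B)%:E)%E.
  rewrite EFinM lee_wpmul2l ?lee_fin ?(ltW eta0)// L2norm_le// => x.
  by have /andP[? ?] := FB x; rewrite ger0_norm.
have mc : measurable_fun setT (c i).
  by have := cL i => /=; rewrite inE => /andP[]; rewrite inE.
apply: (sqr_diff_triangle _ _ mc); first exact: mF.
- exact: mF.
- by apply: le_trans rB; exact: ltW.
- by apply: le_trans rB; exact: ltW.
Qed.
End covering.

Section residual_cover.
Context d (X : measurableType d) (R : realType) (P : probability X R).
Context (m : nat) (h : X -> 'cV[R]_m).
Hypothesis hfm : feature_map P h.
Variable T : 'M[R]_m.
Hypothesis hT : T *m gram (mean P) h *m T^T = 1%:M.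
Local Notation Q := (leverage_sup P h).

(** The difference of residuals is f - g minus its projection, whose coefficients Bessel's
    inequality bounds by the L2(P) distance. As Q >= 1, both terms fit under the same bound. *)
Lemma resid_dist (f g : X -> R) (B W : R) x :
  measurable_fun setT f -> (forall x, `|f x| <= B) ->
  measurable_fun setT g -> (forall x, `|g x| <= B) ->
  mean P (fun x => (f x - g x) ^+ 2) <= W ^+ 2 -> `|f x - g x| <= W ->
  `|resid P h f x - resid P h g x| <= 2 * Num.sqrt Q * W.
Proof.
move=> mf fB mg gB fgW xW; have W0 : 0 <= W by exact: le_trans xW.
have Q1 : 1 <= Num.sqrt Q by rewrite -[leLHS]sqrtr1 ler_sqrt ?(leverage_sup_ge1 hfm hT)// (le_trans ler01 (leverage_sup_ge1 hfm hT)).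
rewrite (resid_whitened hfm hT mf fB) (resid_whitened hfm hT mg gB).
rewrite [X in `|X|](_ : _ = f x - g x - dotmul (whitened h T x) (projection P h T (f \- g))); last first.
  by rewrite (projectionB hfm hT mf fB mg gB) dotmulBr; ring.
apply: (le_trans (ler_normB _ _)).
rewrite (_ : 2 * _ * W = Num.sqrt Q * W + Num.sqrt Q * W); last by ring.
apply: lerD; first by rewrite (le_trans xW)// ler_peMl.
apply: (le_trans (dotmul_le_enorm _ _)); rewrite ler_pM ?enorm_ge0 ?(enorm_whitened_le hfm hT)//.
rewrite -(ler_pXn2r (n := 2))// ?nnegrE ?enorm_ge0// enorm_sqr.
apply: le_trans fgW; apply: (@bessel _ _ _ _ _ _ hfm _ hT _ (B + B)).
  exact: measurable_funB.
by move=> y; rewrite (le_trans (ler_normB _ _))// lerD.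
Qed.

(** In L2 of the mixture, a distance 2 eta B implies a distance at most W = 2 eta B sqrt(n + 1) both
    in L2(P) and at every sample point, so [resid_dist] applies pointwise. The loss sqrt(n + 1)
    matters only through the logarithm of the net size. *)
Lemma resid_cover (Fam : set (X -> R)) (Fenv : X -> R) (v A B eta : R) (F : nat -> X -> R) n
    (x : nat -> X) :
  (forall f, Fam f -> measurable_fun setT f) -> (forall k, Fam (F k)) ->
  (forall f x, Fam f -> `|f x| <= Fenv x) ->
  (forall x, 0 <= Fenv x <= B) -> 0 < eta < 1 -> VC_class Fam Fenv v A ->
  exists2 s : seq nat, (size s)%:R <= (A / eta) `^ v + 1 &
  forall k, exists2 j, j \in s &
    \sum_(i < n) `|resid P h (F k) (x i) - resid P h (F j) (x i)| <=
    n%:R * (4 * Num.sqrt Q * eta * B * Num.sqrt n.+1%:R).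
Proof.
move=> mF FamF Fle FB eta01 vc; have [Qm QmP] := sample_mixture P n x.
have [s sN net] := VC_net Qm mF FamF FB eta01 vc.
have mFk k : measurable_fun setT (F k) by exact: mF.
have FkB k y : `|F k y| <= B.
  by rewrite (le_trans (Fle _ y (FamF k)))//; have /andP[] := FB y.
have B0 : 0 <= B by exact: le_trans (FkB 0%N point).
have [eta0 _] := andP eta01.
exists s => // k; have [j js kj] := net k; exists j => //.
pose W := 2 * eta * B * Num.sqrt n.+1%:R.
have W2 : W ^+ 2 = n.+1%:R * (4 * (eta * B) ^+ 2).
  by rewrite /W exprMn sqr_sqrtr ?ler0n//; ring.
have W0 : 0 <= W by rewrite !mulr_ge0 ?sqrtr_ge0// ltW.
have [H1 H2] := QmP _ (measurable_sqr_diff (mFk k) (mFk j)) (fun y => sqr_ge0 _).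
have WE : (n.+1%:R%:E * \int[Qm]_y ((F k y - F j y) ^+ 2)%:E <= (W ^+ 2)%:E)%E.
  by rewrite W2 EFinM lee_wpmul2l// lee_fin ler0n.
set c := 4 * _ * _ * _ * _; have -> : n%:R * c = \sum_(i < n) c by rewrite sumr_const card_ord mulr_natl.
apply: ler_sum => i _; rewrite /c.
rewrite [leRHS](_ : _ = 2 * Num.sqrt Q * W); last by rewrite /W; ring.
apply: (resid_dist (mFk k) (FkB k) (mFk j) (FkB j)).
  rewrite -lee_fin -EFin_mean; first exact: le_trans WE.
  apply: (@bounded_integrable _ _ _ _ _ ((B + B) ^+ 2)); first exact: measurable_sqr_diff.
  move=> y; rewrite normrX ler_pXn2r ?nnegrE ?addr_ge0//.
  by rewrite (le_trans (ler_normB _ _))// lerD.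
rewrite -(ler_pXn2r (n := 2))// ?nnegrE// real_normK ?num_real// -lee_fin.
by apply: le_trans WE; exact: H2.
Qed.

End residual_cover.

(** * Bounds at a fixed sample size *)

Section nonnegative_supremum.
Context (R : realType) (T : Type) (D : set T) (g : T -> \bar R).

Lemma nnsup_ge0 : (0 <= nnsup D g)%E.
Proof. by apply: ereal_sup_ubound; left. Qed.

Lemma nnsup_ubound t : D t -> (g t <= nnsup D g)%E.
Proof. by move=> Dt; apply: ereal_sup_ubound; right; exists t. Qed.

Lemma nnsup_le z : (0 <= z)%E -> (forall t, D t -> (g t <= z)%E) -> (nnsup D g <= z)%E.
Proof. by move=> z0 gz; apply: ge_ereal_sup => _ [->//|[t Dt <-]]; exact: gz. Qed.

End nonnegative_supremum.

Lemma exp_union_bound (R : realType) (N a s E : R) : 0 <= N -> N <= expR (a * s) ->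
  (a + 1) * s <= E -> N * (2 * expR (- E)) <= 2 * expR (- s).
Proof.
move=> N0 NE sE; rewrite mulrCA ler_pM2l//.
apply: (@le_trans _ _ (expR (a * s) * expR (- ((a + 1) * s)))).
  by rewrite ler_pM ?expR_ge0// ler_expR lerN2.
by rewrite -expRD ler_expR; lra.
Qed.

Lemma sqr_ge8 (R : realType) (c : R) : 16 <= c -> 8 <= c ^+ 2.
Proof. by nra. Qed.

Section sample_size.
Context d (X : measurableType d) (R : realType) (P : probability X R).
Variable nu : probability (sequences X) R.
Hypothesis nuP : iid_law P nu.
Context (m : nat) (h : X -> 'cV[R]_m).
Hypothesis hfm : feature_map P h.
Variable T : 'M[R]_m.
Hypothesis hT : T *m gram (mean P) h *m T^T = 1%:M.
Variables (Fam : set (X -> R)) (Fenv : X -> R) (v A B : R).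
Hypothesis mF : forall f, Fam f -> measurable_fun setT f.
Hypothesis Fle : forall f x, Fam f -> `|f x| <= Fenv x.
Hypothesis FB : forall x, 0 <= Fenv x <= B.
Local Notation w := (whitened h T).
Local Notation Q := (leverage_sup P h).
Local Notation M := (resid_sup P h Fam).

Let FleB f x : Fam f -> `|f x| <= B.
Proof. by move=> Ff; rewrite (le_trans (Fle x Ff))//; have /andP[] := FB x. Qed.

Let B0 : 0 <= B.
Proof. by have /andP[F0 FB'] := FB point; exact: le_trans FB'. Qed.

Let Q1 : 1 <= Q. Proof. exact: (leverage_sup_ge1 hfm hT). Qed.
Let Q0 : 0 < Q. Proof. exact: lt_le_trans Q1. Qed.

Lemma nnsup_resid_le :
  (nnsup Fam (fun f => supnorm (resid P h f)) <= (B + Num.sqrt Q * B)%:E)%E.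
Proof.
have BQ : 0 <= B + Num.sqrt Q * B by rewrite addr_ge0// mulr_ge0 ?sqrtr_ge0.
apply: nnsup_le => [|f Ff]; first by rewrite lee_fin.
apply: nnsup_le => [|x _]; first by rewrite lee_fin.
by rewrite lee_fin (resid_le hfm hT (mF Ff))// => y; exact: FleB.
Qed.

Let resid_fin : nnsup Fam (fun f => supnorm (resid P h f)) \is a fin_num.
Proof. by rewrite ge0_fin_numE ?nnsup_ge0// (le_lt_trans nnsup_resid_le)// ltry. Qed.

Lemma resid_sup_le : M <= 2 * Num.sqrt Q * B.
Proof.
rewrite -lee_fin fineK// (le_trans nnsup_resid_le)// lee_fin.
have : 1 <= Num.sqrt Q by rewrite -[leLHS]sqrtr1 ler_sqrt ?(ltW Q0).
by move: (Num.sqrt Q) => s s1; have := B0; nra.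
Qed.

Lemma resid_sup_ubound f x : Fam f -> `|resid P h f x| <= M.
Proof.
move=> Ff; rewrite -lee_fin fineK//.
apply: le_trans (nnsup_ubound _ Ff).
exact: (nnsup_ubound (fun x => `|resid P h f x|%:E) (t := x)).
Qed.

Lemma resid_sup_ge0 : 0 <= M.
Proof. by rewrite fine_ge0// nnsup_ge0. Qed.

Let gamma2_fin : (nnsup Fam (fun f => \int[P]_x (leverage P h x * resid P h f x ^+ 2)%:E))%E
  \is a fin_num.
Proof.
rewrite ge0_fin_numE ?nnsup_ge0//.
apply: (@le_lt_trans _ _ (Q * M ^+ 2)%:E); last exact: ltry.
have QM : 0 <= Q * M ^+ 2 by rewrite mulr_ge0 ?sqr_ge0 ?(ltW Q0).
apply: nnsup_le => [|f Ff]; first by rewrite lee_fin.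
apply: (@le_trans _ _ (\int[P]_x (Q * M ^+ 2)%:E)%E); last first.
  by rewrite integral_cst// [X in (_ * X)%E]probability_setT mule1.
apply: le_integralT_ge0 => x; rewrite lee_fin (leverage_whitened hfm hT).
  by rewrite mulr_ge0 ?dotmul_ge0 ?sqr_ge0.
rewrite ler_pM ?dotmul_ge0 ?sqr_ge0 ?(whitened_le hfm hT)//.
by rewrite -real_normK ?num_real// ler_pXn2r ?nnegrE ?resid_sup_ubound ?resid_sup_ge0.
Qed.

Lemma gamma2_ge0 : 0 <= gamma2 P h Fam.
Proof. by rewrite fine_ge0// nnsup_ge0. Qed.

Lemma gamma2_ubound f : Fam f ->
  (\int[P]_x (leverage P h x * resid P h f x ^+ 2)%:E <= (gamma2 P h Fam)%:E)%E.
Proof. by move=> Ff; rewrite fineK//; exact: (nnsup_ubound _ Ff). Qed.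

Lemma excess_risk_sup_le (pinv : 'M[R]_m -> 'M[R]_m) n (x : sequences X) tau :
  (0 < n)%N -> (forall A, A *m pinv A *m A = A) -> ~ gram_bad w n x -> 0 <= tau ->
  (forall f, Fam f -> enorm (\sum_(i < n) resid P h f (x i) *: w (x i)) <= n%:R * tau) ->
  (excess_risk_sup P h pinv n x Fam <= (4 * tau ^+ 2)%:E)%E.
Proof.
move=> n0 pinvP xgood tau0 xtau; have n0' : (0 : R) < n%:R by rewrite ltr0n.
apply: nnsup_le => [|f Ff]; first by rewrite lee_fin mulr_ge0 ?sqr_ge0.
rewrite lee_fin.
apply: (le_trans (excess_risk_le hfm hT n0 pinvP (gram_badP xgood) (mF Ff) (fun y => FleB y Ff))).
rewrite (_ : 4 * tau ^+ 2 = (2 / n%:R * (n%:R * tau)) ^+ 2); last by field; rewrite gt_eqF.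
have s0 : 0 <= 2 / n%:R :> R by rewrite divr_ge0 ?ler0n.
rewrite ler_pXn2r ?nnegrE//; [|by rewrite mulr_ge0 ?enorm_ge0|by rewrite mulr_ge0 ?mulr_ge0 ?(ltW n0')].
by rewrite ler_wpM2l// xtau.
Qed.

Definition process_bad (F : nat -> X -> R) n (tau : R) : set (sequences X) :=
  [set x : sequences X | exists k,
    n%:R * tau < enorm (\sum_(i < n) resid P h (F k) (x i) *: w (x i))].

Lemma measurable_process_bad F n tau : (forall k, Fam (F k)) -> measurable (process_bad F n tau).
Proof.
move=> FF; apply: (measurable_exists_gt
  (f := fun k (x : sequences X) => enorm (\sum_(i < n) resid P h (F k) (x i) *: w (x i)))) => k.
apply: measurable_enorm => a.
rewrite (_ : (fun _ => _) =
    (fun x : sequences X => \sum_(i < n) resid P h (F k) (x i) * w (x i) a 0)); last first.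
  by apply/funext => x; rewrite summxE; apply: eq_bigr => i _; rewrite mxE.
apply: measurable_sum => i; apply: measurable_funM.
  apply: (measurableT_comp _ (measurable_coord i)).
  exact: (measurable_resid hfm hT (mF (FF k)) (fun y => FleB y (FF k))).
apply: (@measurableT_comp _ _ _ (sequences X) _ _ (fun y => w y a 0) _
  (fun x : sequences X => x i)); last exact: measurable_coord.
exact: (measurable_whitened hfm T a).
Qed.

(* c and C make both exponents of process_tail exceed the entropy a n r by n r. *)
Lemma process_rate (F : nat -> X -> R) n (a r c C : R) :
  let eta := M / (4 * Num.sqrt Q * B * Num.sqrt n.+1%:R * n%:R) in
  let V := Num.max (gamma2 P h Fam) (L2const P h Fam * Num.sqrt r) in
  16 <= c -> 1024 * (a + 1) <= c ^+ 2 -> 64 <= C -> 1024 * ((1 + c) * (a + 1)) <= C ->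
  (forall k, Fam (F k)) -> VC_class Fam Fenv v A ->
  (0 < n)%N -> 0 < M -> 0 < r <= 1 -> 1 <= n%:R * r -> 0 <= a ->
  (A / eta) `^ v + 1 <= expR (a * (n%:R * r)) ->
  pr nu (process_bad F n (Num.sqrt (C * V * r))) <= 40 * expR (- (n%:R * r)).
Proof.
move=> eta V c16 ca C64 Ca FF vc n0 M0 /andP[r0 r1] nr a0 etaN.
have n0' : (0 : R) < n%:R by rewrite ltr0n.
have n1' : (1 : R) <= n%:R by rewrite ler1n.
have sQ0 : 0 < Num.sqrt Q by rewrite sqrtr_gt0.
have B0' : 0 < B.
  have := lt_le_trans M0 resid_sup_le.
  by rewrite pmulr_rgt0// mulr_gt0.
have sn1 : 1 <= Num.sqrt n.+1%:R :> R by rewrite -[leLHS]sqrtr1 ler_sqrt ?ler0n// ler1n.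
have sn0 := lt_le_trans ltr01 sn1.
have den0 : 0 < 4 * Num.sqrt Q * B * Num.sqrt n.+1%:R * n%:R by rewrite !mulr_gt0.
have eta01 : 0 < eta < 1.
  rewrite divr_gt0//= ltr_pdivrMr// mul1r.
  apply: (le_lt_trans resid_sup_le).
  have QB : 0 < Num.sqrt Q * B by rewrite mulr_gt0.
  rewrite (_ : 2 * _ * B = 2 * (Num.sqrt Q * B)); last by ring.
  rewrite (_ : 4 * _ * B * _ * _ = 4 * (Num.sqrt n.+1%:R * n%:R) * (Num.sqrt Q * B)); last by ring.
  rewrite ltr_pM2r//; have : 1 <= Num.sqrt n.+1%:R * n%:R :> R by rewrite (le_trans n1')// ler_peMl// ltW.
  by move: (_ * n%:R) => z; lra.
(* [eta] is calibrated so that the accuracy delivered by [resid_cover] is exactly M / n. *)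
have cover (x : sequences X) : exists2 s : seq nat, (size s)%:R <= (A / eta) `^ v + 1 &
    forall k, exists2 j, j \in s &
    \sum_(i < n) `|resid P h (F k) (x i) - resid P h (F j) (x i)| <= n%:R * (M / n%:R).
  have [s sN net] := resid_cover hfm hT n x mF FF Fle FB eta01 vc.
  exists s => // k; have [j js kj] := net k; exists j => //.
  apply: le_trans kj _; rewrite (_ : 4 * _ * _ * _ * _ = M / n%:R)//.
  by rewrite /eta; field; rewrite !gt_eqF.
have L0 : 0 < Q * M ^+ 2 by rewrite mulr_gt0 ?exprn_gt0.
have LE : L2const P h Fam = Q * M ^+ 2 by rewrite /L2const mulrC.
have [L LQ] : exists L, L = Q * M ^+ 2 by eexists.
rewrite -LQ in L0 LE.
have sr0 : 0 < Num.sqrt r by rewrite sqrtr_gt0.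
have srr : Num.sqrt r ^+ 2 = r by rewrite sqr_sqrtr// ltW.
have rsr : r <= Num.sqrt r.
  by rewrite -[leLHS]srr expr2 ler_piMl ?(ltW sr0)// -[leRHS]sqrtr1 ler_sqrt.
have nsr : 1 <= n%:R * Num.sqrt r by rewrite (le_trans nr)// ler_pM2l.
have V0 : 0 < V by rewrite lt_max LE [X in _ || X]mulr_gt0 ?orbT.
have Vg : gamma2 P h Fam <= V by rewrite le_max lexx.
have VL : L * Num.sqrt r <= V by rewrite le_max -LE lexx orbT.
have c0 : 0 < c by lra.
have C0 : 0 < C by lra.
have a1 : 0 <= a + 1 by lra.
pose tau := Num.sqrt (C * V * r).
have tau2 : tau ^+ 2 = C * V * r by rewrite sqr_sqrtr// ltW// !mulr_gt0.
have tau0 : 0 < tau by rewrite sqrtr_gt0 !mulr_gt0.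
(* At this level the exponent n u^2 / L^2 equals c^2 n r, while u stays below c V. *)
pose u := c * L * Num.sqrt r.
have u0 : 0 < u by rewrite !mulr_gt0.
have H := @process_tail _ X R P nu nuP m n w Q (measurable_whitened hfm T) Q0 (whitened_le hfm hT)
  (fun k => resid P h (F k)) M (gamma2 P h Fam) (M / n%:R) ((A / eta) `^ v + 1).
have {}H := H (fun k => measurable_resid hfm hT (mF (FF k)) (fun y => FleB y (FF k))) M0
  (fun k y => resid_sup_ubound y (FF k)).
have ew k b : mean P (fun x => w x b 0 * resid P h (F k) x) = 0.
  have := projection_resid hfm hT (mF (FF k)) (fun y => FleB y (FF k)).
  by move=> /matrixP/(_ b 0); rewrite !mxE.
have eg k : (\int[P]_x (dotmul (w x) (w x) * resid P h (F k) x ^+ 2)%:E <= (gamma2 P h Fam)%:E)%E.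
  by have := gamma2_ubound (FF k); under eq_integral do rewrite (leverage_whitened hfm hT).
have N0 : 0 <= (A / eta) `^ v + 1 by rewrite addr_ge0 ?powR_ge0.
have {}H := H ew eg n0 N0 cover u tau u0.
rewrite -/tau; rewrite -LQ in H.
have u2 : n%:R * u ^+ 2 = (c ^+ 2 * L ^+ 2) * (n%:R * r).
  by rewrite /u !exprMn srr; ring.
have Vn : L / n%:R <= V.
  by apply: le_trans VL; rewrite ler_pM2l// -[leLHS]div1r ler_pdivrMr// mulrC.
have rn : n%:R^-1 <= r by rewrite -[leLHS]div1r ler_pdivrMr// mulrC.
have h1 : 8 * L ^+ 2 <= n%:R * u ^+ 2.
  have -> : n%:R * u ^+ 2 = c ^+ 2 * L ^+ 2 * (n%:R * r) by rewrite /u !exprMn srr; ring.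
  have c8 := sqr_ge8 c16.
  rewrite -[leLHS]mulr1; apply: ler_pM => //; first exact: mulr_ge0 (ler0n _ _) (sqr_ge0 _).
  exact: ler_wpM2r (sqr_ge0 _) _ _ c8.
have h2 : 16 * Q * M * (M / n%:R) <= u.
  have -> : 16 * Q * M * (M / n%:R) = 16 * L * n%:R^-1 by rewrite LQ; ring.
  rewrite ler_pM// ?invr_ge0 ?(ltW n0')//; first by rewrite mulr_ge0// ltW.
    by rewrite ler_wpM2r// ltW.
  exact: le_trans rn rsr.
have h3 : 8 * gamma2 P h Fam <= n%:R * tau ^+ 2.
  rewrite tau2 (_ : _ * (_ * _) = C * V * (n%:R * r)); last by ring.
  have CV : 8 * gamma2 P h Fam <= C * V by rewrite ler_pM ?gamma2_ge0// (le_trans _ C64)// ler_nat.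
  by rewrite (le_trans CV)// ler_peMr// mulr_ge0// ltW.
have h4 : 8 * Num.sqrt Q * (M / n%:R) <= tau.
  rewrite -(ler_pXn2r (n := 2))// ?nnegrE ?(ltW tau0)//; last first.
    by rewrite !mulr_ge0 ?invr_ge0 ?sqrtr_ge0// ltW.
  rewrite tau2 (_ : (8 * _ * _) ^+ 2 = 64 * (L / n%:R) * n%:R^-1); last first.
    by rewrite !exprMn sqr_sqrtr ?(ltW Q0)// LQ; field; rewrite gt_eqF.
  rewrite ler_pM ?invr_ge0 ?(ltW n0')// ?mulr_ge0 ?invr_ge0 ?(ltW n0') ?(ltW L0)//.
  by rewrite ler_pM// mulr_ge0 ?invr_ge0 ?(ltW n0') ?(ltW L0).
apply: (le_trans (H h1 h2 tau0 h3 h4 gamma2_ge0)) => {H h1 h2 h3 h4}.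
move: c16 ca C64 Ca; have : 0 < 1024 :> R by rewrite ltr0n.
move: 1024 => k k0 c16 ca C64 Ca.
have s0 : 0 <= n%:R * r by lra.
have e1 : (a + 1) * (n%:R * r) <= n%:R * u ^+ 2 / (k * L ^+ 2).
  rewrite (_ : n%:R * u ^+ 2 / (k * L ^+ 2) = c ^+ 2 / k * (n%:R * r)); last first.
    by rewrite /u !exprMn srr; field; rewrite !gt_eqF.
  by rewrite ler_wpM2r// ler_pdivlMr// mulrC.
have gu0 : 0 < gamma2 P h Fam + u by rewrite ltr_wpDl ?gamma2_ge0.
have e2 : (a + 1) * (n%:R * r) <= n%:R * tau ^+ 2 / (k * (gamma2 P h Fam + u)).
  rewrite ler_pdivlMr ?mulr_gt0// tau2.
  rewrite (_ : n%:R * (C * V * r) = C * V * (n%:R * r)); last by ring.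
  rewrite mulrAC ler_wpM2r//.
  have guV : gamma2 P h Fam + u <= (1 + c) * V.
    rewrite mulrDl mul1r; apply: lerD => //; rewrite /u -mulrA.
    exact: ler_wpM2l (ltW c0) _ _ VL.
  apply: (@le_trans _ _ (k * ((1 + c) * (a + 1)) * V)); last by rewrite ler_wpM2r// ltW.
  rewrite (_ : (a + 1) * _ = (a + 1) * k * (gamma2 P h Fam + u)); last by ring.
  rewrite (_ : k * _ * V = (a + 1) * k * ((1 + c) * V)); last by ring.
  by rewrite ler_wpM2l// mulr_ge0// ltW.
have H1 := exp_union_bound N0 etaN e1.
have H2 := exp_union_bound N0 etaN e2.
move: H1 H2; set x1 := _ * (2 * _); set x2 := _ * (2 * _); move: x1 x2 (expR _) => x1 x2 E; lra.
Qed.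
End sample_size.

Section net_size.
Variable R : realType.

Lemma ln2_ge : 1 / 2 <= ln 2 :> R.
Proof.
have h : -1 < - (2^-1) :> R by lra.
have := le_ln1Dx h; rewrite (_ : 1 + - 2^-1 = 2^-1); last by lra.
by rewrite lnV ?posrE// lerNl opprK; lra.
Qed.

Lemma ln_ge1 n : (4 <= n)%N -> 1 <= ln n%:R :> R.
Proof.
move=> n4; have l2 := ln2_ge.
have l4 : 2 * ln 2 <= ln n%:R :> R.
  rewrite mulr_natl -lnXn// -natrX ler_ln ?posrE ?ltr0n ?ler_nat//.
  exact: leq_trans n4.
lra.
Qed.

Lemma ln_sqrt (x : R) : 0 < x -> ln (Num.sqrt x) = ln x / 2.
Proof.
move=> x0; rewrite -[in RHS](sqr_sqrtr (ltW x0)) lnXn ?sqrtr_gt0// -mulr_natl.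
by field.
Qed.

(** With x the ratio of (log 1/M)_+ to log n and p = 3/2, this lets the power in [r_rate] dominate a
    term linear in (log 1/M)_+. *)
Lemma powR_ge_sub1 (x p : R) : 0 <= x -> 1 <= p -> x - 1 <= x `^ p.
Proof.
move=> x0 p1; have [x1|x1] := leP 1 x; last by rewrite (le_trans _ (powR_ge0 _ _))// subr_le0 ltW.
by rewrite (le_trans _ (le1r_powR x1 p1))// gerBl.
Qed.

(** Bookkeeping for [net_size]: [L], [LQ], [Ln], [LM], [L2] stand for the logarithms of 4 A B, Q, n
    + 1, 1/M and 2; [l] is log n and [x] is (log 1/M)_+. *)
Lemma entropy_arith (L LQ Ln LM L2 x l v q : R) : 0 < v -> 0 <= q ->
  L <= `|L| * l -> L2 <= l -> Ln <= 2 * l -> LQ <= q * l -> LM <= x -> 0 <= x -> 1 <= l ->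
  L2 + v * (L + LQ / 2 + Ln / 2 + l + LM) <= (1 + v * (`|L| + q + 2)) * (l + x).
Proof.
move=> v0 q0 H1 H2 H3 H4 H5 x0 l1.
have e1 : v * (L + LQ / 2 + Ln / 2 + l + LM) <= v * (`|L| * l + q * l + 2 * l + x).
  rewrite ler_wpM2l ?(ltW v0)//.
  have : 0 <= q * l by rewrite mulr_ge0//; lra.
  lra.
have e2 : v * x <= v * ((`|L| + q + 2) * x).
  by rewrite ler_wpM2l ?(ltW v0)// ler_peMl// -addrA ler_wpDl//; lra.
move: (`|L|) H1 e1 e2 => aL H1 e1 e2; lra.
Qed.

(** The logarithm of A / eta is affine in log Q, log n, log(n + 1) and log(1/M), all controlled by
    log n + (log 1/M)_+, which is at most 2 n r. Here [r] is the rate before truncation at 1. *)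
Lemma net_size (A B v M Q q : R) n :
  let a := 2 * (1 + v * (`|ln (4 * A * B)| + q + 2)) in
  let r := ln n%:R / n%:R * (1 + (Num.max (ln M^-1) 0 / ln n%:R) `^ (3 / 2)) in
  let eta := M / (4 * Num.sqrt Q * B * Num.sqrt n.+1%:R * n%:R) in
  1 <= A -> 0 < B -> 0 < v -> 0 < M -> M <= 2 * Num.sqrt Q * B -> 1 <= Q ->
  (4 <= n)%N -> 0 <= q -> ln Q <= q * ln n%:R ->
  (A / eta) `^ v + 1 <= expR (a * (n%:R * r)).
Proof.
move=> a r eta A1 B0 v0 M0 MQ Q1 n4 q0 Qq.
have n0 : (0 < n)%N by exact: leq_trans n4.
have n0' : (0 : R) < n%:R by rewrite ltr0n.
have A0 : 0 < A by lra.
have Q0 : 0 < Q by lra.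
have sQ0 : 0 < Num.sqrt Q by rewrite sqrtr_gt0.
have sn1 : 1 <= Num.sqrt n.+1%:R :> R by rewrite -[leLHS]sqrtr1 ler_sqrt ?ler0n// ler1n.
have sn0 : 0 < Num.sqrt n.+1%:R :> R by exact: lt_le_trans sn1.
have l1 := ln_ge1 n4; set l := ln n%:R in l1 Qq r *.
have l0 : 0 < l by lra.
set x := Num.max (ln M^-1) 0.
have x0 : 0 <= x by rewrite le_max lexx orbT.
have xM : ln M^-1 <= x by rewrite le_max lexx.
have nr : l + x <= 2 * (n%:R * r).
  have -> : n%:R * r = l * (1 + (x / l) `^ (3 / 2)) by rewrite /r -/x; field; rewrite gt_eqF.
  have p1 : 1 <= 3 / 2 :> R by lra.
  have := powR_ge_sub1 (divr_ge0 x0 (ltW l0)) p1; have := powR_ge0 (x / l) (3 / 2).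
  set y := x / l; have -> : x = y * l by rewrite /y divfK// gt_eqF.
  move: (_ `^ _) => z z0 yz; rewrite mulrCA -[X in X + _]mulr1 [y * l]mulrC -mulrDr ler_pM2l//.
  lra.
have Z0 : 0 < A / eta by rewrite !divr_gt0 // !mulr_gt0.
have ZE : A / eta = 4 * A * B * Num.sqrt Q * Num.sqrt n.+1%:R * n%:R * M^-1.
  by rewrite /eta; field; rewrite !gt_eqF.
have lnZ : ln (A / eta) = ln (4 * A * B) + ln Q / 2 + ln n.+1%:R / 2 + l + ln M^-1.
  have AB0 : 0 < 4 * A * B by rewrite !mulr_gt0.
  by rewrite ZE !lnM ?posrE ?invr_gt0 ?mulr_gt0// !ln_sqrt// ltr0n.
have Z1 : 1 <= A / eta.
  have e1 : eta <= 1.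
    rewrite ler_pdivrMr ?mul1r ?mulr_gt0// (le_trans MQ)//.
    rewrite [leRHS](_ : _ = 2 * Num.sqrt Q * B * (2 * (Num.sqrt n.+1%:R * n%:R))); last by ring.
    rewrite ler_peMr// ?mulr_ge0 ?(ltW B0) ?(ltW sQ0)//.
    have : 1 <= Num.sqrt n.+1%:R * n%:R :> R.
      by rewrite (le_trans sn1)// ler_peMr ?(ltW sn0)// ler1n.
    lra.
  have eta0 : 0 < eta by rewrite divr_gt0 ?mulr_gt0.
  by rewrite ler_pdivlMr// mul1r (le_trans e1).
(* Since this power is at least 1, adding 1 at most doubles it, which is the summand [ln 2]
   below. *)
have Zv1 : 1 <= (A / eta) `^ v.
  by rewrite /powR gt_eqF// -expR0 ler_expR mulr_ge0 ?(ltW v0)// ln_ge0.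
apply: (@le_trans _ _ (expR (ln 2 + v * ln (A / eta)))).
  rewrite expRD lnK ?posrE// -[X in _ <= _ * X](_ : (A / eta) `^ v = _); last by rewrite /powR gt_eqF.
  lra.
rewrite ler_expR.
have l2 : ln 2 <= l by rewrite ler_ln ?posrE// ler_nat (leq_trans _ n4).
have ln1 : ln n.+1%:R <= 2 * l.
  rewrite mulr_natl -lnXn// -natrX ler_ln ?posrE ?ltr0n ?ler_nat ?expn_gt0 ?n0//.
  by move: n4; clear; nia.
have lL : ln (4 * A * B) <= `|ln (4 * A * B)| * l.
  by rewrite (le_trans (ler_norm _))// ler_peMr.
pose S := 1 + v * (`|ln (4 * A * B)| + q + 2).
have S0 : 0 <= S by rewrite addr_ge0// mulr_ge0 ?(ltW v0)// !addr_ge0.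
have -> : a * (n%:R * r) = S * (2 * (n%:R * r)) by rewrite /a /S; ring.
apply: (@le_trans _ _ (S * (l + x))); last by rewrite ler_wpM2l.
rewrite lnZ; exact: entropy_arith.
Qed.
End net_size.

Lemma L2const_le_tau_rate (R : realType) (M L2 a : R) : M != 0 -> 0 <= L2 ->
  L2 <= tau_rate M L2 a.
Proof. by move=> M0 L0; rewrite /tau_rate (negPf M0) ler_peMr// le_max lexx. Qed.

Section finite_sample.
Context d (X : measurableType d) (R : realType) (P : probability X R).
Variable nu : probability (sequences X) R.
Hypothesis nuP : iid_law P nu.
Context (m : nat) (h : X -> 'cV[R]_m).
Hypothesis hfm : feature_map P h.
Variable T : 'M[R]_m.
Hypothesis hT : T *m gram (mean P) h *m T^T = 1%:M.
Variables (Fam : set (X -> R)) (Fenv : X -> R) (v A B : R).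
Hypothesis mF : forall f, Fam f -> measurable_fun setT f.
Hypothesis Fle : forall f x, Fam f -> `|f x| <= Fenv x.
Hypothesis FB : forall x, 0 <= Fenv x <= B.
Hypothesis vc : VC_class Fam Fenv v A.
Hypothesis v0 : 0 < v.
Hypothesis A1 : 1 <= A.
Variable pinv : 'M[R]_m -> 'M[R]_m.
Hypothesis pinvP : forall A, A *m pinv A *m A = A.
Local Notation w := (whitened h T).
Local Notation Q := (leverage_sup P h).
Local Notation M := (resid_sup P h Fam).

(** Three regimes. If M = 0 all residuals vanish. If r = 1, the bounds |eps_f| <= M and |w| <= sqrt
    Q give 4 L_n^2 off [gram_bad], with empty [E]. Otherwise [process_rate] applies, and n r >= log
    n turns its failure probability into 40 / n. The rate in terms of L_n^2 is weakened to tau at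
    the end. *)
Lemma finite_sample_bound (F : nat -> X -> R) (q aa a c C : R) n :
  let r := r_rate M n in let tau := tau_rate M (L2const P h Fam) aa in
  a = 2 * (1 + v * (`|ln (4 * A * B)| + q + 2)) ->
  16 <= c -> 1024 * (a + 1) <= c ^+ 2 -> 64 <= C -> 1024 * ((1 + c) * (a + 1)) <= C ->
  (forall k, Fam (F k)) -> (forall f, Fam f -> exists k, F k = f) ->
  (4 <= n)%N -> 0 <= q -> ln Q <= q * ln n%:R ->
  exists2 E, measurable E & pr nu E <= 40 / n%:R /\
    forall x, ~ gram_bad w n x -> ~ E x ->
      (excess_risk_sup P h pinv n x Fam <=
       (4 * (C * (Num.max (gamma2 P h Fam) (tau * Num.sqrt r) * r)))%:E)%E.
Proof.
move=> r tau aE c16 ca C64 Ca FF Fsurj n4 q0 Qq.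
have n0 : (0 < n)%N by exact: leq_trans n4.
have n0' : (0 : R) < n%:R by rewrite ltr0n.
have C0 : 0 < C by exact: lt_le_trans C64.
have Q1 := leverage_sup_ge1 hfm hT; have Q0 : 0 < Q by exact: lt_le_trans Q1.
have M0 := resid_sup_ge0 P h Fam.
have g0 := gamma2_ge0 P h Fam.
have p0 : pr nu set0 <= 40 / n%:R by rewrite /pr measure0 divr_ge0 ?ler0n.
have L0 : 0 <= L2const P h Fam by rewrite mulr_ge0 ?sqr_ge0 ?(ltW Q0).
have bound x t : 0 <= t -> (forall f y, Fam f -> `|resid P h f y| * Num.sqrt Q <= t) ->
    ~ gram_bad w n x -> (excess_risk_sup P h pinv n x Fam <= (4 * t ^+ 2)%:E)%E.
  move=> t0 tle xgood; apply: (excess_risk_sup_le hfm hT mF Fle FB n0 pinvP xgood t0) => f Ff.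
  apply: (le_trans (enorm_sum _ _ _)).
  have -> : n%:R * t = \sum_(i < n) t by rewrite sumr_const card_ord mulr_natl.
  apply: ler_sum => i _; rewrite enormZ; apply: le_trans (tle f (x i) Ff).
  by rewrite ler_wpM2l// (enorm_whitened_le hfm hT).
have [M00|Mn0] := eqVneq M 0.
  have rE : r = 1 by rewrite /r /r_rate M00 eqxx.
  exists set0 => //; split => // x xgood _.
  apply: (@le_trans _ _ 0%E); last first.
    rewrite lee_fin rE mulr1; apply: mulr_ge0 => //; apply: mulr_ge0; first exact: ltW.
    by rewrite le_max g0.
  rewrite (_ : 0%E = (4 * (0 : R) ^+ 2)%:E); last by rewrite expr0n mulr0.
  apply: bound => // f y Ff.
  have := resid_sup_ubound hfm hT mF Fle FB y Ff.
  by rewrite M00 normr_le0 => /eqP ->; rewrite normr0 mul0r.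
have Mgt0 : 0 < M by rewrite lt_neqAle eq_sym Mn0.
have tauL : L2const P h Fam <= tau by exact: L2const_le_tau_rate.
have l1 : 1 <= ln n%:R :> R by exact: ln_ge1.
set r' := ln n%:R / n%:R * (1 + (Num.max (ln M^-1) 0 / ln n%:R) `^ (3 / 2)).
have rE : r = Num.min 1 r' by rewrite /r /r_rate (negPf Mn0).
have [r1|r1] := leP 1 r'.
  have {rE}rE : r = 1 by rewrite rE min_l.
  exists set0 => //; split => // x xgood _.
  apply: (@le_trans _ _ (4 * L2const P h Fam)%:E); last first.
    rewrite lee_fin ler_pM2l// rE sqrtr1 !mulr1 (le_trans tauL)//.
    apply: (@le_trans _ _ (Num.max (gamma2 P h Fam) tau)); first by rewrite le_max lexx orbT.
    by rewrite ler_peMl ?le_max ?g0// (le_trans _ C64)// ler1n.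
  rewrite (_ : L2const P h Fam = (M * Num.sqrt Q) ^+ 2); last first.
    by rewrite exprMn sqr_sqrtr ?(ltW Q0).
  apply: bound => //; first by rewrite mulr_ge0 ?sqrtr_ge0.
  by move=> f y Ff; rewrite ler_wpM2r ?sqrtr_ge0// (resid_sup_ubound hfm hT mF Fle FB y Ff).
have {}rE : r = r' by rewrite rE min_r// ltW.
have nr : ln n%:R <= n%:R * r'.
  rewrite /r' mulrA [n%:R * _]mulrC divfK ?gt_eqF// ler_peMr ?(le_trans ler01 l1)//.
  by rewrite lerDl powR_ge0.
have nr1 : 1 <= n%:R * r' by exact: le_trans nr.
have r0 : 0 < r' by rewrite -(pmulr_rgt0 _ n0') (lt_le_trans ltr01).
have B0 : 0 < B.
  have := lt_le_trans Mgt0 (resid_sup_le hfm hT mF Fle FB).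
  by rewrite pmulr_rgt0// mulr_gt0// sqrtr_gt0.
have size_net := net_size A1 B0 v0 Mgt0 (resid_sup_le hfm hT mF Fle FB) Q1 n4 q0 Qq.
rewrite /= -aE -/r' in size_net.
have a0 : 0 <= a.
  rewrite aE mulr_ge0// addr_ge0// mulr_ge0 ?(ltW v0)//.
  by apply: addr_ge0 => //; apply: addr_ge0.
have r01 : 0 < r' <= 1 by rewrite r0 ltW.
have := process_rate nuP hfm hT mF Fle FB c16 ca C64 Ca FF vc n0 Mgt0 r01 nr1 a0 size_net.
set V := Num.max _ _; set t := Num.sqrt _ => Ht.
exists (process_bad P h T F n t); first exact: (measurable_process_bad hfm hT mF Fle FB).
have V0 : 0 <= V by rewrite le_max g0.
split.
  apply: (le_trans Ht); rewrite ler_pM2l ?ltr0n//.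
  rewrite (_ : n%:R^-1 = expR (- ln n%:R)) ?ler_expR ?lerN2//.
  by rewrite expRN lnK ?posrE.
move=> x xgood xE.
have t0 : 0 <= t by exact: sqrtr_ge0.
apply: (@le_trans _ _ (4 * t ^+ 2)%:E).
  apply: (excess_risk_sup_le hfm hT mF Fle FB n0 pinvP xgood t0) => f Ff.
  have [k <-] := Fsurj f Ff; rewrite leNgt; apply/negP => kx.
  by apply: xE; exists k.
rewrite lee_fin ler_pM2l// sqr_sqrtr; last first.
  exact: mulr_ge0 (mulr_ge0 (ltW C0) V0) (ltW r0).
rewrite -mulrA ler_pM2l// rE ler_wpM2r ?(ltW r0)//.
rewrite ge_max le_max lexx/= le_max.
by rewrite [X in _ || X]ler_wpM2r ?sqrtr_ge0// orbT.
Qed.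

End finite_sample.

(** * From the sample law to asymptotics *)

Lemma countable_enum (T : Type) (D : set T) : countable D -> D !=set0 ->
  exists2 F : nat -> T, forall k, D (F k) & forall f, D f -> exists k, F k = f.
Proof.
move=> /countable_injP[i iinj] [f0 Df0].
have pre k : exists f, D f /\ forall g, D g -> i g = k -> g = f.
  have [[g [Dg gk]]|no] := pselect (exists g, D g /\ i g = k).
    exists g; split => // g' Dg' g'k; apply: iinj; rewrite ?inE//.
    by rewrite gk.
  by exists f0; split => // g Dg gk; exfalso; apply: no; exists g.
have [F FP] := choice pre.
exists F => [k|f Df]; first by have [] := FP k.
by exists (i f); have [_ /(_ f Df erefl)] := FP (i f).
Qed.

Section sample_law.
Context d (X : measurableType d) (R : realType) (P : probability X R).
Context (dO : measure_display) (Omega : measurableType dO) (Pr : probability Omega R).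

(** The law is the image of [Pr] under the whole sample path; independence over the index sets {0,
    ..., n-1} gives its value on cylinders. *)
Lemma iid_sample_law (Xs : nat -> Omega -> X) : iid_sample Pr P Xs ->
  exists2 nu : probability (sequences X) R, iid_law P nu &
    (forall E, measurable E ->
      measurable ((fun w => (Xs ^~ w : sequences X)) @^-1` E)) /\
    forall E : set (sequences X), measurable E -> 
      Pr ((fun w => (Xs ^~ w : sequences X)) @^-1` E) = nu E.
Proof.
move=> [mX lX iX].
have mZ : measurable_fun setT (fun w => (Xs ^~ w : sequences X)).
  by apply: measurable_to_sequences => i; exact: mX.
pose Z : {mfun Omega >-> sequences X} := HB.pack (fun w => (Xs ^~ w : sequences X))
  (isMeasurableFun.Build _ _ _ _ (fun w => (Xs ^~ w : sequences X)) mZ).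
exists (distribution Pr Z).
  move=> n B mB; rewrite /distribution /pushforward/=.
  have := iX [fset i in iota 0 n]%fset B mB.
  set J := [fset i in iota 0 n]%fset.
  have JP i : (i \in J) = (i < n)%N by rewrite inE /= mem_iota add0n.
  rewrite (_ : \bigcap_(i in [set` J]) (Xs i @^-1` B i) = Z @^-1` cylinder n B); last first.
    apply/seteqP; split => w /= h i; first by move=> lti; apply: h; rewrite /= JP.
    by rewrite /= JP => /h.
  move=> JE; transitivity (\prod_(i <- J) Pr (Xs i @^-1` B i))%E; first exact: JE.
  rewrite (eq_bigr (fun i => P (B i))); last by move=> i _; exact: lX.
  rewrite -(big_mkord xpredT (fun i => P (B i))) /index_iota subn0; apply: perm_big.
  apply: uniq_perm; rewrite ?fset_uniq ?iota_uniq// => i.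
  by rewrite JP mem_iota add0n.
split => [E mE|E mE //].
by have := mZ measurableT E mE; rewrite setTI.
Qed.

(** The excess risk depends on an arbitrary pseudo-inverse and may fail to be measurable; a
    measurable superset of the tail event controls its outer probability. One constant [C] serves
    every [eps]. *)
Lemma bigO_P_near (Y : nat -> Omega -> \bar R) (c : nat -> R) :
  (exists2 C : R, 0 < C & forall eps : R, 0 < eps -> \forall n \near \oo,
     exists2 E, measurable E & (Pr E <= eps%:E)%E /\
       [set w | ((c n * C)%:E < `|Y n w|)%E] `<=` E) ->
  bigO_P Pr Y c.
Proof.
move=> [C C0 H] eps eps0; exists C => //.
have [N _ HN] := H eps eps0.
apply: (@le_trans _ _ (ereal_sup ((fun n => (Pr^*)%mu [set w | ((c n * C)%:E < `|Y n w|)%E]) @` [set n | (N <= n)%N]))).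
  apply: ereal_inf_lbound; exists [set n | (N <= n)%N] => //.
  by exists N.
apply: ge_ereal_sup => _ [n Nn <-]; have [E mE [PE sub]] := HN n Nn.
rewrite (le_trans (le_mu_ext _ sub))//.
by rewrite [leLHS]measurable_mu_extE.
Qed.

End sample_law.

Section gram_rates.
Context d (X : measurableType d) (R : realType) (P : probability X R).
Variable nu : probability (sequences X) R.
Hypothesis nuP : iid_law P nu.
Context (m : nat) (h : X -> 'cV[R]_m).
Hypothesis hfm : feature_map P h.
Variable T : 'M[R]_m.
Hypothesis hT : T *m gram (mean P) h *m T^T = 1%:M.
Local Notation w := (whitened h T).
Local Notation Q := (leverage_sup P h).

Let Q1 : 1 <= Q. Proof. exact: (leverage_sup_ge1 hfm hT). Qed.
Let Q0 : 0 < Q. Proof. exact: lt_le_trans Q1. Qed.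

Lemma gram_bad_second_moment n : (0 < n)%N ->
  pr nu (gram_bad w n) <= 4 * \int[P]_x (leverage P h x ^+ 2) / n%:R.
Proof.
move=> n0; apply: (gram_bad_frobenius nuP (measurable_whitened hfm T) Q0
  (whitened_le hfm hT) (whitened_orth hfm hT) n0).
under eq_integral do rewrite -(leverage_whitened hfm hT).
rewrite -/(mean P _) -EFin_mean//.
apply: (@bounded_integrable _ _ _ _ _ (Q ^+ 2)).
  rewrite (_ : (fun _ => _) = (fun x => (\sum_a w x a 0 * w x a 0) ^+ 2)).
    apply: measurable_funX; apply: measurable_sum => a.
    by apply: measurable_funM; exact: (measurable_whitened hfm T).
  by apply/funext => x; rewrite (leverage_whitened hfm hT) dotmulE.
move=> x; rewrite (leverage_whitened hfm hT) normrX ger0_norm ?dotmul_ge0//.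
by rewrite ler_pXn2r ?nnegrE ?dotmul_ge0 ?(ltW Q0) ?(whitened_le hfm hT).
Qed.

(** In [gram_bad_chernoff] with p of order log m, the dimension m <= 2^p moves inside the power and
    p <= 6 log(2m) bounds p Q / n by 6 dlt. The base is then at most 12 (512 dlt) <= 1, so its p-th
    power is at most 12 (512 dlt). *)
Lemma gram_bad_log_dim n (dlt : R) : (0 < n)%N ->
  dlt = Q * ln (2 * m)%:R / n%:R -> 12 * (512 * dlt) <= 1 ->
  pr nu (gram_bad w n) <= 36 * (12 * (512 * dlt)).
Proof.
move=> n0 dE d1; have n0' : (0 : R) < n%:R by rewrite ltr0n.
have m0 : (0 < m)%N by case: hfm.
have l2 := ln2_ge R.
have lm : 0 <= ln m%:R :> R by rewrite ln_ge0// ler1n.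
have l2m : ln (2 * m)%:R = ln 2 + ln m%:R :> R by rewrite natrM lnM ?posrE ?ltr0n.
(* a moment of order log m absorbs the dimension: m <= 2 ^ p *)
pose p := (trunc_log 2 m).+3.
have pl : p%:R <= 6 * ln (2 * m)%:R :> R.
  have : (2 ^ trunc_log 2 m)%:R <= m%:R :> R by rewrite ler_nat trunc_logP.
  rewrite -ler_ln ?posrE ?ltr0n ?expn_gt0// natrX lnXn// -[leLHS]mulr_natl l2m.
  have -> : p%:R = (trunc_log 2 m)%:R + 3 :> R by rewrite -natrD addn3.
  have := ler0n R (trunc_log 2 m); move: (trunc_log 2 m)%:R (ln 2) (ln m%:R) l2 lm => t a b.
  by move=> a2 b0 t0 tab; nra.
have mp : m%:R <= 2 ^+ p :> R.
  by rewrite -natrX ler_nat ltnW// (ltn_trans (trunc_log_ltn m (ltnSn 1)))// ltn_exp2l.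
have pQ : p%:R * Q / n%:R <= 6 * dlt.
  by rewrite dE !mulrA ler_pM2r ?invr_gt0// mulrAC ler_pM2r.
have Qd : Q / n%:R <= 2 * dlt.
  rewrite dE !mulrA ler_pM2r ?invr_gt0// mulrC mulrA ler_peMl ?(ltW Q0)//; lra.
have H p3 := @gram_bad_chernoff _ _ _ _ _ nuP _ _ _ (measurable_whitened hfm T) Q0
  (whitened_le hfm hT) (whitened_orth hfm hT) n p n0 p3.
have {}H := H isT.
have : 64 <= 512 :> R by rewrite ler_nat.
move: H d1; move: 512 => k H d1 k64.
have d0 : 0 <= dlt by rewrite dE divr_ge0 ?(ltW n0')// mulr_ge0 ?(ltW Q0)// l2m; lra.
have n32 : 32 * Q <= n%:R.
  rewrite -(ler_pM2r (x := n%:R^-1)) ?invr_gt0// mulfV ?gt_eqF// -mulrA.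
  have : 64 * dlt <= k * dlt by rewrite ler_wpM2r.
  lra.
apply: (le_trans (H n32)); rewrite ler_pM2l ?ltr0n//.
have k0 : 0 <= k by lra.
have z0 : 0 <= 12 * (k * dlt) by rewrite mulr_ge0// mulr_ge0//; lra.
have pk0 : 0 <= k * (p%:R * Q / n%:R).
  exact: mulr_ge0 k0 (divr_ge0 (mulr_ge0 (ler0n _ _) (ltW Q0)) (ler0n _ _)).
apply: (@le_trans _ _ ((12 * (k * dlt)) ^+ p)); last by rewrite exprS ler_piMr// exprn_ile1.
apply: (@le_trans _ _ (2 ^+ p * (k * (p%:R * Q / n%:R)) ^+ p)).
  by rewrite ler_wpM2r// exprn_ge0.
rewrite -exprMn ler_pXn2r ?nnegrE//; last exact: mulr_ge0 (ler0n _ 2) pk0.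
have : k * (p%:R * Q / n%:R) <= k * (6 * dlt) by rewrite ler_wpM2l//; lra.
lra.
Qed.
End gram_rates.

(** * The rate of a_n *)

Section envelope_rate.
Variable R : realType.

Lemma cbrtK (x : R) : 0 <= x -> (x `^ (1 / 3)) ^+ 3 = x.
Proof.
move=> x0; rewrite -powR_mulrn ?powR_ge0// -powRrM (_ : 1 / 3 * 3%:R = 1); last by field.
by rewrite powRr1.
Qed.

Lemma powR_cube (z : R) : 0 <= z -> (z ^+ 3) `^ (2 / 3) = z ^+ 2.
Proof.
move=> z0; rewrite -powR_mulrn// -powRrM (_ : 3%:R * (2 / 3) = 2%:R); last by field.
by rewrite powR_mulrn.
Qed.

(** Let s and t be the cube roots of n and log n. The exponent of [Dstar] contains (2n / log
    n)^(2/3) log n >= s^2 t, and t >= 8 v makes s^2 t / (4 v) at least 2 s^2: one s^2 is the target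
    rate, the other beats the multiples of log n <= 3 s and the constant [c1], which comes from 32 A
    B = eps c1 <= eps e^c1. *)
Lemma a_rate_le (v A B Q q eps : R) n :
  0 < v -> 1 <= A -> 0 <= B -> 1 <= Q -> (4 <= n)%N -> 0 <= q -> ln Q <= q * ln n%:R ->
  0 < eps -> (8 * v) ^+ 3 <= ln n%:R ->
  (32 * A * B / eps + 3 * (q / 2 + Num.max (4 * v) 1 / (4 * v))) ^+ 3 <= n%:R ->
  a_rate 1 v A B Q n <= eps * expR (- (n%:R `^ (2 / 3))).
Proof.
move=> v0 A1 B0 Q1 n4 q0 Qq eps0 ln_large n_large.
have n0' : (0 : R) < n%:R by rewrite ltr0n (leq_trans _ n4).
have l1 : 1 <= ln n%:R :> R by exact: ln_ge1.
have Q0 : 0 < Q by lra.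
rewrite /a_rate /Dstar mul1r; set W := Num.max _ _ in n_large *.
have W0 : 0 <= W by rewrite le_max ler01 orbT.
set l := ln n%:R in l1 Qq ln_large *.
have l0 : 0 <= l by lra.
pose s : R := n%:R `^ (1 / 3); pose t : R := l `^ (1 / 3).
have s3 : s ^+ 3 = n%:R by rewrite cbrtK// ltW.
have t3 : t ^+ 3 = l by rewrite cbrtK.
have s0 : 0 <= s by exact: powR_ge0.
have t0 : 0 <= t by exact: powR_ge0.
have t8 : 8 * v <= t by rewrite -(ler_pXn2r (n := 3))// ?nnegrE ?mulr_ge0 ?(ltW v0)// t3.
set c1 := 32 * A * B / eps in n_large.
have c10 : 0 <= c1 by rewrite divr_ge0 ?mulr_ge0// ?(ltW eps0)//; lra.
set kap := q / 2 + W / (4 * v) in n_large.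
have kap0 : 0 <= kap by rewrite addr_ge0// divr_ge0// mulr_ge0// ltW.
have sc : c1 + 3 * kap <= s.
  by rewrite -(ler_pXn2r (n := 3))// ?nnegrE ?(addr_ge0 c10 (mulr_ge0 (ler0n _ _) kap0))// s3.
have s1 : 1 <= s.
  rewrite -(ler_pXn2r (n := 3))// ?nnegrE// s3 expr1n ler1n.
  exact: leq_trans n4.
have tp : 0 < t by rewrite (lt_le_trans _ t8)// mulr_gt0.
have n23 : n%:R `^ (2 / 3) = s ^+ 2 by rewrite -s3 powR_cube.
have ls : l <= 3 * s.
  have sp : 0 < s by exact: lt_le_trans s1.
  have -> : l = 3 * ln s by rewrite /l -s3 lnXn// -[LHS]mulr_natl.
  by rewrite ler_pM2l ?ltr0n// ltW// ln_sublinear.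
have y23 : s ^+ 2 * t <= (2 * n%:R / l) `^ (2 / 3) * l.
  have -> : s ^+ 2 * t = (n%:R / l) `^ (2 / 3) * l.
    rewrite -s3 -t3 -expr_div_n powR_cube ?divr_ge0//.
    by field; rewrite gt_eqF.
  rewrite ler_wpM2r// ge0_ler_powR ?nnegrE ?divr_ge0 ?mulr_ge0 ?ler0n//.
  rewrite ler_wpM2r ?invr_ge0// ler_peMl ?ler0n//; lra.
have -> : expR (((2 * n%:R / l) `^ (2 / 3) - W) * l) `^ (4 * v)^-1 =
    expR (((2 * n%:R / l) `^ (2 / 3) * l - W * l) / (4 * v)).
  by rewrite {1}/powR gt_eqF ?expR_gt0// expRK mulrBl mulrC.
have sQ : Num.sqrt Q <= expR (q * l / 2).
  rewrite -[leLHS]lnK ?posrE ?sqrtr_gt0// ler_expR ln_sqrt//; lra.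
have AB : 32 * A * B <= eps * expR c1.
  have -> : 32 * A * B = eps * c1 by rewrite /c1 [RHS]mulrC divfK// gt_eqF.
  rewrite ler_pM2l// (le_trans _ (expR_ge1Dx _))//; lra.
rewrite -expRN n23; set Y := _ / (4 * v).
apply: (@le_trans _ _ (eps * expR c1 * expR (q * l / 2) * expR (- Y))).
  rewrite ler_wpM2r ?expR_ge0//; apply: ler_pM => //.
  by rewrite mulr_ge0// mulr_ge0//; lra.
rewrite -!mulrA ler_pM2l// -!expRD ler_expR.
have v4 : 0 < 4 * v by lra.
have Yge : (s ^+ 2 * t - W * l) / (4 * v) <= Y.
  by rewrite /Y ler_pM2r ?invr_gt0// lerD2r.
have t2 : 2 * s ^+ 2 <= s ^+ 2 * t / (4 * v).
  rewrite ler_pdivlMr// (_ : 2 * s ^+ 2 * (4 * v) = s ^+ 2 * (8 * v)); last by ring.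
  exact: ler_wpM2l (sqr_ge0 s) _ _ t8.
have kl : kap * l = q * l / 2 + W * l / (4 * v) by rewrite /kap; field; rewrite gt_eqF.
have kls : kap * l <= kap * (3 * s) by rewrite ler_wpM2l.
have ss : (c1 + 3 * kap) * s <= s ^+ 2 by rewrite expr2 ler_wpM2r.
have cs : c1 <= c1 * s by rewrite ler_peMr.
rewrite mulrBl in Yge; lra.
Qed.
End envelope_rate.

Lemma rate_constants (R : realType) (a : R) : 0 <= a -> exists c C : R,
  [/\ 16 <= c, 1024 * (a + 1) <= c ^+ 2, 64 <= C & 1024 * ((1 + c) * (a + 1)) <= C].
Proof.
move=> a0; have : 0 <= 1024 :> R by rewrite ler0n.
move: 1024 => k k0; pose c := 16 + k * (a + 1).
have ka : 0 <= k * (a + 1) by rewrite mulr_ge0//; lra.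
have c16 : 16 <= c by rewrite lerDl.
have kca : 0 <= k * ((1 + c) * (a + 1)) by rewrite mulr_ge0// mulr_ge0//; lra.
exists c, (64 + k * ((1 + c) * (a + 1))); split => //.
- have : c * 1 <= c * c by rewrite ler_wpM2l; lra.
  rewrite -expr2 /c; lra.
- lra.
- lra.
Qed.

Lemma r_rate_ge0 (R : realType) (M : R) n : (0 < n)%N -> 0 <= r_rate M n.
Proof.
move=> n0; rewrite /r_rate; case: ifP => // _.
rewrite le_min ler01 mulr_ge0 ?divr_ge0 ?ln_ge0 ?ler1n ?ler0n//.
by rewrite addr_ge0 ?powR_ge0.
Qed.

Theorem theorem1 (R : realType) :
  exists K : R, 0 < K /\
  forall (d : measure_display) (X : measurableType d) (P : probability X R)
    (dO : measure_display) (Omega : measurableType dO)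
    (Pr : probability Omega R) (Xs : nat -> Omega -> X)
    (Fam : set (X -> R)) (Fenv : X -> R) (v A : R)
    (dim : nat -> nat) (h : forall n, X -> 'cV[R]_(dim n))
    (pinv : forall m, 'M[R]_m -> 'M[R]_m),
  iid_sample Pr P Xs ->
  (forall f, Fam f -> measurable_fun setT f) ->
  (forall n, (0 < n)%N -> feature_map P (h n)) ->
  pseudo_inverse pinv ->
  ((fun n => \int[P]_x (leverage P (h n) x ^+ 2)) =o_\oo (fun n => n%:R : R)
     /\ (fun n => ln (leverage_sup P (h n))) =O_\oo (fun n => ln n%:R : R)
   \/ (fun n => leverage_sup P (h n) * ln (2 * dim n)%:R)
        =o_\oo (fun n => n%:R : R)) ->
  countable Fam ->
  (forall x, 0 <= Fenv x) ->
  (forall f x, Fam f -> `|f x| <= Fenv x) ->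
  (supnorm Fenv < +oo)%E ->
  0 < v -> 1 <= A -> VC_class Fam Fenv v A ->
  let M n := resid_sup P (h n) Fam in
  let a n := a_rate K v A (fine (supnorm Fenv)) (leverage_sup P (h n)) n in
  let tau n := tau_rate (M n) (L2const P (h n) Fam) (a n) in
  let r n := r_rate (M n) n in
  a =o_\oo (fun n => expR (- (n%:R `^ (2 / 3))) : R) /\
  bigO_P Pr
    (fun n w => excess_risk_sup P (h n) (@pinv (dim n)) n
                  (fun i => Xs i w) Fam)
    (fun n => Num.max (gamma2 P (h n) Fam) (tau n * Num.sqrt (r n)) * r n).
Proof.
(* a_n enters the risk bound only through tau_n >= L_n^2, so K plays no role there. *)
exists 1; split => // d X P dO Omega Pr Xs Fam Fenv v A dim h pinv iid mF hfm pinvP cond cntF.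
move=> F0 Fle Ffin v0 A1 vc M a tau r.
pose B := fine (supnorm Fenv); pose Q n := leverage_sup P (h n).
have FB x : 0 <= Fenv x <= B.
  by rewrite F0/= (le_trans (ler_norm _))// (supnormP Ffin).
have B0 : 0 <= B by have /andP[? ?] := FB point; lra.
have Q1 n : (0 < n)%N -> 1 <= Q n.
  by move=> /hfm hn; have [T hT] := exists_whitening hn; exact: (leverage_sup_ge1 hn hT).
have ln2m n : (0 < n)%N -> 1 / 2 <= ln (2 * dim n)%:R :> R.
  move=> n0; have m0 : (0 < dim n)%N by case: (hfm n n0).
  have lm : 0 <= ln (dim n)%:R :> R by rewrite ln_ge0// ler1n.
  by rewrite natrM lnM ?posrE ?ltr0n//; have := ln2_ge R; lra.
(* (a) provides this directly; under (b), log(2 d_n) >= 1/2 and eventually Q log(2 d_n) <= n/2, so Q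
   <= n and q = 1 works. *)
have [q q0 Qq] : exists2 q : R, 0 <= q & \forall n \near \oo, ln (Q n) <= q * ln n%:R.
  case: cond => [[_ /eqO_exP[q q0 Hq]]|/eqoP Hq].
    exists q; first exact: ltW.
    near=> n; have n0 : (0 < n)%N by near: n; exact: nbhs_infty_gt.
    have : `|ln (Q n)| <= q * `|ln n%:R| by near: n.
    rewrite [X in _ <= _ * X]ger0_norm ?ln_ge0 ?ler1n//.
    exact: le_trans (ler_norm _).
  exists 1 => //; near=> n; have n0 : (0 < n)%N by near: n; exact: nbhs_infty_gt.
  have : `|Q n * ln (2 * dim n)%:R| <= 1 / 2 * `|n%:R : R|.
    by near: n; apply: Hq; lra.
  have l2 := ln2m n n0; have Qn := Q1 n n0.
  rewrite (ger0_norm (ler0n _ n)) ger0_norm; last by rewrite mulr_ge0//; lra.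
  move=> H; rewrite mul1r ler_ln ?posrE ?ltr0n//; last by lra.
  have : Q n * (1 / 2) <= Q n * ln (2 * dim n)%:R by rewrite ler_wpM2l//; lra.
  lra.
have [nu nuP [mpre Prnu]] := iid_sample_law iid.
(* Stated for every whitening matrix at once, because [T] depends on n and is obtained only after n
   is fixed. *)
have gram_small (eps : R) : 0 < eps -> \forall n \near \oo,
    forall T : 'M[R]_(dim n), T *m gram (mean P) (h n) *m T^T = 1%:M ->
    pr nu (gram_bad (whitened (h n) T) n) <= eps.
  move=> eps0; case: cond => [[/eqoP Hq _]|/eqoP Hq].
    near=> n => T hT; have n0 : (0 < n)%N by near: n; exact: nbhs_infty_gt.
    have n0' : (0 : R) < n%:R by rewrite ltr0n.
    apply: (le_trans (gram_bad_second_moment nuP (hfm n n0) hT n0)).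
    have : `|\int[P]_x (leverage P (h n) x ^+ 2)| <= eps / 4 * `|n%:R : R|.
      by near: n; apply: Hq; lra.
    rewrite (ger0_norm (ler0n _ n)) => /(le_trans (ler_norm _)) H.
    by rewrite ler_pdivrMr//; lra.
  have k0 : 0 < 512 :> R by rewrite ltr0n.
  (* This makes 12 (512 dlt) at most 1, as [gram_bad_log_dim] requires, and 36 times that quantity
     at most [eps]. *)
  pose e' := Num.min 1 (eps / 36) / (12 * 512) : R.
  have e'0 : 0 < e' by rewrite divr_gt0 ?mulr_gt0// lt_min ltr01 divr_gt0.
  have {}Hq := Hq e' e'0.
  near=> n => T hT; have n0 : (0 < n)%N by near: n; exact: nbhs_infty_gt.
  have n0' : (0 : R) < n%:R by rewrite ltr0n.
  have := gram_bad_log_dim nuP (hfm n n0) hT n0 erefl.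
  set dlt := _ / n%:R.
  have : dlt <= e'.
    rewrite ler_pdivrMr//.
    have : `|Q n * ln (2 * dim n)%:R| <= e' * `|n%:R : R| by near: n.
    by rewrite (ger0_norm (ler0n _ n)); exact: le_trans (ler_norm _).
  rewrite ler_pdivlMr ?mulr_gt0// le_min => /andP[d1 d2].
  have E : dlt * (12 * 512) = 12 * (512 * dlt) by rewrite mulrCA [dlt * _]mulrC.
  rewrite E in d1 d2; move=> /(_ d1) H; apply: (le_trans H).
  by rewrite mulrC -ler_pdivlMr.
split.
  apply/eqoP => eps eps0; near=> n.
  have n4 : (4 <= n)%N by near: n; exact: nbhs_infty_ge.
  have n0 : (0 < n)%N by exact: leq_trans n4.
  rewrite (ger0_norm (expR_ge0 _)) ger0_norm; last first.
    rewrite mulr_ge0 ?invr_ge0 ?powR_ge0// mulr_ge0 ?sqrtr_ge0// mulr_ge0//.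
    by rewrite mulr_ge0//; lra.
  apply: (@a_rate_le R v A B (Q n) q eps n) => //; first exact: Q1.
  - by near: n.
  - suff : expR ((8 * v) ^+ 3) <= n%:R.
      by rewrite -ler_ln ?posrE ?expR_gt0 ?ltr0n// expRK.
    by near: n; exact: nbhs_infty_ger.
  - by near: n; exact: nbhs_infty_ger.
have gam0 n : 0 <= gamma2 P (h n) Fam by exact: gamma2_ge0.
apply: bigO_P_near.
(* An enumeration indexed by [nat] needs a member; over the empty family the supremum is 0 by the
   convention of [nnsup]. *)
have [Fam0|/set0P Fam_neq0] := eqVneq Fam set0.
  exists 1 => // eps eps0; near=> n; have n0 : (0 < n)%N by near: n; exact: nbhs_infty_gt.
  exists set0 => //; rewrite measure0 lee_fin (ltW eps0); split=> // w /=.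
  apply/negP; rewrite -leNgt gee0_abs ?nnsup_ge0//.
  apply: nnsup_le => [|f]; last by rewrite Fam0.
  by rewrite lee_fin mulr1 mulr_ge0 ?r_rate_ge0// le_max gam0.
have [F FF Fsurj] := countable_enum cntF Fam_neq0.
pose ent := 2 * (1 + v * (`|ln (4 * A * B)| + q + 2)).
have ent0 : 0 <= ent.
  rewrite mulr_ge0// addr_ge0// mulr_ge0 ?(ltW v0)//.
  by apply: addr_ge0 => //; exact: addr_ge0.
have [c [C [c16 ca C64 Ca]]] := rate_constants ent0.
have C0 : 0 < C by exact: lt_le_trans C64.
exists (4 * C); first by rewrite mulr_gt0.
move=> eps eps0; have eps2 : 0 < eps / 2 by rewrite divr_gt0.
have gs := gram_small _ eps2; near=> n.
have n4 : (4 <= n)%N by near: n; exact: nbhs_infty_ge.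
have n0 : (0 < n)%N by exact: leq_trans n4.
have [T hT] := exists_whitening (hfm n n0).
have Qqn : ln (Q n) <= q * ln n%:R by near: n.
have [E mE [PE HE]] := finite_sample_bound nuP (hfm n n0) hT mF Fle FB vc v0 A1
  (pinvP (dim n)) (a n) erefl c16 ca C64 Ca FF Fsurj n4 q0 Qqn.
have small : pr nu (gram_bad (whitened (h n) T) n) <= eps / 2.
  exact: (near gs n _ T hT).
have mG : measurable (gram_bad (whitened (h n) T) n).
  by apply: measurable_gram_bad => b; exact: (measurable_whitened (hfm n n0) T).
have small2 : 40 / n%:R <= eps / 2 :> R.
  rewrite ler_pdivrMr ?ltr0n// mulrC -ler_pdivrMr ?divr_gt0//.
  by near: n; exact: nbhs_infty_ger.
have mGE := measurableU _ _ mG mE.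
exists ((fun w => (Xs ^~ w : sequences X)) @^-1` (gram_bad (whitened (h n) T) n `|` E)).
  exact: mpre.
split.
  rewrite [leLHS]Prnu// -EFin_pr// lee_fin (le_trans (pr_setU _ mG mE))//; lra.
move=> w; apply: contraPP => wgood; apply/negP; rewrite -leNgt gee0_abs ?nnsup_ge0//.
have [wG wE] : ~ gram_bad (whitened (h n) T) n (Xs ^~ w) /\ ~ E (Xs ^~ w).
  by split => ?; apply: wgood; [left|right].
by have := HE _ wG wE; rewrite mulrA [X in (X%:E)%E]mulrC.
Unshelve. all: by end_near.
Qed.
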